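(* Let $\mathcal{A}'$ be a hyperplane arrangement in $V=\mathbb{K}^\ell$, let $H\subset V$ be a linear hyperplane with $H\notin\mathcal{A}'$, and let $\mathcal{A}=\mathcal{A}'\cup\{H\}$. If $\mathcal{A}'$ is tame and both $\mathcal{A}'$ and $\mathcal{A}$ are locally free along $H$, then $\mathcal{A}$ and $\mathcal{A}^H$ are both tame.
   Context: Let $\mathbb{K}$ be a field, $V=\mathbb{K}^\ell$, $S=\mathbb{K}[x_1,\ldots,x_\ell]$ the coordinate ring of $V$. An arrangement $\mathcal{A}$ in $V$ is a finite set of linear hyperplanes of $V$; for each $H\in\mathcal{A}$ fix a linear form $\alpha_H\in V^*$ with $H=\ker\alpha_H$, and put $Q(\mathcal{A})=\prod_{H\in\mathcal{A}}\alpha_H$. Let $\Omega^1_V=\bigoplus_{i=1}^\ell S\,dx_i$ and $\Omega^p_V=\wedge^p\Omega^1_V$. For $0\le p\le\ell$ the module of logarithmic $p$-forms is $$\Omega^p(\mathcal{A})=\{\omega\in \tfrac{1}{Q(\mathcal{A})}\Omega^p_V \mid Q(\mathcal{A})\,d\alpha_H\wedge\omega\in\alpha_H\Omega^{p+1}_V\ (\forall H\in\mathcal{A})\}.$$ $\mathcal{A}$ is free if $\Omega^1(\mathcal{A})$ is a free $S$-module (of rank $\ell$). $\mathcal{A}$ is tame if $\mathrm{pd}_S\,\Omega^p(\mathcal{A})\le p$ for all $0\le p\le\ell$, where $\mathrm{pd}_S$ is projective dimension over $S$. For $x\in V$ let $\mathcal{A}_x=\{L\in\mathcal{A}\mid x\in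 L\}$ (an arrangement in $V$). For $X\subset V$, $\mathcal{A}$ is locally free along $X$ if $\mathcal{A}_x$ is free for all $0\ne x\in X$. For $H\in\mathcal{A}$, the restriction $\mathcal{A}^H=\{H\cap L\mid L\in\mathcal{A}\setminus\{H\}\}$ is an arrangement in $H\cong\mathbb{K}^{\ell-1}$, whose logarithmic forms and tameness are defined over $\overline{S}=S/\alpha_HS$. *)

(* Defs.v *)
From HB Require Import structures.
From mathcomp Require Import all_boot all_order all_algebra.
From mathcomp Require Import finmap mpoly boolp.

Set Implicit Arguments.
Unset Strict Implicit.
Unset Printing Implicit Defensive.

Import GRing.Theory.
Local Open Scope ring_scope.

Section Modules.
Variable R : nzRingType.

Definition free_of_rank (M : lmodType R) (n : nat) : Prop :=
  exists e : 'I_n -> M,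
    forall m : M, exists! c : {ffun 'I_n -> R}, m = \sum_(i < n) c i *: e i.

Definition projective (P : lmodType R) : Prop :=
  forall (M N : lmodType R) (g : {linear M -> N}) (f : {linear P -> N}),
    (forall y : N, exists x : M, g x = y) ->
    exists h : {linear P -> M}, forall x : P, g (h x) = f x.

Definition exact (A B C : lmodType R) (f : A -> B) (g : B -> C) : Prop :=
  forall y : B, g y = 0 <-> exists x : A, f x = y.

(* pd M <= n: there is a projective resolution
   0 -> P n -> ... -> P 1 -> P 0 -> M -> 0. *)
Definition pd_le (M : lmodType R) (n : nat) : Prop :=
  exists (P : nat -> lmodType R) (d : forall i, {linear P i.+1 -> P i})
         (e : {linear P 0%N -> M}),
    [/\ forall i, projective (P i),
        forall m : M, exists x : P 0%N, e x = m,
        exact (d 0%N) e,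
        forall i, exact (d i.+1) (d i)
      & forall i, (n < i)%N -> forall x : P i, x = 0].

End Modules.

Section FractionModule.
Variable R : idomainType.
Implicit Types (a b : R) (x y : {fraction R}).

Definition frac_scale a x : {fraction R} := tofrac a * x.

Fact frac_scaleA a b x : frac_scale a (frac_scale b x) = frac_scale (a * b) x.
Proof. by rewrite /frac_scale rmorphM mulrA. Qed.
Fact frac_scale1 : left_id 1 frac_scale.
Proof. by move=> x; rewrite /frac_scale rmorph1 mul1r. Qed.
Fact frac_scaleDr : right_distributive frac_scale +%R.
Proof. by move=> a x y; rewrite /frac_scale mulrDr. Qed.
Fact frac_scaleDl x : {morph frac_scale^~ x : a b / a + b}.
Proof. by move=> a b; rewrite /frac_scale rmorphD mulrDl. Qed.

HB.instance Definition _ :=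
  GRing.Zmodule_isLmodule.Build R {fraction R}
    frac_scaleA frac_scale1 frac_scaleDr frac_scaleDl.

End FractionModule.

Section RationalForms.
Variables (K : fieldType) (n : nat).
Local Notation S := {mpoly K[n]}.

(* The exterior algebra on dx_1, ..., dx_n over the fraction field of S:
   w I is the coefficient of dx_I = dx_{i_1} /\ ... /\ dx_{i_p}, where
   I = {i_1 < ... < i_p}. *)
Definition rform := {ffun {set 'I_n} -> {fraction S}}.
HB.instance Definition _ := GRing.Lmodule.on rform.

Definition inversions (I J : {set 'I_n}) : nat :=
  #|[set ij in setX I J | (ij.2 < ij.1)%N]|.

(* dx_I /\ dx_J = (-1) ^ inversions I J dx_{I u J} for disjoint I and J. *)
Definition wedge (w v : rform) : rform :=
  [ffun J : {set 'I_n} => \sum_(I : {set 'I_n} | I \subset J)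
     (-1) ^+ inversions I (J :\: I) * w I * v (J :\: I)].

Definition dpoly (f : S) : rform :=
  [ffun I : {set 'I_n} => \sum_(i < n | I == [set i]) tofrac (mderiv i f)].

(* The elements of Omega^p_V, i.e. the homogeneous forms of degree p with
   coefficients in S. *)
Definition regular_form (p : nat) (w : rform) : Prop :=
  forall I : {set 'I_n},
    if #|I| == p then exists f : S, w I = tofrac f else w I = 0.

Fact regular_form0 p : regular_form p 0.
Proof.
move=> I; case: ifP => _; last by rewrite ffunE.
by exists 0; rewrite ffunE rmorph0.
Qed.

Fact regular_formD p (a : S) w v :
  regular_form p w -> regular_form p v -> regular_form p (a *: w + v).
Proof.
move=> hw hv I; move: (hw I) (hv I); case: ifP => _.
  case=> f wf [g vg]; exists (a * f + g).
  by rewrite !ffunE wf vg rmorphD rmorphM.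
by move=> w0 v0; rewrite !ffunE w0 v0 scaler0 addr0.
Qed.

Fact wedge0 w : wedge w 0 = 0.
Proof.
by apply/ffunP => J; rewrite !ffunE big1 // => I _; rewrite ffunE mulr0.
Qed.

Fact wedge_linear w : linear (wedge w).
Proof.
move=> a u v; apply/ffunP => J; rewrite !ffunE scaler_sumr -big_split /=.
by apply: eq_bigr => I _; rewrite !ffunE mulrDr /GRing.scale/= /frac_scale mulrCA.
Qed.

End RationalForms.

Section Arrangements.
Variables (K : fieldType) (V : vectType K).
Implicit Types (A : {fset {vspace V}}) (H L : {vspace V}).

Definition hyperplane H : bool := ((\dim H).+1 == \dim {:V})%N.

Definition arrangement A : Prop := forall H, H \in A -> hyperplane H.

Fact ex_form H : exists a : 'Hom(V, K^o), hyperplane H ==> (lker a == H).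
Proof.
case hH : (hyperplane H); last by exists 0.
pose W := (H^C)%VS; pose w := vpick W.
have dW : \dim W = 1%N by rewrite dimv_compl -(eqP hH) subSnn.
have WH0 : (W :&: H = 0)%VS by rewrite capvC capv_compl.
have wW : w \in W by exact: memv_pick.
have w0 : w != 0 by rewrite vpick0 -dimv_eq0 dW.
have defW : (<<[tuple w]>> = W)%VS.
  rewrite span_seq1; apply/eqP.
  by rewrite eqEdim dim_vline w0 dW -memvE wW.
pose f v : K^o := coord [tuple w] ord0 (daddv_pi W H v).
have f_lin : linear f by move=> c u v; rewrite /f !linearP.
pose F : {linear V -> K^o} := HB.pack f (GRing.isLinear.Build K V K^o *:%R f f_lin).
exists (linfun F); apply/eqP/vspaceP => v; rewrite memv_ker lfunE /= /f.
have vE : v = daddv_pi W H v + daddv_pi H W v.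
  by rewrite daddv_pi_add // addvC addv_complf memvf.
apply/eqP/idP => [c0|vH].
  have /coord_span : daddv_pi W H v \in <<[tuple w]>>%VS by rewrite defW memv_pi.
  by rewrite big_ord1 c0 scale0r => p0; rewrite vE p0 add0r memv_pi.
have HW0 : (H :&: W = 0)%VS by rewrite capvC.
have -> : daddv_pi W H v = 0.
  by apply: (addIr (daddv_pi H W v)); rewrite -vE add0r daddv_pi_id.
by rewrite linear0.
Qed.

Definition alpha H : 'Hom(V, K^o) := xchoose (ex_form H).

Fact lker_alpha H : hyperplane H -> lker (alpha H) = H.
Proof. by move=> hH; have /implyP/(_ hH)/eqP := xchooseP (ex_form H). Qed.

Definition localization A (x : V) : {fset {vspace V}} := [fset L in A | x \in L]%fset.

(* The subspaces H :&: L, seen inside the vector space H; the coordinate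
   ring of H is S / alpha_H S. *)
Definition restriction A H : {fset {vspace (subvs_of H)}} :=
  [fset (linfun (vsval : subvs_of H -> V) @^-1: L)%VS | L in A `\ H]%fset.

End Arrangements.

Section LogarithmicForms.
Variables (K : fieldType) (V : vectType K) (n : nat).
(* b is meant to be a basis of V. The coordinate ring of V is {mpoly K[n]},
   where 'X_0, ..., 'X_(n.-1) are the coordinates dual to b. *)
Variable b : n.-tuple V.
Implicit Types (A : {fset {vspace V}}) (H L : {vspace V}).

Definition form_poly (a : 'Hom(V, K^o)) : {mpoly K[n]} :=
  \sum_(i < n) a (tnth b i) *: 'X_i.

Definition defining_poly A : {mpoly K[n]} :=
  \prod_(H <- A) form_poly (alpha H).

(* As Q(A) != 0, membership of w in Omega^p_V / Q(A) is stated as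
   Q(A) w \in Omega^p_V. *)
Definition log_form A (p : nat) (w : rform K n) : Prop :=
  regular_form p (defining_poly A *: w) /\
  forall H, H \in A ->
    exists2 v, regular_form p.+1 v &
      defining_poly A *: wedge (dpoly (form_poly (alpha H))) w =
      form_poly (alpha H) *: v.

Definition log_pred A p : {pred rform K n} := [pred w | `[< log_form A p w >]].

Fact log_submod_closed A p : submod_closed (log_pred A p).
Proof.
split=> [|a w v]; rewrite !inE.
  apply/asboolP; split; first by rewrite scaler0; apply: regular_form0.
  by move=> H _; exists 0; [apply: regular_form0 | rewrite wedge0 !scaler0].
move=> /asboolP[rw lw] /asboolP[rv lv]; apply/asboolP; split.
  by rewrite scalerDr scalerA mulrC -scalerA; apply: regular_formD.
move=> H HA; have [w' rw' ew] := lw H HA; have [v' rv' ev] := lv H HA.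
exists (a *: w' + v'); first exact: regular_formD.
by rewrite wedge_linear !scalerDr ev !scalerA !(mulrC _ a) -!scalerA ew.
Qed.

HB.instance Definition _ A p :=
  GRing.isSubmodClosed.Build {mpoly K[n]} (rform K n) (log_pred A p)
    (log_submod_closed A p).

Record Omega A (p : nat) : Type :=
  LogForm { log_val :> rform K n; _ : log_val \in log_pred A p }.

HB.instance Definition _ A p := [isSub for @log_val A p].
HB.instance Definition _ A p := [Choice of Omega A p by <:].
HB.instance Definition _ A p := [SubChoice_isSubLmodule of Omega A p by <:].

Definition free_arrangement A : Prop := free_of_rank (Omega A 1) n.

Definition tame A : Prop :=
  forall p : nat, (p <= n)%N -> pd_le (Omega A p) p.

Definition locally_free_along A (X : {pred V}) : Prop :=
  forall x : V, x \in X -> x != 0 -> free_arrangement (localization A x).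

End LogarithmicForms.

Definition std_basis (K : fieldType) (l : nat) : l.-tuple 'rV[K]_l :=
  [tuple delta_mx ord0 i | i < l].

(* Main.v *)
(** Multiplication by [Q(A)] turns [Omega^p(A)] into the module [Lp A p] of the
    p-forms [w] with coefficients in [S] such that [alpha_L] divides
    [w(v_1, ..., v_p)] for all [L] in [A] and [v_1, ..., v_p] in [L]. Restriction
    to [H] and residue along [H] give exact sequences
      0 -> Lp A p -> Lp A' p -> N p   and   0 -> Lp A' p -> Lp A p -> Lp A^H (p-1),
    where [N p] is isomorphic to [Lp A^H p]. For [x != 0] in [H], freeness of
    [A'_x] and [A_x] makes their modules [Lp] projective, so that the images of
    the last maps are projective over [S / alpha_H S]; as they agree with the
    targets in codimension one, they are equal to them. Hence, for [A' u {H}]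
    itself, the images and the targets agree outside the origin.

    Over a polynomial ring in [k] variables a submodule of a free module has
    projective dimension at most [k-1], and if it has projective dimension at
    most [k-2] then it contains every vector multiplied into it by all variables.
    For [p >= l-2] the first bound is enough. For [p <= l-3], by induction on
    [p], the second sequence bounds the projective dimension of [Lp A p] from
    those of [Lp A' p] and [Lp A^H (p-1)], and then the first one bounds that of
    [Lp A^H p]; in both cases the images have projective dimension at most [l-3],
    hence are equal to the targets. *)
Require Import Defs.
From HB Require Import structures.
From mathcomp Require Import all_boot all_order all_algebra.
From mathcomp Require Import finmap mpoly freeg boolp.
From mathcomp Require Import ring.
From mathcomp Require classical_sets.

Set Implicit Arguments.
Unset Strict Implicit.
Unset Printing Implicit Defensive.

Import GRing.Theory.
Local Open Scope ring_scope.

(** * Projective dimension *)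

(** Localization, Ext and depth are avoided: every bound comes from short exact sequences of
    arbitrary, not necessarily finitely generated, modules. Agreement outside the origin means that
    for [x != 0] in [H] the product of the forms of the hyperplanes missing [x], restricted to [H],
    multiplies the target into the image. Points over [K] suffice for any field: linear forms over
    [K] without a common nonzero zero in [H] span all linear forms on [H], hence the variables. The
    bound [k-2] is the threshold for gluing because the residue field does not have projective
    dimension at most [k-1]. [N p] differs from [Lp A^H p] because several hyperplanes of [A'] may
    have the same trace on [H]: it is the multiple of [Lp A^H p] by the product of the trace forms,
    each raised to its multiplicity minus one. Freeness concerns 1-forms only. It reaches all
    degrees through two matrices with product [Q], that of a basis of 1-forms and that of the dual
    logarithmic vector fields: pulling back along them exhibits [Lp] as a retract of a free module,
    so that no exterior power of a module is formed. *)

Section LinearMaps.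
Variables (R : nzRingType) (A B : lmodType R) (f : A -> B).

Definition mklin (fl : linear f) : {linear A -> B} :=
  HB.pack f (GRing.isLinear.Build R A B *:%R f fl).

Lemma mklinE (fl : linear f) x : mklin fl x = f x.
Proof. by []. Qed.

End LinearMaps.

Lemma eq_prod (A B : Type) (z z' : A * B) : z.1 = z'.1 -> z.2 = z'.2 -> z = z'.
Proof. by case: z z' => a b [a' b'] /= -> ->. Qed.

Definition surj (A B : Type) (f : A -> B) : Prop := forall y, exists x, f x = y.

Lemma surj_section (A B : Type) (f : A -> B) : surj f -> exists g, cancel g f.
Proof. by move=> fs; have [g gP] := boolp.choice fs; exists g. Qed.

Section Submodules.
Variables (R : nzRingType) (M : lmodType R).

(** The carrier is a [Prop], since kernels, images and modules cut out by divisibility are given by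
    existential statements; excluded middle turns it into the module [subm]. *)
Record submod : Type := Submod {
  scar :> M -> Prop;
  scar0 : scar 0;
  scarL : forall a x y, scar x -> scar y -> scar (a *: x + y) }.

Variable U : submod.

Lemma scarD x y : U x -> U y -> U (x + y).
Proof. by move=> Ux Uy; rewrite -[x]scale1r; apply: scarL. Qed.
Lemma scarZ a x : U x -> U (a *: x).
Proof. by move=> Ux; rewrite -[_ *: x]addr0; apply: scarL => //; apply: scar0. Qed.
Lemma scarN x : U x -> U (- x).
Proof. by move=> Ux; rewrite -scaleN1r; apply: scarZ. Qed.
Lemma scarB x y : U x -> U y -> U (x - y).
Proof. by move=> Ux Uy; apply: scarD => //; apply: scarN. Qed.
Lemma scar_sum (I : Type) (r : seq I) (P : pred I) (F : I -> M) :
  (forall i, P i -> U (F i)) -> U (\sum_(i <- r | P i) F i).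
Proof. by move=> UF; apply: big_ind => //; [exact: scar0 | exact: scarD]. Qed.

Definition scar_pred : {pred M} := [pred x | `[< U x >]].

Fact scar_pred_closed : submod_closed scar_pred.
Proof.
split=> [|a x y]; rewrite !inE; first by apply/asboolP; apply: scar0.
by move=> /asboolP Ux /asboolP Uy; apply/asboolP; apply: scarL.
Qed.

HB.instance Definition _ :=
  GRing.isSubmodClosed.Build R M scar_pred scar_pred_closed.

Record subm : Type := Subm { sval_ :> M; _ : sval_ \in scar_pred }.

HB.instance Definition _ := [isSub for sval_].
HB.instance Definition _ := [Choice of subm by <:].
HB.instance Definition _ := [SubChoice_isSubLmodule of subm by <:].

Lemma submP (x : subm) : U (sval_ x).
Proof. by case: x => x Ux; apply/asboolP. Qed.

Definition mksub x (Ux : U x) : subm := Subm (introT (asboolP _) Ux).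

Lemma subm_inj : injective sval_. Proof. exact: val_inj. Qed.

Fact sval_linear : linear sval_. Proof. by []. Qed.
Definition incl : {linear subm -> M} := mklin sval_linear.

End Submodules.

Section Factor.
Variables (R : nzRingType) (A M : lmodType R) (U : submod M).
Variables (f : {linear A -> M}) (fU : forall x, U (f x)).

Definition factor_fun x : subm U := mksub (fU x).
Fact factor_linear : linear factor_fun.
Proof. by move=> a x y; apply: subm_inj; rewrite /= linearP. Qed.
Definition factor : {linear A -> subm U} := mklin factor_linear.
Lemma factorE x : sval_ (factor x) = f x. Proof. by []. Qed.
End Factor.

Section KernelImage.
Variables (R : nzRingType) (A B : lmodType R) (f : {linear A -> B}).

Fact ker0 : f 0 = 0. Proof. exact: linear0. Qed.
Fact kerL a x y : f x = 0 -> f y = 0 -> f (a *: x + y) = 0.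
Proof. by move=> fx fy; rewrite linearP fx fy scaler0 addr0. Qed.
Definition kersub : submod A := Submod ker0 kerL.

Fact im0 : exists x, f x = 0. Proof. by exists 0; rewrite linear0. Qed.
Fact imL a y z : (exists x, f x = y) -> (exists x, f x = z) ->
  exists x, f x = a *: y + z.
Proof. by move=> [x <-] [x' <-]; exists (a *: x + x'); rewrite linearP. Qed.
Definition imsub : submod B := @Submod _ B (fun y => exists x, f x = y) im0 imL.

End KernelImage.

Section Ses.
Variable R : nzRingType.

Definition ses (A B C : lmodType R) (i : {linear A -> B}) (f : {linear B -> C}) :=
  [/\ injective i, exact i f & surj f].

Lemma ses_ker (B C : lmodType R) (f : {linear B -> C}) :
  surj f -> ses (incl (kersub f)) f.
Proof.
move=> fs; split=> //; first exact: subm_inj.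
move=> y; split=> [fy|[x <-]]; first by exists (@mksub _ _ (kersub f) y fy).
exact: (submP x).
Qed.

Lemma exact0 (A B C : lmodType R) (i : {linear A -> B}) (f : {linear B -> C}) :
  exact i f -> forall x, f (i x) = 0.
Proof. by move=> e x; apply/e; exists x. Qed.

(** One syzygy at a time, which suits induction better than a whole resolution; [pd_le_pdr] and
    [pdr_pd_le] relate it to [pd_le]. That any projective cover may serve in the successor case is
    [pdr_cover_ker]. *)
Fixpoint pdr n (M : lmodType R) : Prop :=
  if n is m.+1 then
    exists (K P : lmodType R) (i : {linear K -> P}) (e : {linear P -> M}),
      [/\ ses i e, projective P & pdr m K]
  else projective M.

Lemma proj_retract (P Q : lmodType R) (i : {linear Q -> P}) (r : {linear P -> Q}) :
  cancel i r -> projective P -> projective Q.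
Proof.
move=> ir pP M N g f gs.
have [h hP] := pP M N g (f \o r)%FUN gs.
by exists (h \o i)%FUN => x /=; rewrite hP /= ir.
Qed.

Lemma proj_prod (P Q : lmodType R) :
  projective P -> projective Q -> projective (P * Q)%type.
Proof.
move=> pP pQ M N g f gs.
have il : linear (fun x : P => (x, 0 : Q)).
  by move=> a x y; apply: eq_prod; rewrite //= scaler0 addr0.
have jl : linear (fun y : Q => (0 : P, y)).
  by move=> a x y; apply: eq_prod; rewrite //= scaler0 addr0.
have [h hP] := pP M N g (f \o mklin il)%FUN gs.
have [k kP] := pQ M N g (f \o mklin jl)%FUN gs.
have Hl : linear (fun z : P * Q => h z.1 + k z.2).
  by move=> a [x y] [x' y'] /=; rewrite !linearP scalerDr addrACA.
exists (mklin Hl) => -[x y] /=.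
rewrite linearD hP kP /= -linearD; congr (f _).
by apply: eq_prod; rewrite /= ?addr0 ?add0r.
Qed.

Lemma proj_zero (P : lmodType R) : (forall x : P, x = 0) -> projective P.
Proof.
move=> P0 M N g f gs.
have zl : linear (fun _ : P => 0 : M) by move=> a x y; rewrite scaler0 addr0.
by exists (mklin zl) => x /=; rewrite (P0 x) !linear0.
Qed.

Lemma pdr_iso n (A B : lmodType R) (i : {linear A -> B}) :
  injective i -> surj i -> pdr n A -> pdr n B.
Proof.
move=> ii is_ pA.
have [r ri] := surj_section is_.
have rl : linear r by move=> a x y; apply: ii; rewrite ri linearP !ri.
case: n pA => [|n] /=.
  by apply: (@proj_retract _ _ (mklin rl) i) => y /=; rewrite ri.
move=> [K [P [k [e [[ik ex es] pP pK]]]]].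
exists K, P, k, (i \o e)%FUN; split=> //; split=> //.
- move=> y; rewrite -ex /=; split=> [|->]; last exact: linear0.
  by rewrite -[RHS](linear0 i) => /ii.
- by move=> y; have [x <-] := is_ y; have [z <-] := es x; exists z.
Qed.

Lemma pdrS n (M : lmodType R) : pdr n M -> pdr n.+1 M.
Proof.
elim: n M => [|n IHn] M.
  move=> pM; exists (subm (kersub (idfun : {linear M -> M}))), M.
  exists (incl _), idfun; split=> //; first by apply: ses_ker => y; exists y.
  by apply: proj_zero => x; apply: subm_inj; apply: (submP x).
move=> [K [P [i [e [se pP pK]]]]].
by exists K, P, i, e; split=> //; apply: IHn.
Qed.

Lemma pdr_le m n (M : lmodType R) : (m <= n)%N -> pdr m M -> pdr n M.
Proof.
move=> /subnK <-; elim: (n - m)%N => // k IHk pM.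
by rewrite addSn; apply: pdrS; apply: IHk.
Qed.

Section Pullback.
Variables (B C P : lmodType R) (f : {linear B -> C}) (e : {linear P -> C}).
Fact pb0 : f (0 : B * P).1 = e (0 : B * P).2. Proof. by rewrite !linear0. Qed.
Fact pbL a (x y : B * P) : f x.1 = e x.2 -> f y.1 = e y.2 ->
  f (a *: x + y).1 = e (a *: x + y).2.
Proof. by move=> h h'; rewrite /= !linearP h h'. Qed.
Definition pullback : submod (B * P)%type := Submod pb0 pbL.
Fact pb1_linear : linear (fun z : subm pullback => (sval_ z).1). Proof. by []. Qed.
Fact pb2_linear : linear (fun z : subm pullback => (sval_ z).2). Proof. by []. Qed.
Definition pb1 := mklin pb1_linear.
Definition pb2 := mklin pb2_linear.
Lemma pbE z : f (pb1 z) = e (pb2 z). Proof. exact: (submP z). Qed.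

Variables (A K : lmodType R) (i : {linear A -> B}) (k : {linear K -> P}).

Fact pb_inl_linear : linear (fun x : A => (i x, 0 : P)).
Proof. by move=> a x y; apply: eq_prod; rewrite /= ?linearP // scaler0 addr0. Qed.
Fact pb_inr_linear : linear (fun x : K => (0 : B, k x)).
Proof. by move=> a x y; apply: eq_prod; rewrite /= ?linearP // scaler0 addr0. Qed.


(** The fibre product of [f] and [e] is an extension in two ways: of [P] by the kernel of [f] here,
    of [B] by the kernel of [e] in [pullback_ses1]. *)
Lemma pullback_ses2 : ses i f -> exists j : {linear A -> subm pullback}, ses j pb2.
Proof.
move=> [ii ex fs].
have jU x : pullback (mklin pb_inl_linear x).
  by rewrite /= (exact0 ex) linear0.
exists (factor jU); split.
- by move=> x y /(congr1 (@sval_ _ _ _)) [] /ii.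
- move=> z; split=> [z0|[x <-]] //.
  have /ex [x xz] : f (pb1 z) = 0 by rewrite pbE z0 linear0.
  by exists x; apply: subm_inj; rewrite factorE /= xz -z0 -surjective_pairing.
- move=> y; have [x xy] := fs (e y).
  by exists (@mksub _ _ pullback (x, y) xy).
Qed.

Lemma pullback_ses1 : ses k e -> exists j : {linear K -> subm pullback}, ses j pb1.
Proof.
move=> [ii ex fs].
have jU x : pullback (mklin pb_inr_linear x).
  by rewrite /= (exact0 ex) linear0.
exists (factor jU); split.
- by move=> x y /(congr1 (@sval_ _ _ _)) [] /ii.
- move=> z; split=> [z0|[x <-]] //.
  have /ex [x xz] : e (pb2 z) = 0 by rewrite -pbE z0 linear0.
  by exists x; apply: subm_inj; rewrite factorE /= xz -z0 -surjective_pairing.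
- move=> y; have [x xy] := fs (f y).
  by exists (@mksub _ _ pullback (y, x) (esym xy)).
Qed.

End Pullback.

Lemma ses_split (A B C : lmodType R) (i : {linear A -> B}) (f : {linear B -> C}) :
  ses i f -> projective C ->
  exists h : {linear (C * A)%type -> B}, injective h /\ surj h.
Proof.
move=> [ii ex fs] pC; have [s sP] := pC B C f idfun fs.
have hl : linear (fun z : C * A => s z.1 + i z.2).
  by move=> a [x y] [x' y'] /=; rewrite !linearP scalerDr addrACA.
exists (mklin hl); split.
  move=> [x y] [x' y'] /= e.
  have ex' : x = x'.
    move: (congr1 f e); rewrite !linearD !(exact0 ex) !addr0.
    by have := sP x; have := sP x'; rewrite /= => -> ->.
  by move: e; rewrite ex' => /addrI /ii ->.
move=> b; have /ex [a ab] : f (b - s (f b)) = 0.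
  by rewrite linearB; have := sP (f b) => /= ->; rewrite subrr.
by exists (f b, a); rewrite /= ab addrC subrK.
Qed.

(** Horseshoe lemma: a cover of [A] and a lift to [B] of a cover of [C] together cover [B], and the
    three kernels again form a short exact sequence. *)
Lemma pdr_ses_mid n (A B C : lmodType R) (i : {linear A -> B}) (f : {linear B -> C}) :
  ses i f -> pdr n A -> pdr n C -> pdr n B.
Proof.
elim: n A B C i f => [|n IHn] A B C i f s.
  move=> pA pC; have [h [hi hs]] := ses_split s pC.
  exact: (@pdr_iso 0 _ _ h hi hs (proj_prod pC pA)).
move=> [KA [P [a [eA [sA pP pKA]]]]] [KC [Q [c [eC [sC pQ pKC]]]]].
have [ii ex fs] := s; have [ai ax as_] := sA; have [ci cx cs] := sC.
have [l lP] := pQ B C f eC fs.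
have el : linear (fun z : P * Q => i (eA z.1) + l z.2).
  by move=> k [x y] [x' y'] /=; rewrite !linearP scalerDr addrACA.
pose e := mklin el.
have es : surj e.
  move=> b; have [q qb] := cs (f b).
  have /ex [x xb] : f (b - l q) = 0 by rewrite linearB lP qb subrr.
  by have [p px] := as_ x; exists (p, q); rewrite /= px xb subrK.
exists (subm (kersub e)), (P * Q)%type, (incl _), e; split; first exact: ses_ker.
  exact: proj_prod.
have kC (z : subm (kersub e)) : kersub eC (sval_ z).2.
  have /(congr1 f) := submP z; rewrite /= linearD (exact0 ex) add0r lP.
  by rewrite linear0.
pose gl : linear (fun z : subm (kersub e) => (sval_ z).2) := fun a x y => erefl.
pose g := factor (fun z => kC z : kersub eC (mklin gl z)).
have jl : linear (fun x : subm (kersub eA) => (sval_ x, 0 : Q)).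
  by move=> k x y; apply: eq_prod; rewrite //= scaler0 addr0.
have jU x : kersub e (mklin jl x).
  by rewrite /= (submP x) !linear0 addr0.
pose j := factor jU.
have sg : ses j g.
  split.
  - by move=> x y /(congr1 (@sval_ _ _ _)) [] /subm_inj.
  - move=> z; split=> [gz|[x <-]]; last exact: subm_inj.
    have z2 : (sval_ z).2 = 0 by have := congr1 (@sval_ _ _ _) gz.
    have z1 : kersub eA (sval_ z).1.
      have /= := submP z; rewrite z2 linear0 addr0 -[RHS](linear0 i).
      by move/ii.
    exists (mksub z1); apply: subm_inj => /=.
    by rewrite -z2 -surjective_pairing.
  - move=> q; have /= qC := submP q.
    have /ex [x xq] : f (l (sval_ q)) = 0 by rewrite lP.
    have [p px] := as_ (- x).
    have pq : kersub e (p, sval_ q).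
      by rewrite /= px linearN xq addNr.
    by exists (mksub pq); apply: subm_inj.
apply: (IHn _ _ _ j g sg).
- have [k1 [k2 k3]] : exists k : {linear KA -> subm (kersub eA)},
      injective k /\ surj k.
    exists (factor (fun x => exact0 ax x : kersub eA (a x))).
    split=> [x y /(congr1 (@sval_ _ _ _)) /ai //|y].
    have /ax [x xy] := submP y; by exists x; apply: subm_inj.
  exact: pdr_iso k2 k3 pKA.
- have [k1 [k2 k3]] : exists k : {linear KC -> subm (kersub eC)},
      injective k /\ surj k.
    exists (factor (fun x => exact0 cx x : kersub eC (c x))).
    split=> [x y /(congr1 (@sval_ _ _ _)) /ci //|y].
    have /cx [x xy] := submP y; by exists x; apply: subm_inj.
  exact: pdr_iso k2 k3 pKC.
Qed.

(** A cover of [B] also covers [C], and the kernel of the composite is an extension of [A] by the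
    syzygy of [B]. *)
Lemma pdr_ses_right n (A B C : lmodType R) (i : {linear A -> B}) (f : {linear B -> C}) :
  ses i f -> pdr n A -> pdr n.+1 B -> pdr n.+1 C.
Proof.
move=> [ii ex fs] pA [K [P [k [e [[ki kx ks] pP pK]]]]].
pose g : {linear P -> C} := (f \o e)%FUN.
have gs : surj g.
  by move=> c; have [b <-] := fs c; have [p <-] := ks b; exists p.
exists (subm (kersub g)), P, (incl _), g; split=> //; first exact: ses_ker.
have [r rP] : exists r : subm (kersub g) -> A, forall x, i (r x) = e (sval_ x).
  suff h (x : subm (kersub g)) : exists y, i y = e (sval_ x) by have [r rP] := boolp.choice h; exists r.
  by apply/ex; apply: (submP x).
have rl : linear r.
  by move=> a x y; apply: ii; rewrite (linearP i) !rP /= linearP.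
have jU x : kersub g (k x) by rewrite /= (exact0 kx) linear0.
apply: (@pdr_ses_mid n K _ A (factor jU) (mklin rl)) => //; split.
- by move=> x y /(congr1 (@sval_ _ _ _)) /ki.
- move=> z; rewrite /=; split=> [rz|[x <-]].
    have /kx [x xz] : e (sval_ z) = 0 by rewrite -rP rz linear0.
    by exists x; apply: subm_inj.
  by apply: ii; rewrite rP factorE (exact0 kx) linear0.
- move=> a; have [p pa] := ks (i a).
  have pU : kersub g p by rewrite /= pa (exact0 ex).
  by exists (mksub pU); apply: ii; rewrite /= rP.
Qed.

(** A cover of [Q * A] also covers [A], with kernel an extension of the projective [Q] by the old
    syzygy. *)
Lemma pdr_summand n (Q A : lmodType R) :
  projective Q -> pdr n (Q * A)%type -> pdr n A.
Proof.
move=> pQ.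
have sl : linear (fun z : Q * A => z.2) by [].
have fl : linear (fun z : Q * A => z.1) by [].
have jl : linear (fun y : A => (0 : Q, y)).
  by move=> a x y; apply: eq_prod; rewrite //= scaler0 addr0.
case: n => [|n].
  by apply: (@proj_retract _ _ (mklin jl) (mklin sl)).
move=> [K [P [k [e [[ki kx ks] pP pK]]]]].
pose g : {linear P -> A} := (mklin sl \o e)%FUN.
have gs : surj g by move=> a; have [p pa] := ks (0, a); exists p; rewrite /= pa.
exists (subm (kersub g)), P, (incl _), g; split=> //; first exact: ses_ker.
have jU x : kersub g (k x) by rewrite /= (exact0 kx).
apply: (@pdr_ses_mid n K _ Q (factor jU) (mklin fl \o e \o incl _)%FUN) => //.
  split.
  - by move=> x y /(congr1 (@sval_ _ _ _)) /ki.
  - move=> z; rewrite /=; split=> [rz|[x <-]].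
      have /kx [x xz] : e (sval_ z) = 0.
        by have /= := submP z; case: (e _) rz => a b /= -> ->.
      by exists x; apply: subm_inj.
    by rewrite factorE (exact0 kx).
  - move=> q; have [p pq] := ks (q, 0).
    have pU : kersub g p by rewrite /= pq.
    by exists (mksub pU); rewrite /= pq.
exact: (@pdr_le 0).
Qed.

(** Schanuel's argument: the fibre product of [B] with a cover [P] of [C] is an extension of [B] by
    the syzygy of [C], and it splits as [P * A] because [P] is projective. *)
Lemma pdr_ses_left n (A B C : lmodType R) (i : {linear A -> B}) (f : {linear B -> C}) :
  ses i f -> pdr n B -> pdr n.+1 C -> pdr n A.
Proof.
move=> s pB [K [P [k [e [sk pP pK]]]]].
have [j1 s1] := pullback_ses1 f sk.
have [j2 s2] := pullback_ses2 e s.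
have [h [hi hs]] := ses_split s2 pP.
apply: (pdr_summand pP).
have pY := pdr_ses_mid s1 pK pB.
have [r ri] := surj_section hs.
have rl : linear r by move=> a x y; apply: hi; rewrite ri linearP !ri.
apply: (@pdr_iso n _ _ (mklin rl)) pY => [x y /= exy|y].
  by rewrite -(ri x) -(ri y) exy.
by exists (h y); apply: hi; rewrite /= ri.
Qed.

Lemma pdr_cover_ker n (M P : lmodType R) (e : {linear P -> M}) :
  projective P -> surj e -> pdr n.+1 M -> pdr n (subm (kersub e)).
Proof.
by move=> pP es; apply: pdr_ses_left (ses_ker es) _; apply: (@pdr_le 0).
Qed.

End Ses.

(** * Change of rings *)

Section PdLe.
Variable R : nzRingType.

Lemma pd_le_pdr (M : lmodType R) n : pd_le M n -> pdr n M.
Proof.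
elim: n M => [|n IHn] M [P [d [e [pP es ex0 ex P0]]]].
  apply: (@pdr_iso _ 0 _ _ e _ es (pP 0%N)) => x y exy.
  have /ex0 [z zxy] : e (x - y) = 0 by rewrite linearB /= exy subrr.
  by apply/eqP; rewrite -subr_eq0 -zxy (P0 1%N isT z) linear0.
exists (subm (kersub e)), (P 0%N), (incl _), e; split=> //; first exact: ses_ker.
apply: IHn; exists (fun i => P i.+1), (fun i => d i.+1).
exists (factor (fun x => exact0 ex0 x : kersub e (d 0%N x))).
split=> // [m|y|i ni x]; last exact: P0.
  by have /ex0 [x xm] := submP m; exists x; apply: subm_inj.
rewrite -(ex 0%N y); split=> [/(congr1 (@sval_ _ _ _))//|y0].
exact: subm_inj.
Qed.

Section Glue.
Variables (P0 : lmodType R) (P : nat -> lmodType R).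
Variables (d : forall i, {linear P i.+1 -> P i}) (d0 : {linear P 0%N -> P0}).
Definition consP i : lmodType R := if i is j.+1 then P j else P0.
Definition consd i : {linear consP i.+1 -> consP i} :=
  match i with 0 => d0 | j.+1 => d j end.
End Glue.

Lemma pdr_pd_le (M : lmodType R) n : pdr n M -> pd_le M n.
Proof.
elim: n M => [|n IHn] M.
  move=> pM; pose Z : lmodType R := subm (kersub (idfun : {linear M -> M})).
  have Z0 (x : Z) : x = 0 by apply: subm_inj; apply: (submP x).
  exists (consP M (fun=> Z)), (@consd M (fun=> Z) (fun=> (idfun : {linear Z -> Z})) (incl _)), idfun; split=> //.
  - by case=> [|i] //=; apply: proj_zero.
  - by move=> m; exists m.
  - move=> y; split=> [y0|[x <-]]; last by rewrite (Z0 x) linear0.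
    by exists 0; rewrite linear0 -y0.
  - case=> [|i] y; split=> _; try by rewrite (Z0 y) linear0.
      by exists 0; rewrite (Z0 y) linear0.
    by exists 0; rewrite (Z0 y) linear0.
  - by case.
move=> [K [P0 [i [e [[ii ex es] pP0 /IHn]]]]].
move=> [P [d [eK [pP eKs exK exd Pz]]]].
exists (consP P0 P), (consd d (i \o eK)%FUN), e; split=> //.
- by case.
- move=> y; rewrite ex; split=> [[x <-]|[x <-]] /=.
    by have [z <-] := eKs x; exists z.
  by exists (eK x).
- case=> [|j] y; last exact: exd.
  rewrite -exK /=; split=> [|->]; last exact: linear0.
  by rewrite -[RHS](linear0 i) => /ii.
- by case=> // j nj x; apply: Pz.
Qed.

End PdLe.

Section FreeModules.
Variables (R : nzRingType) (T : choiceType).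
Local Notation F := {freeg T / R}.

Definition gen (c : R) (x : T) : F := Freeg [:: (c, x)].

Lemma coeff_gen c x y : coeff y (gen c x) = c * (x == y)%:R.
Proof. exact: coeffU. Qed.

Lemma freeg_sum (D : F) : D = \sum_(z <- dom D) gen (coeff z D) z.
Proof. by rewrite /gen freeg_sumE. Qed.

Lemma freeg_ext (D D' : F) : (forall x, coeff x D = coeff x D') -> D = D'.
Proof. by move=> h; apply/eqP/freeg_eqP. Qed.

Lemma gen_scale a c x : a *: gen c x = gen (a * c) x.
Proof. by apply: freeg_ext => y; rewrite coeffZ !coeff_gen mulrA. Qed.

Lemma gen_add c d x : gen (c + d) x = gen c x + gen d x.
Proof. by apply: freeg_ext => y; rewrite coeffD !coeff_gen mulrDl. Qed.

Lemma sum_dom (A : zmodType) (L : T -> R -> A) (D : F) (r : seq T) :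
  (forall x, L x 0 = 0) -> uniq r -> {subset dom D <= r} ->
  \sum_(z <- r) L z (coeff z D) = \sum_(z <- dom D) L z (coeff z D).
Proof.
move=> L0 ur sr; rewrite (bigID (mem (dom D))) /= [X in _ + X]big1 => [|x].
  rewrite addr0 -big_filter; apply: perm_big; apply: uniq_perm.
  - exact: filter_uniq.
  - exact: uniq_dom.
  - by move=> x; rewrite mem_filter; case xD: (x \in dom D); rewrite //= sr.
by move/coeff_outdom ->.
Qed.

(** The supports of [D], [D'] and [D + D'] differ, so the three sums are extended by zero terms to
    one common list. *)
Lemma freeg_additive (A : zmodType) (L : T -> R -> A) :
  (forall x, {morph L x : a b / a + b}) ->
  {morph (fun D : F => \sum_(z <- dom D) L z (coeff z D)) : D D' / D + D'}.
Proof.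
move=> La D D' /=.
have L0 x : L x 0 = 0 by apply: (addrI (L x 0)); rewrite -La !addr0.
pose r := undup (dom (D + D') ++ dom D ++ dom D').
rewrite -!(@sum_dom _ _ _ r) ?undup_uniq // => [|x xD|x xD|x xD].
- by rewrite -big_split; apply: eq_bigr => x _; rewrite coeffD La.
- by rewrite mem_undup !mem_cat xD !orbT.
- by rewrite mem_undup !mem_cat xD !orbT.
- by rewrite mem_undup !mem_cat xD.
Qed.

Lemma freeg_sum_gen (A : zmodType) (L : T -> R -> A) c x : L x 0 = 0 ->
  \sum_(z <- dom (gen c x)) L z (coeff z (gen c x)) = L x c.
Proof.
move=> L0; have [->|c0] := eqVneq c 0.
  by rewrite /gen freegU0 dom0 big_nil L0.
by rewrite /gen domU // big_seq1 coeffU eqxx mulr1.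
Qed.

Section Lift.
Variables (A : lmodType R) (f : T -> A).
Definition lift_fun (D : F) : A := \sum_(z <- dom D) coeff z D *: f z.
Fact lift_linear : linear lift_fun.
Proof.
have fa : forall x, {morph (fun c : R => c *: f x) : a b / a + b}.
  by move=> x a b; rewrite scalerDl.
move=> a D D'; rewrite /lift_fun (freeg_additive fa); congr (_ + _).
rewrite -(@sum_dom _ (fun x c => c *: f x) (a *: D) (dom D)).
- by rewrite scaler_sumr; apply: eq_bigr => x _; rewrite coeffZ scalerA.
- by move=> x; rewrite scale0r.
- exact: uniq_dom.
- exact: domZ_subset.
Qed.
(* Opaque, so that [/=] does not expose the sum. *)
Fact flift_key : {h : {linear F -> A} | forall c x, h (gen c x) = c *: f x}.
Proof.
exists (mklin lift_linear) => c x.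
by rewrite mklinE /lift_fun (@freeg_sum_gen _ (fun x c => c *: f x)) ?scale0r.
Qed.
Definition flift : {linear F -> A} := sval flift_key.
Lemma flift_gen c x : flift (gen c x) = c *: f x.
Proof. exact: (svalP flift_key). Qed.
End Lift.


Lemma freeg_proj : projective F.
Proof.
move=> M N g f gs; have [s sK] := surj_section gs.
exists (flift (fun x => s (f (gen 1 x)))) => D.
rewrite [D]freeg_sum !linear_sum; apply: eq_bigr => x _.
rewrite flift_gen !linearZ /= sK; have -> : gen (coeff x D) x = coeff x D *: gen 1 x by rewrite gen_scale mulr1.
by rewrite linearZ.
Qed.

Lemma freeg_lin_ext (A : lmodType R) (f g : {linear F -> A}) :
  (forall x, f (gen 1 x) = g (gen 1 x)) -> f =1 g.
Proof.
move=> fg D; rewrite [D]freeg_sum !linear_sum; apply: eq_bigr => x _.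
have -> : gen (coeff x D) x = coeff x D *: gen 1 x by rewrite gen_scale mulr1.
by rewrite !linearZ /= fg.
Qed.

End FreeModules.

Definition fgcover (R : nzRingType) (M : lmodType R) : {linear {freeg M / R} -> M} :=
  flift id.

Lemma fgcover_gen (R : nzRingType) (M : lmodType R) c (x : M) :
  fgcover M (gen c x) = c *: x.
Proof. exact: flift_gen. Qed.

Lemma fgcover_surj (R : nzRingType) (M : lmodType R) : surj (fgcover M).
Proof. by move=> x; exists (gen 1 x); rewrite fgcover_gen scale1r. Qed.

(** * Restriction of scalars and projective dimension *)

Section Restriction.
Variables (R S : nzRingType).

Definition restr of {rmorphism R -> S} := fun M : lmodType S => (M : Type).
HB.instance Definition _ phi (M : lmodType S) := GRing.Zmodule.on (restr phi M).

Variable phi : {rmorphism R -> S}.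

Section RestrLmodule.
Variable M : lmodType S.
Definition restr_scale (a : R) (x : restr phi M) : restr phi M := phi a *: (x : M).
Fact restr_scaleA a b x : restr_scale a (restr_scale b x) = restr_scale (a * b) x.
Proof. by rewrite /restr_scale scalerA rmorphM. Qed.
Fact restr_scale1 : left_id 1 restr_scale.
Proof. by move=> x; rewrite /restr_scale rmorph1 scale1r. Qed.
Fact restr_scaleDr : right_distributive restr_scale +%R.
Proof. by move=> a x y; rewrite /restr_scale scalerDr. Qed.
Fact restr_scaleDl x : {morph restr_scale^~ x : a b / a + b}.
Proof. by move=> a b; rewrite /restr_scale rmorphD scalerDl. Qed.
HB.instance Definition _ := GRing.Zmodule_isLmodule.Build R (restr phi M)
  restr_scaleA restr_scale1 restr_scaleDr restr_scaleDl.
Lemma restrZ a (x : restr phi M) : a *: x = phi a *: (x : M) :> M.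
Proof. by []. Qed.
End RestrLmodule.

Section RestrMap.
Variables (A B : lmodType S) (f : {linear A -> B}).
Fact restr_map_linear : linear (f : restr phi A -> restr phi B).
Proof. by move=> a x y; rewrite -[RHS]/(phi a *: f x + f y) -linearP. Qed.
Definition restr_map : {linear restr phi A -> restr phi B} := mklin restr_map_linear.
End RestrMap.

Lemma restr_ses (A B C : lmodType S) (i : {linear A -> B}) (f : {linear B -> C}) :
  ses i f -> ses (restr_map i) (restr_map f).
Proof. by move=> [ii ex fs]; split. Qed.

End Restriction.

(** Unlike in [pdr_summand] the other factor is arbitrary. The product of the two free covers has
    the product of the two kernels as its kernel, so the induction stays within products. *)
Lemma pdr_prod_right (R : nzRingType) n (A B : lmodType R) :
  pdr n (A * B)%type -> pdr n A.
Proof.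
elim: n A B => [|n IHn] A B.
  have sl : linear (fun z : A * B => z.1) by [].
  have jl : linear (fun y : A => (y, 0 : B)).
    by move=> a x y; apply: eq_prod; rewrite //= scaler0 addr0.
  by apply: (@proj_retract _ _ _ (mklin jl) (mklin sl)).
move=> pAB.
pose PA := {freeg A / R}; pose PB := {freeg B / R}.
have el : linear (fun z : PA * PB => (fgcover A z.1, fgcover B z.2)).
  by move=> a [x y] [x' y']; apply: eq_prod; rewrite /= linearP.
pose e := mklin el.
have es : surj e.
  move=> [a b]; have [x xa] := fgcover_surj a; have [y yb] := fgcover_surj b.
  by exists (x, y); rewrite /e mklinE /= xa yb.
have pP : projective (PA * PB)%type by apply: proj_prod; apply: freeg_proj.
have pK := pdr_cover_ker pP es pAB.
pose KA := subm (kersub (fgcover A)); pose KB := subm (kersub (fgcover B)).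
have k1 (z : subm (kersub e)) : kersub (fgcover A) (sval_ z).1.
  by have := congr1 fst (submP z).
have k2 (z : subm (kersub e)) : kersub (fgcover B) (sval_ z).2.
  by have := congr1 snd (submP z).
have hl : linear (fun z : subm (kersub e) => (mksub (k1 z), mksub (k2 z))).
  by move=> a x y; apply: eq_prod; apply: subm_inj.
have pKK : pdr n (KA * KB)%type.
  apply: (@pdr_iso _ n _ _ (mklin hl)) pK => [x y|[x y]].
    rewrite !mklinE => /= [[h1 h2]]; apply: subm_inj.
    by rewrite [LHS]surjective_pairing [RHS]surjective_pairing h1 h2.
  have exy : kersub e (sval_ x, sval_ y).
    by rewrite /e /= (submP x) (submP y).
  by exists (mksub exy); apply: eq_prod; apply: subm_inj.
exists KA, PA, (incl _), (fgcover A); split; first exact: (ses_ker (@fgcover_surj _ _)).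
  exact: freeg_proj.
exact: IHn pKK.
Qed.

(* [t] behaves like a variable of [R = Rb[t]] as far as the quotient by [t] is
   concerned: [pi] kills [t] and [s] is a section of it. *)
Section ChangeOfRings.
Variables (R Rb : comNzRingType) (pi : {rmorphism R -> Rb}) (s : {rmorphism Rb -> R}).
Variable t : R.
Hypothesis piK : cancel s pi.
Hypothesis pit : pi t = 0.
Hypothesis treg : forall x, t * x = 0 -> x = 0.
Hypothesis tdiv : forall x, exists y, x = s (pi x) + t * y.

Local Notation "M %:pi" := (restr pi M) (at level 2).

(** Multiplication by [t] on the free [R]-module with the same basis is a resolution of length
    one. *)
Lemma restr_free_pdr1 (T : choiceType) : pdr 1 ({freeg T / Rb} : lmodType Rb)%:pi.
Proof.
pose F := {freeg T / R}; pose Fb := {freeg T / Rb}.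
pose e : {linear F -> Fb %:pi} := flift (fun x => gen 1 x : Fb %:pi).
have coefe D x : coeff x (e D : Fb) = pi (coeff x D).
  rewrite [D in LHS]freeg_sum linear_sum /= raddf_sum /=.
  rewrite [D in RHS]freeg_sum !raddf_sum /=; apply: eq_bigr => y _.
  rewrite /e /= [X in coeff _ X](flift_gen (fun x => gen 1 x : Fb %:pi)).
  by rewrite restrZ gen_scale !coeff_gen mulr1 rmorphM rmorph_nat.
have es : surj e.
  move=> D; exists (\sum_(z <- dom D) gen (s (coeff z D)) z).
  rewrite linear_sum [RHS]freeg_sum; apply: eq_bigr => x _.
  by rewrite /= flift_gen restrZ gen_scale mulr1 piK.
exists F, F, ( *:%R t : {linear F -> F}), e; split; [split | |] => //.
- move=> D D' /(congr1 (fun D => coeff _ D)) tD; apply: freeg_ext => x.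
  apply/eqP; rewrite -subr_eq0; apply/eqP/treg.
  by have := tD x; rewrite !coeffZ => tD'; rewrite mulrBr tD' subrr.
- move=> D; split=> [D0|[D' <-]]; last first.
    by rewrite linearZ /= restrZ pit scale0r.
  have [q qP] := boolp.choice tdiv.
  exists (\sum_(z <- dom D) gen (q (coeff z D)) z).
  rewrite /= scaler_sumr [RHS]freeg_sum; apply: eq_bigr => x _.
  rewrite gen_scale; congr (gen _ x).
  by rewrite [RHS]qP -coefe D0 (coeff0 Rb) rmorph0 add0r.
- exact: freeg_proj.
- exact: freeg_proj.
Qed.

(** A projective [Rb]-module is a summand of a free one, which has dimension at most one over [R];
    syzygies do the rest. *)
Lemma pdr_restr n (M : lmodType Rb) : pdr n M -> pdr n.+1 M%:pi.
Proof.
elim: n M => [|n IHn] M pM.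
  have s0 := ses_ker (@fgcover_surj _ M).
  have [h [hi hs]] := ses_split s0 pM.
  apply: (@pdr_prod_right _ 1 _ (subm (kersub (fgcover M)))%:pi).
  have [r ri] := surj_section hs.
  have rl : linear r by move=> a x y; apply: hi; rewrite ri linearP !ri.
  pose r' : {linear ({freeg M / Rb} : lmodType Rb)%:pi ->
    (M%:pi * (subm (kersub (fgcover M)))%:pi)%type} :=
    restr_map pi (mklin rl).
  apply: (@pdr_iso _ 1 _ _ r'); last exact: restr_free_pdr1.
    by move=> x y exy; rewrite -(ri x) -(ri y); congr (h _).
  by move=> y; exists (h y); apply: hi; rewrite ri.
have [K [P [i [e [se pP pK]]]]] := pM.
apply: (pdr_ses_right (restr_ses pi se)); first exact: IHn.
by apply: pdrS; apply: IHn; apply: (@pdr_le _ 0).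
Qed.

End ChangeOfRings.

(* For a derivation [dq] along [pi], [dbl] is [M * M] on which [a] acts by the
   matrix ((pi a, 0), (dq a, pi a)). *)
Record deriv_along (R Rb : nzRingType) (pi : {rmorphism R -> Rb}) : Type := Deriv {
  der :> R -> Rb;
  derD : {morph der : a b / a + b};
  derM : forall a b, der (a * b) = der a * pi b + pi a * der b }.

Section Dbl.
Variables (R Rb : nzRingType) (pi : {rmorphism R -> Rb}).
Definition dbl of deriv_along pi := fun M : lmodType Rb => (M * M)%type.
HB.instance Definition _ dq (M : lmodType Rb) := GRing.Zmodule.on (dbl dq M).

Variables (dq : deriv_along pi) (M : lmodType Rb).
Definition dbl_scale (a : R) (z : dbl dq M) : dbl dq M :=
  (pi a *: z.1, pi a *: z.2 + dq a *: z.1).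
Fact der1 : dq 1 = 0.
Proof.
have := derM dq 1 1; rewrite mulr1 rmorph1 mulr1 mul1r => h.
by apply: (addrI (dq 1)); rewrite addr0 -h.
Qed.
Fact dbl_scaleA a b x : dbl_scale a (dbl_scale b x) = dbl_scale (a * b) x.
Proof.
apply: eq_prod; rewrite /= rmorphM ?scalerA // derM scalerDr scalerDl !scalerA.
by rewrite -addrA [in RHS](addrC (_ *: _) (_ *: _)).
Qed.
Fact dbl_scale1 : left_id 1 dbl_scale.
Proof.
by move=> x; apply: eq_prod; rewrite /= rmorph1 ?der1 !scale1r // scale0r addr0.
Qed.
Fact dbl_scaleDr : right_distributive dbl_scale +%R.
Proof.
by move=> a x y; apply: eq_prod; rewrite /= !scalerDr // addrACA.
Qed.
Fact dbl_scaleDl x : {morph dbl_scale^~ x : a b / a + b}.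
Proof.
by move=> a b; apply: eq_prod; rewrite /= rmorphD ?derD !scalerDl // addrACA.
Qed.
HB.instance Definition _ := GRing.Zmodule_isLmodule.Build R (dbl dq M)
  dbl_scaleA dbl_scale1 dbl_scaleDr dbl_scaleDl.
End Dbl.

Section ChangeOfRingsDown.
Variables (R Rb : comNzRingType) (pi : {rmorphism R -> Rb}) (s : {rmorphism Rb -> R}).
Variable t : R.
Hypothesis piK : cancel s pi.
Hypothesis pit : pi t = 0.
Hypothesis treg : forall x, t * x = 0 -> x = 0.
Hypothesis tdiv : forall x, exists y, x = s (pi x) + t * y.

(** The derivative in [t] at [t = 0]: if [x = s (pi x) + t * q x], then [pi (q x)] satisfies the
    Leibniz rule along [pi]. *)
Lemma quotient_derivation : exists dq : deriv_along pi, dq t = 1.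
Proof.
have [q qP] := boolp.choice tdiv.
have qU x y : x = s (pi x) + t * y -> q x = y.
  move=> xy; apply/eqP; rewrite -subr_eq0; apply/eqP/treg.
  apply: (addrI (s (pi x))); rewrite mulrBr addrA -qP.
  by rewrite {1}xy addrK addr0.
have qD : {morph (fun x => pi (q x)) : a b / a + b}.
  move=> a b /=; rewrite -rmorphD; congr (pi _); apply: qU.
  by rewrite {1}[a]qP {1}[b]qP !rmorphD mulrDr addrACA.
have qM a b : pi (q (a * b)) = pi (q a) * pi b + pi a * pi (q b).
  have -> : q (a * b) = q a * s (pi b) + a * q b.
    apply: qU; rewrite {1}[b]qP mulrDr mulrDr {1}[a]qP mulrDl !rmorphM.
    by rewrite -addrA !mulrA [a * t]mulrC.
  by rewrite rmorphD !rmorphM piK.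
exists (Deriv qD qM) => /=.
by rewrite (qU t 1) ?rmorph1 // pit rmorph0 add0r mulr1.
Qed.

(** Let [K] be the kernel of the free cover [F] of [M] over [R]; it is projective. Sending [m] to
    the class of [t] times its generator embeds [M] in [K / t K], and [psi], built from the
    derivation, is a retraction of this embedding. So a lift of [f \o psi] to [K], evaluated at [t]
    times the generators, lifts [f]. *)
Lemma restr_proj_down (M : lmodType Rb) :
  pdr 1 (restr pi M) -> projective M.
Proof.
move=> p1; have [dq dqt] := quotient_derivation.
pose F : lmodType R := {freeg M / R}; pose RM : lmodType R := restr pi M.
pose e : {linear F -> RM} := flift (fun m : M => m : RM).
have eg c m : e (gen c m) = pi c *: m :> M by rewrite /e flift_gen.
have es : surj e by move=> m; exists (gen 1 m); rewrite eg rmorph1 scale1r.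
have pK := pdr_cover_ker (@freeg_proj R M) es p1.
pose K : lmodType R := subm (kersub e); rewrite /= in pK.
pose Q : {linear F -> dbl dq M} := flift (fun m : M => (m, 0) : dbl dq M).
have Qg c m : Q (gen c m) = (pi c *: m, dq c *: m) :> M * M.
  by rewrite /Q flift_gen; apply: eq_prod; rewrite //= scaler0 add0r.
have fstl : linear (fun z : dbl dq M => z.1 : RM) by [].
have Q1 D : (Q D : M * M).1 = e D.
  apply: (@freeg_lin_ext _ _ _ (mklin fstl \o Q)%FUN e) => m.
  by rewrite eg -[LHS]/((Q (gen 1 m) : M * M).1) Qg.
(* The second component is [R]-linear on [K] only, where the first one vanishes. *)
have psil : linear (fun k : K => (Q (sval_ k) : M * M).2 : RM).
  move=> a x y; have x0 : e (sval_ x) = 0 :> M := submP x.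
  by rewrite /= linearP /= Q1 x0 scaler0 addr0.
pose psi : {linear K -> RM} := mklin psil.
have tK m : kersub e (gen t m) by rewrite /= eg pit scale0r.
have psit m : psi (mksub (tK m)) = m by rewrite /psi mklinE /= Qg dqt scale1r.
move=> A B g f gs.
have [h hP] := pK _ _ (restr_map pi g) (restr_map pi f \o psi)%FUN gs.
have kK a x y : kersub e (gen 1 (a *: x + y) - gen (s a) x - gen 1 y).
  by rewrite /= !linearB /= !eg !rmorph1 piK !scale1r addrAC addrK subrr.
(* The generators of [F] are not additive in [m]; the defect lies in [t K], and it disappears in
   [A], which [t] kills. *)
have tKl a x y : mksub (tK (a *: x + y)) =
  s a *: mksub (tK x) + mksub (tK y) + t *: mksub (kK a x y).
  apply: subm_inj => /=; rewrite !scalerBr !gen_scale !mulr1 [s a * t]mulrC.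
  by rewrite [RHS]addrC -[X in _ = X + _]addrA -opprD subrK.
have rl : linear (fun m => h (mksub (tK m)) : A).
  move=> a x y; rewrite tKl !linearD !linearZ /= !restrZ piK pit.
  by rewrite [X in _ + X]scale0r addr0.
exists (mklin rl) => m; rewrite mklinE.
by have := hP (mksub (tK m)) => /= ->; rewrite -[RHS]/(f m) -[in RHS](psit m).
Qed.

(** Induction on syzygies: over [R] the free cover has dimension one, so the bound of the kernel
    drops together with that of [M], down to [restr_proj_down]. *)
Lemma pdr_restr_down n (M : lmodType Rb) :
  pdr n.+1 (restr pi M) -> pdr n M.
Proof.
elim: n M => [|n IHn] M pM; first exact: restr_proj_down.
exists (subm (kersub (fgcover M))), {freeg M / Rb}, (incl _), (fgcover M); split.
- exact: (ses_ker (@fgcover_surj _ _)).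
- exact: freeg_proj.
apply: IHn; apply: (pdr_ses_left (restr_ses pi (ses_ker (@fgcover_surj _ M))) _ pM).
by apply: (@pdr_le _ 1) => //; apply: (restr_free_pdr1 piK pit treg tdiv).
Qed.

End ChangeOfRingsDown.

(** * Hilbert's syzygy theorem *)

(* [S] is free over [R] with basis the powers of [t]. *)
Record poly_ext (R S : comNzRingType) (i : {rmorphism R -> S}) (t : S) : Prop :=
  PolyExt {
    poly_span : forall x : S, exists n (c : nat -> R), x = \sum_(j < n) i (c j) * t ^+ j;
    poly_free : forall (A : lmodType R) (a : nat -> A),
      exists L : {linear restr i S^o -> A}, forall j, L (t ^+ j) = a j }.

Section HilbertSyzygy.
Variables (R S : comNzRingType) (i : {rmorphism R -> S}) (t : S).
Hypothesis RS : poly_ext i t.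
Variable T : choiceType.
Local Notation F := ({freeg T / S} : lmodType S).
Local Notation RF := (restr i F : lmodType R).

Lemma restr_free_lift (A : lmodType R) (a : T -> nat -> A) :
  exists H : {linear RF -> A}, forall x j, H (gen (t ^+ j) x) = a x j.
Proof.
have [L LP] := boolp.choice (fun x => poly_free RS (a x)).
have La x : {morph L x : u v / u + v}.
  by move=> u v; rewrite -(linearD (L x)).
have L0 x : L x 0 = 0 by rewrite linear0.
have Hl : linear (fun D : RF => \sum_(z <- dom D) L z (coeff z D) : A).
  move=> c D D'; rewrite (freeg_additive La); congr (_ + _).
  rewrite -(@sum_dom _ _ _ (fun x => L x) (i c *: D : F) (dom D)) //.
  - rewrite scaler_sumr; apply: eq_bigr => x _; rewrite coeffZ.
    by rewrite -[i c * _]/(c *: (coeff x D : restr i S^o)) linearZ.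
  - exact: uniq_dom.
  - exact: domZ_subset.
exists (mklin Hl) => x j; rewrite mklinE.
by rewrite (@freeg_sum_gen _ _ _ (fun x => L x)).
Qed.

Lemma restr_free_ext (A : zmodType) (f g : RF -> A) :
  {morph f : x y / x + y} -> {morph g : x y / x + y} ->
  (forall c x j, f (gen (i c * t ^+ j) x) = g (gen (i c * t ^+ j) x)) -> f =1 g.
Proof.
move=> fD gD fg D.
have f0 : f 0 = 0 by apply: (addrI (f 0)); rewrite -fD !addr0.
have g0 : g 0 = 0 by apply: (addrI (g 0)); rewrite -gD !addr0.
have fS (I : Type) (r : seq I) (u : I -> RF) :
  f (\sum_(k <- r) u k) = \sum_(k <- r) f (u k) by exact: big_morph.
have gS (I : Type) (r : seq I) (u : I -> RF) :
  g (\sum_(k <- r) u k) = \sum_(k <- r) g (u k) by exact: big_morph.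
rewrite [D]freeg_sum fS gS; apply: eq_bigr => x _.
have [n [c ->]] := poly_span RS (coeff x D).
have -> : gen (\sum_(j < n) i (c j) * t ^+ j) x =
    \sum_(j < n) gen (i (c j) * t ^+ j) x.
  apply: (big_morph (fun c => gen c x)) => [u v|]; first exact: gen_add.
  by rewrite /gen freegU0.
by rewrite fS gS; apply: eq_bigr => j _.
Qed.

Lemma restr_free_lin_ext (A : lmodType R) (f g : {linear RF -> A}) :
  (forall x j, f (gen (t ^+ j) x) = g (gen (t ^+ j) x)) -> f =1 g.
Proof.
move=> fg; apply: restr_free_ext => [x y|x y|c x j]; rewrite ?linearD //.
have -> : gen (i c * t ^+ j) x = c *: (gen (t ^+ j) x : RF).
  by rewrite restrZ gen_scale.
by rewrite !linearZ /= fg.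
Qed.

Lemma restr_free_proj : projective RF.
Proof.
move=> A B g f gs; have [s sK] := surj_section gs.
have [H HP] := restr_free_lift (fun x j => s (f (gen (t ^+ j) x))).
exists H; apply: (@restr_free_lin_ext _ (g \o H)%FUN f) => x j /=.
by rewrite HP sK.
Qed.

Lemma restr_linP (M N : lmodType S) (g : {linear restr i M -> restr i N}) c (u v : M) :
  g (i c *: u + v) = i c *: (g u : N) + (g v : N) :> N.
Proof. exact: (linearP g c u v). Qed.

(* A lift of [f] is built [R]-linearly on all of the free module, so that its
   failure [dt] to commute with [t] vanishes on [U]. *)
Lemma retract_proj (U : submod F) (rho : {linear RF -> restr i (subm U)}) :
  (forall k : subm U, rho (sval_ k) = k) -> projective (subm U).
Proof.
move=> rhoK A B g f gs.
pose f' : {linear RF -> restr i B} := (restr_map i f \o rho)%FUN.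
have f'K (k : subm U) : f' (sval_ k) = f k by rewrite /= rhoK.
have dl : linear (fun x : RF => f' (t *: (x : F)) - t *: (f' x : B) : restr i B).
  move=> c x y; rewrite -[LHS]/(f' (t *: (i c *: (x : F) + y))
    - t *: (f' (i c *: (x : F) + y) : B)).
  rewrite -[RHS]/(i c *: (f' (t *: (x : F)) - t *: (f' x : B))
    + (f' (t *: (y : F)) - t *: (f' y : B))).
  rewrite [t *: (_ + _)]scalerDr scalerA mulrC -scalerA !(restr_linP f').
  rewrite scalerDr scalerA (mulrC t) -scalerA.
  by rewrite scalerBr opprD addrACA.
pose d := mklin dl.
have dK (k : subm U) : d (sval_ k) = 0.
  have -> : d (sval_ k) = f' (t *: sval_ k) - t *: (f' (sval_ k) : B) by [].
  have := f'K (t *: k) => /= ->; have := f'K k => /= ->.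
  by rewrite linearZ subrr.
have gRs : surj (restr_map i g) by [].
have [dd ddP] := restr_free_proj d gRs.
(* Subtracting the retraction makes the lift of [d] vanish on [U]; its image under [g] is still [d],
   since [d] vanishes on [U]. *)
have dtl : linear (fun x : RF => dd (x - sval_ (rho x)) : restr i A).
  move=> c x y; rewrite -linearP; congr (dd _).
  by rewrite linearP /= scalerBr opprD addrACA.
pose dt := mklin dtl.
have dtK (k : subm U) : dt (sval_ k) = 0.
  by rewrite /dt mklinE rhoK subrr linear0.
have gdt x : g (dt x) = d x.
  rewrite -[LHS]/(restr_map i g (dd (x - sval_ (rho x)))) ddP.
  by rewrite (linearB d) (dK (rho x)) subr0.
have [a0 a0P] := surj_section gs.
(* The recursion is chosen to force [h' (t x) = t h' x + dt x], so that [g \o h'] and [f'] have the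
   same defect of commutation with [t]. *)
pose av x := fix av j : A := if j is k.+1 then
    t *: av k + dt (gen (t ^+ k) x) else a0 (f' (gen 1 x)).
have [h' h'P] := @restr_free_lift (restr i A) av.
have h't x : h' (t *: (x : F)) = t *: (h' x : A) + dt x.
  have l1 : linear (fun x : RF => h' (t *: (x : F))).
    move=> c y z; rewrite -[LHS]/(h' (t *: (i c *: (y : F) + z))).
    by rewrite scalerDr scalerA mulrC -scalerA (restr_linP h').
  have l2 : linear (fun x : RF => (t *: (h' x : A) + dt x) : restr i A).
    move=> c y z; rewrite -[LHS]/(t *: (h' (i c *: (y : F) + z) : A)
      + dt (i c *: (y : F) + z)) !restr_linP scalerDr scalerA (mulrC t) -scalerA.
    by rewrite addrACA -scalerDr.
  apply: (@restr_free_lin_ext _ (mklin l1) (mklin l2)) => y j.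
  by rewrite !mklinE gen_scale -exprS !h'P.
have gh' : restr_map i g \o h' =1 f'.
  apply: (@restr_free_lin_ext _ (restr_map i g \o h')%FUN f') => x j.
  elim: j => [|j IHj]; first by rewrite /= h'P /= a0P.
  have -> : gen (t ^+ j.+1) x = t *: (gen (t ^+ j) x) :> F.
    by rewrite gen_scale exprS.
  rewrite /= h't linearD linearZ /= gdt.
  have -> : g (h' (gen (t ^+ j) x)) = f' (gen (t ^+ j) x) :> B by exact: IHj.
  by rewrite addrC -[d _]/(_ - _) subrK.
have hl : linear (fun k : subm U => h' (sval_ k) : A).
  move=> c x y.
  have hD (u v : F) : h' (u + v) = h' u + h' v :> A by exact: (linearD h').
  have hR r (u : F) : h' (i r *: u) = i r *: (h' u : A).
    by have := restr_linP h' r u 0; rewrite addr0 linear0 addr0.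
  have ht (k : subm U) j : h' (t ^+ j *: sval_ k) = t ^+ j *: (h' (sval_ k) : A).
    elim: j => [|j IHj]; first by rewrite !scale1r.
    rewrite exprS -!scalerA h't IHj.
    by rewrite -[dt _]/(dt (sval_ (t ^+ j *: k))) dtK addr0.
  rewrite /= hD; congr (_ + _).
  have [n [e ->]] := poly_span RS c; rewrite !scaler_suml (linear_sum h').
  by apply: eq_bigr => j _; rewrite -!scalerA hR ht.
exists (mklin hl) => k; rewrite mklinE.
by have := gh' (sval_ k); rewrite /= rhoK.
Qed.

End HilbertSyzygy.

(** If [M] is projective over [R], its free cover over [S] splits over [R]; this yields an
    [R]-linear retraction onto the kernel, which is then projective over [S] by [retract_proj]. The
    other degrees follow by syzygies. *)
Lemma hilbert_step (R S : comNzRingType) (i : {rmorphism R -> S}) (t : S) :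
  poly_ext i t ->
  forall n (M : lmodType S), pdr n (restr i M) -> pdr n.+1 M.
Proof.
move=> RS; elim=> [|n IHn] M pM;
  exists (subm (kersub (fgcover M))), {freeg M / S}, (incl _), (fgcover M); split;
  try exact: (ses_ker (@fgcover_surj _ M)); try exact: freeg_proj; last first.
  apply: IHn; apply: (pdr_ses_left (restr_ses i (ses_ker (@fgcover_surj _ M))) _ pM).
  by apply: (@pdr_le _ 0) => //; apply: restr_free_proj RS _.
pose e := fgcover M; pose F : lmodType S := {freeg M / S}.
have [sg sgP] := pM _ _ (restr_map i e) idfun (@fgcover_surj _ M).
have sgP' x : e (sg x) = x by have := sgP x.
have rU x : kersub e (x - sg (e x)) by rewrite /= linearB /= sgP' subrr.
have rl : linear (fun x : restr i F => mksub (rU x) : restr i (subm (kersub e))).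
  move=> c x y; apply: subm_inj; rewrite /= -[in RHS]/(c *: (x - sg (e x) : restr i F)).
  have -> : e (c *: x + y) = c *: (e x : restr i M) + e y by rewrite linearP.
  by rewrite linearP scalerBr opprD addrACA.
apply: (@retract_proj _ _ _ _ RS _ _ (mklin rl)) => k; apply: subm_inj => /=.
by rewrite (submP k) linear0 subr0.
Qed.

(** * Polynomial rings: adding and killing a variable *)

Section PolynomialRing.
Variable K : fieldType.

Lemma mpoly_gen_ind n (P : {mpoly K[n]} -> Prop) :
  (forall c, P c%:MP) -> (forall i, P 'X_i) ->
  (forall p q, P p -> P q -> P (p + q)) ->
  (forall p q, P p -> P q -> P (p * q)) -> forall p, P p.
Proof.
move=> PC PX PD PM p; rewrite [p]mpolyE.
have P0 : P 0 by rewrite -mpolyC0.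
have P1 : P 1 by rewrite -mpolyC1.
apply: (big_ind P) => // m _; rewrite -mul_mpolyC; apply: (PM) => //.
rewrite mpolyXE_id; apply: (big_ind P) => // i _.
by elim: (m i) => [|k IHk]; rewrite ?expr0 // exprS; apply: PM.
Qed.

Lemma rmorph_mpoly_ext n (R : nzRingType) (f g : {rmorphism {mpoly K[n]} -> R}) :
  (forall c, f c%:MP = g c%:MP) -> (forall i, f 'X_i = g 'X_i) -> f =1 g.
Proof.
move=> fgC fgX; apply: mpoly_gen_ind => // p q fp fq.
  by rewrite !rmorphD fp fq.
by rewrite !rmorphM fp fq.
Qed.

(** Congruence to the identity modulo [t] is stable under sums and products, so the variables
    decide. *)
Lemma hom_div n (rho : {rmorphism {mpoly K[n]} -> {mpoly K[n]}}) (t : {mpoly K[n]}) :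
  (forall c, rho c%:MP = c%:MP) -> (forall i, exists y, 'X_i = rho 'X_i + t * y) ->
  forall x, exists y, x = rho x + t * y.
Proof.
move=> rC rX; apply: mpoly_gen_ind => // [c|p q [y py] [z qz]|p q [y py] [z qz]].
- by exists 0; rewrite rC mulr0 addr0.
- by exists (y + z); rewrite rmorphD mulrDr addrACA -py -qz.
- exists (rho p * z + y * q); rewrite rmorphM {1}py mulrDl {1}qz mulrDr.
  by rewrite mulrDr -addrA !mulrA [rho p * t]mulrC.
Qed.

Section OneMoreVariable.
Variable n : nat.
Local Notation S := {mpoly K[n.+1]}.
Local Notation R := {mpoly K[n]}.
Local Notation t := ('X_ord_max : S).
Local Notation widen := (widen_ord (leqnSn n)).

Lemma muni_X (i : 'I_n) : muni ('X_(widen i) : S) = ('X_i)%:P.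
Proof.
rewrite muniE msuppX big_seq1 mcoeffX eqxx scale1r.
rewrite mnm1E.
have -> : (widen i == ord_max :> 'I_n.+1) = false.
  by apply/negbTE; rewrite -val_eqE /= neq_ltn ltn_ord.
rewrite expr0 alg_polyC; congr ('X_[_])%:P; apply/mnmP => j.
by rewrite mnmE !mnm1E -!val_eqE.
Qed.

Lemma muni_Xmax : muni t = 'X.
Proof.
rewrite muniE msuppX big_seq1 mcoeffX eqxx scale1r mnm1E eqxx expr1.
have -> : [multinom (U_(ord_max))%MM (widen i) | i < n] = 0%MM.
  apply/mnmP => j; rewrite mnmE mnm1E mnm0E.
  have -> // : (ord_max == widen j :> 'I_n.+1) = false.
  by apply/negbTE; rewrite -val_eqE /= neq_ltn ltn_ord orbT.
by rewrite mpolyX0 scale1r.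
Qed.

Lemma mwiden_X (i : 'I_n) : mwiden ('X_i : R) = 'X_(widen i).
Proof. by rewrite mwidenX mnmwiden1. Qed.

Lemma muni_mwiden (p : R) : muni (mwiden p) = p%:P.
Proof.
pose f : {rmorphism R -> {poly R}} := (@muni n K \o @mwiden n K)%FUN.
pose g : {rmorphism R -> {poly R}} := polyC.
apply: (@rmorph_mpoly_ext _ _ f g) => [c|i] /=.
  by rewrite mwidenC muniC.
by rewrite mwiden_X muni_X.
Qed.

Lemma ord_max_case (i : 'I_n.+1) : i = ord_max \/ exists j : 'I_n, i = widen j.
Proof.
have [lt_in|le_ni] := ltnP i n; [right | left].
  by exists (Ordinal lt_in); apply: val_inj.
by apply: val_inj; apply/eqP; rewrite eqn_leq le_ni -ltnS ltn_ord.
Qed.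

(** Through [muni] the ring becomes univariate polynomials over [K[n]]; their coefficients define
    the linear maps required by [poly_free]. *)
Lemma mpoly_poly_ext : poly_ext (@mwiden n K) t.
Proof.
split=> [x|A a].
  suff [q ->] : exists q : {poly R}, x = (map_poly (@mwiden n K) q).[t].
    exists (size q), (fun j => q`_j).
    rewrite (@horner_coef_wide _ (size q)); last exact: size_poly.
    by apply: eq_bigr => j _; rewrite coef_map.
  pose P (x : S) := exists q : {poly R}, x = (map_poly (@mwiden n K) q).[t].
  apply: (@mpoly_gen_ind n.+1 P) => [c|i|u v [p' up] [q' vq]|u v [p' up] [q' vq]].
  - by exists c%:MP%:P; rewrite map_polyC hornerC /= mwidenC.
  - have [->|[j ->]] := ord_max_case i.
      by exists 'X; rewrite map_polyX hornerX.
    by exists ('X_j)%:P; rewrite map_polyC hornerC /= mwiden_X.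
  - by exists (p' + q'); rewrite up vq rmorphD hornerD.
  - by exists (p' * q'); rewrite up vq rmorphM hornerM.
have [Lp LpE] : exists Lp : {poly R} -> A, forall q, Lp q = \sum_(k < size q) q`_k *: a k.
  by exists (fun q : {poly R} => \sum_(k < size q) q`_k *: a k).
have Lw m (q : {poly R}) : (size q <= m)%N -> Lp q = \sum_(k < m) q`_k *: a k.
  move=> le_qm; rewrite LpE -!(big_mkord xpredT (fun k => q`_k *: a k)).
  rewrite [RHS](big_cat_nat _ (n := size q)) //= [X in _ + X]big1_seq ?addr0 //.
  by move=> k /andP[_]; rewrite mem_index_iota => /andP[le_k _]; rewrite nth_default ?scale0r.
have LpL c u v : Lp (c%:P * u + v) = c *: Lp u + Lp v.
  set w := _ * u + v; pose m := maxn (size w) (maxn (size u) (size v)).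
  have h1 : (size w <= m)%N by apply: leq_maxl.
  have h2 : (size u <= m)%N by apply: leq_trans (leq_maxl _ _) (leq_maxr _ _).
  have h3 : (size v <= m)%N by apply: leq_trans (leq_maxr _ _) (leq_maxr _ _).
  rewrite (Lw _ _ h1) (Lw _ _ h2) (Lw _ _ h3) scaler_sumr -big_split /=.
  by apply: eq_bigr => k _; rewrite coefD coefCM scalerDl scalerA.
have Ll : linear (fun x : restr (@mwiden n K) S^o => Lp (muni (x : S))).
  move=> c x y; rewrite -LpL -muni_mwiden; congr (Lp _).
  by rewrite -[muni (mwiden c) * _]muniM -muniD.
exists (mklin Ll) => j; rewrite mklinE rmorphXn /= muni_Xmax.
rewrite (Lw j.+1) ?size_polyXn // big_ord_recr /= coefXn eqxx scale1r big1 ?add0r //.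
by move=> k _; rewrite coefXn ltn_eqF ?scale0r.
Qed.

Definition drop_last : {rmorphism S -> R} := (horner_eval 0 \o @muni n K)%FUN.

Lemma drop_lastC c : drop_last c%:MP = c%:MP.
Proof. by rewrite /drop_last /= muniC /horner_eval hornerC. Qed.
Lemma mwidenK : cancel (@mwiden n K) drop_last.
Proof. by move=> p; rewrite /drop_last /= muni_mwiden /horner_eval hornerC. Qed.
Lemma drop_last_max : drop_last t = 0.
Proof. by rewrite /drop_last /= muni_Xmax /horner_eval hornerX. Qed.
Lemma drop_last_div (x : S) : exists y, x = mwiden (drop_last x) + t * y.
Proof.
pose rho : {rmorphism S -> S} := (@mwiden n K \o drop_last)%FUN.
have rhoE y : rho y = mwiden (drop_last y) by [].
apply: (@hom_div _ rho) => [c|i]; rewrite rhoE.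
  by rewrite drop_lastC mwidenC.
have [->|[j ->]] := ord_max_case i.
  by exists 1; rewrite drop_last_max rmorph0 add0r mulr1.
by exists 0; rewrite -mwiden_X mwidenK mulr0 addr0.
Qed.

End OneMoreVariable.

Lemma mpolyX_reg n (i : 'I_n) (x : {mpoly K[n]}) : 'X_i * x = 0 -> x = 0.
Proof.
move/eqP; rewrite mulf_eq0 => /orP[/eqP/mpolyP/(_ U_(i)%MM)|/eqP//].
by rewrite mcoeffX mcoeff0 eqxx => /eqP; rewrite oner_eq0.
Qed.

End PolynomialRing.

(** * Every module over a division ring is projective *)

Section Zorn.
Variable R : nzRingType.
Hypothesis Rdiv : forall a : R, a != 0 -> exists b, b * a = 1.

Lemma complement (M : lmodType R) (U : submod M) :
  exists W : submod M, (forall x, W x -> U x -> x = 0) /\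
    forall x, exists2 w, W w & U (x - w).
Proof.
pose D (W : submod M) := forall x, W x -> U x -> x = 0.
pose le (W W' : {W : submod M | D W}) := `[< forall x, sval W x -> sval W' x >].
have z0 : (0 : M) = 0 by [].
have zL (a : R) (x y : M) : x = 0 -> y = 0 -> a *: x + y = 0.
  by move=> -> ->; rewrite scaler0 addr0.
pose Z : submod M := Submod z0 zL.
have ZD : D Z by move=> x.
have [| | |[W WD] Wmax] := @classical_sets.ZL_preorder _ (exist D Z ZD) le.
- by move=> W; apply/asboolP.
- move=> W1 W2 W3 /asboolP h1 /asboolP h2; apply/asboolP => x /h1; exact: h2.
- move=> A Atot.
  pose B x := x = 0 \/ exists2 W, A W & sval W x.
  have B0 : B 0 by left.
  have BL a x y : B x -> B y -> B (a *: x + y).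
    case=> [->|[W AW Wx]]; case=> [->|[W' AW' Wy]].
    - by left; rewrite scaler0 addr0.
    - by right; exists W' => //; rewrite scaler0 add0r.
    - by right; exists W => //; rewrite addr0; apply: scarZ.
    - have [/asboolP le12|/asboolP le21] := Atot _ _ AW AW'.
        by right; exists W' => //; apply: scarL => //; apply: le12.
      by right; exists W => //; apply: scarL => //; apply: le21.
  have BD : D (Submod B0 BL).
    by move=> x /= [//|[W AW Wx]]; apply: (svalP W).
  exists (exist D _ BD) => W AW; apply/asboolP => x Wx /=.
  by right; exists W.
exists W; split=> // x; apply: contrapT => nx.
(* This is [W + R x]. It still meets [U] in 0, since otherwise a nonzero coefficient of [x] could be
   inverted to put [x] in [W + U]; it contradicts maximality. *)
pose B y := exists a, W (y - a *: x).
have B0 : B 0 by exists 0; rewrite scale0r subr0; apply: scar0.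
have BL a y z : B y -> B z -> B (a *: y + z).
  move=> [b Wb] [c Wc]; exists (a * b + c).
  by rewrite scalerDl -scalerA opprD addrACA -scalerBr; apply: scarL.
have BD : D (Submod B0 BL).
  move=> y /= [a Wy] Uy; have [a0|a0] := eqVneq a 0.
    by rewrite a0 scale0r subr0 in Wy; apply: (WD y).
  have [b ba] := Rdiv a0; case: nx; exists (- b *: (y - a *: x)).
    exact: scarZ.
  rewrite scaleNr opprK scalerBr scalerA ba scale1r addrC subrK.
  exact: scarZ.
have leWB : le (exist D W WD) (exist D _ BD).
  by apply/asboolP => y Wy; exists 0; rewrite scale0r subr0.
have /asboolP/(_ x) /= Wx := Wmax _ leWB.
apply: nx; exists x; last by rewrite subrr; apply: scar0.
by apply: Wx; exists 1; rewrite scale1r subrr; apply: scar0.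
Qed.

(** Projection onto the image of [j] along a complement. *)
Lemma linear_retraction (A B : lmodType R) (j : {linear A -> B}) :
  injective j -> exists r : {linear B -> A}, cancel j r.
Proof.
move=> ji; have [W [WU Wx]] := complement (imsub j).
have dec x : exists a, W (x - j a).
  have [w Ww [a aE]] := Wx x; exists a.
  by rewrite aE opprB addrC subrK.
have [r rP] := boolp.choice dec.
have rU x a : W (x - j a) -> r x = a.
  move=> Wa; apply: ji; apply/eqP; rewrite -subr_eq0; apply/eqP/WU.
    have -> : j (r x) - j a = (x - j a) - (x - j (r x)).
      by rewrite opprB [RHS]addrC addrA subrK.
    exact: scarB.
  by exists (r x - a); rewrite linearB.
have rl : linear r.
  move=> c x y; apply: rU; rewrite linearP opprD addrACA -scalerBr.
  exact: scarL.
by exists (mklin rl) => a; apply: rU; rewrite subrr; apply: scar0.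
Qed.

Lemma division_proj (M : lmodType R) : projective M.
Proof.
move=> A B g f gs; pose U := kersub g.
have [r rP] := @linear_retraction (subm U) A (incl U) (@subm_inj _ _ U).
have [s sK] := surj_section gs.
pose sg b := s b - sval_ (r (s b)).
have gsg b : g (sg b) = b by rewrite linearB sK (submP (r _)) subr0.
have rsg b : r (sg b) = 0 by rewrite /sg linearB -[X in _ - r X]/(incl U _) rP subrr.
have sgl : linear sg.
  move=> c x y; pose d := sg (c *: x + y) - (c *: sg x + sg y).
  have Ud : U d by rewrite /= /d linearB linearP !gsg subrr.
  have rd : r d = 0 by rewrite /d linearB linearP !rsg scaler0 addr0 subrr.
  have d0 : mksub Ud = 0 by rewrite -(rP (mksub Ud)) -[RHS]rd.
  by apply/eqP; rewrite -subr_eq0; apply/eqP; apply: (congr1 (@sval_ _ _ _) d0).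
by exists (mklin sgl \o f)%FUN => x; rewrite /= gsg.
Qed.

End Zorn.

(** * Syzygies over polynomial rings and the residue field at the origin *)

Section Syzygies.
Variable K : fieldType.

Lemma mpoly0_div (a : {mpoly K[0]}) : a != 0 -> exists b, b * a = 1.
Proof.
rewrite [a]nvar0_mpolyC mpolyC_eq0 => a0; exists (a@_0%MM)^-1%:MP.
by rewrite -mpolyCM mulVf.
Qed.

Lemma proj_to_free (R : nzRingType) (P : lmodType R) : projective P ->
  exists j : {linear P -> {freeg P / R}}, injective j.
Proof.
move=> pP; have [h hP] := pP _ _ (fgcover P) idfun (@fgcover_surj _ P).
by exists h; apply: (can_inj (g := fgcover P)) => x; apply: hP.
Qed.

(** One better than adding one for each variable. The gain is made at one variable, where the
    embedding in a free module has a retraction linear over the constants and [retract_proj] gives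
    projectivity; each further variable costs one. For [n = 0] the predecessor is 0 as well. *)
Lemma pdr_sub_proj n (M P : lmodType {mpoly K[n]}) (j : {linear M -> P}) :
  injective j -> projective P -> pdr n.-1 M.
Proof.
elim: n M P j => [|[|n] IHn] M P j ji pP; first exact: division_proj mpoly0_div _.
  have [k ki] := proj_to_free pP; pose f : {linear M -> {freeg P / _}} := (k \o j)%FUN.
  have fi : injective f by move=> x y /ki /ji.
  pose U := imsub f; have fU x : U (f x) by exists x.
  pose i0 := @mwiden 0 K.
  have [rho rhoP] := linear_retraction mpoly0_div
    (j := restr_map i0 (incl U)) (@subm_inj _ _ U).
  have pU := retract_proj (mpoly_poly_ext K 0) rhoP.
  have fact_i : injective (factor fU) by move=> x y /(congr1 (@sval_ _ _ _)) /fi.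
  have [r ri] : exists r, cancel r (factor fU).
    by apply: surj_section => u; have [x xu] := submP u; exists x; apply: subm_inj.
  have rl : linear r by move=> a x y; apply: fact_i; rewrite ri linearP !ri.
  apply: (@proj_retract _ _ _ (factor fU) (mklin rl)) pU => x /=.
  by apply: fact_i; rewrite ri.
have [k ki] := proj_to_free pP.
apply: (hilbert_step (mpoly_poly_ext K n.+1)).
apply: (IHn _ _ (restr_map (@mwiden n.+1 K) (k \o j)%FUN)); first by move=> x y /ki /ji.
exact: restr_free_proj (mpoly_poly_ext K n.+1) _.
Qed.

Definition ev0 n : {rmorphism {mpoly K[n]} -> K} := meval (fun=> 0).
Lemma ev0C n c : ev0 n c%:MP = c. Proof. exact: mevalC. Qed.
Lemma ev0X n i : ev0 n 'X_i = 0. Proof. exact: mevalXU. Qed.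
Definition residue n : lmodType {mpoly K[n]} := restr (ev0 n) K^o.

Lemma residue_scale n f (c : residue n) : f *: c = ev0 n f * (c : K) :> K.
Proof. by []. Qed.

(** In one variable a projective module embeds in a torsion-free one, while the variable kills the
    residue field. Each further variable is removed by [pdr_restr_down]. *)
Lemma residue_pdr n : ~ pdr n (residue n.+1).
Proof.
elim: n => [|n IHn].
  pose S := {mpoly K[1]} => /= pr.
  have gl : linear (fun f : S^o => ev0 1 f : residue 1).
    by move=> a x y; rewrite rmorphD rmorphM.
  have gs : surj (mklin gl).
    by move=> c; exists (c%:MP); rewrite mklinE ev0C.
  have [h hP] := pr _ _ (mklin gl) idfun gs.
  have : h (1 : K) = 0 :> S.
    apply: (@mpolyX_reg K 1 ord0); rewrite -[LHS]/('X_ord0 *: (h (1 : K) : S^o)) -linearZ.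
    have -> : 'X_ord0 *: (1 : residue 1) = 0 by rewrite residue_scale ev0X mul0r.
    by rewrite linear0.
  move=> h1; have := hP (1 : K); rewrite mklinE h1 rmorph0 => /esym/eqP.
  by rewrite oner_eq0.
move=> pr; apply: IHn.
apply: (pdr_restr_down (@mwidenK K n.+1) (@drop_last_max K n.+1)
  (@mpolyX_reg K n.+2 ord_max) (@drop_last_div K n.+1)).
have il : linear (fun c : residue n.+2 => c : restr (drop_last K n.+1) (residue n.+1)).
  move=> a x y; rewrite restrZ; congr (_ * _ + _).
  pose g : {rmorphism {mpoly K[n.+2]} -> K} := (ev0 n.+1 \o drop_last K n.+1)%FUN.
  have gE p : g p = ev0 n.+1 (drop_last K n.+1 p) by [].
  apply: (@rmorph_mpoly_ext _ _ _ (ev0 n.+2) g) => [d|i]; rewrite gE.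
    by rewrite drop_lastC !ev0C.
  have [->|[j ->]] := ord_max_case i; first by rewrite drop_last_max rmorph0 ev0X.
  by rewrite -mwiden_X mwidenK mwiden_X !ev0X.
by apply: (@pdr_iso _ n.+1 _ _ (mklin il)) pr => // x; exists x.
Qed.

(** Modulo [U] every polynomial acts on [z] as its constant term. *)
Lemma scale_mod_ev0 n (W : lmodType {mpoly K[n]}) (U : submod W) z :
  (forall i, U ('X_i *: z)) -> forall f, U (f *: z - (ev0 n f)%:MP *: z).
Proof.
move=> UX; apply: mpoly_gen_ind => [c|i|f g Uf Ug|f g Uf Ug].
- by rewrite ev0C subrr; apply: scar0.
- by rewrite ev0X mpolyC0 scale0r subr0.
- by rewrite rmorphD mpolyCD !scalerDl opprD addrACA; apply: scarD.
- rewrite rmorphM mpolyCM.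
  have -> : (f * g) *: z - ((ev0 n f)%:MP * (ev0 n g)%:MP) *: z =
     f *: (g *: z - (ev0 n g)%:MP *: z)
     + (ev0 n g)%:MP *: (f *: z - (ev0 n f)%:MP *: z).
    rewrite !scalerBr !scalerA [f * (ev0 n g)%:MP]mulrC addrA subrK.
    by rewrite [(ev0 n f)%:MP * _]mulrC.
  by apply: scarD; apply: scarZ.
Qed.

(* A submodule of small projective dimension has no embedded point at the origin:
   otherwise [U + S z] would be an extension of the residue field by [U]. *)
Lemma no_socle n (W : lmodType {mpoly K[n.+2]}) (U : submod W) z :
  projective W -> pdr n (subm U) -> (forall i, U ('X_i *: z)) -> U z.
Proof.
move=> pW pU UX; apply: contrapT => nz; apply: (@residue_pdr n.+1).
pose N w := exists f, U (w - f *: z).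
have N0 : N 0 by exists 0; rewrite scale0r subr0; apply: scar0.
have NL a x y : N x -> N y -> N (a *: x + y).
  move=> [f Uf] [g Ug]; exists (a * f + g).
  by rewrite scalerDl -scalerA opprD addrACA -scalerBr; apply: scarL.
pose V := Submod N0 NL.
(* [F x] is a coefficient of [z] in [x] modulo [U]. Only its constant term is well defined, because
   [z] is not in [U]; it is the map from [U + S z] to the residue field. *)
have [F FP] := boolp.choice (fun x : subm V => submP x).
have Funiq (x : subm V) f : U (sval_ x - f *: z) -> ev0 _ (F x) = ev0 _ f.
  move=> Uf; have Ud : U ((F x - f) *: z).
    have -> : (F x - f) *: z = (sval_ x - f *: z) - (sval_ x - F x *: z).
      by rewrite opprB [RHS]addrC addrA subrK scalerBl.
    exact: scarB.
  apply/eqP; rewrite -subr_eq0 -rmorphB; apply/negPn/negP => c0.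
  have := scarB Ud (scale_mod_ev0 UX (F x - f)); rewrite opprB addrC subrK.
  move=> /(scarZ (ev0 _ (F x - f))^-1%:MP); rewrite scalerA -mpolyCM mulVf //.
  by rewrite mpolyC1 scale1r.
have el : linear (fun x : subm V => ev0 _ (F x) : residue n.+2).
  move=> a x y; rewrite -[RHS]/(ev0 _ a * ev0 _ (F x) + ev0 _ (F y)).
  rewrite -rmorphM -rmorphD; apply: Funiq.
  by rewrite /= scalerDl -scalerA opprD addrACA -scalerBr; apply: scarL.
have UV (x : subm U) : V (incl U x) by exists 0; rewrite scale0r subr0; apply: submP.
(* In [n.+2] variables [V] has dimension at most [n.+1] and [U] at most [n], so the residue field
   would have dimension at most [n.+1]. *)
apply: (@pdr_ses_right _ n _ _ _ (factor UV) (mklin el)) => //.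
  split=> [x y xy|x|c].
  - by apply: subm_inj; have := congr1 (@sval_ _ _ _) xy.
  - rewrite mklinE; split=> [Fx|[u <-]].
      have Ux : U (sval_ x).
        have := scale_mod_ev0 UX (F x); rewrite Fx mpolyC0 scale0r subr0 => UF.
        by have := scarD (FP x) UF; rewrite subrK.
      by exists (mksub Ux); apply: subm_inj.
    have U0 : U (sval_ (factor UV u) - 0 *: z).
      by rewrite scale0r subr0; apply: submP.
    by rewrite (Funiq _ _ U0) rmorph0.
  - have Vz : V (c%:MP *: z) by exists c%:MP; rewrite subrr; apply: scar0.
    exists (mksub Vz); rewrite mklinE (Funiq _ c%:MP) ?ev0C //.
    by rewrite subrr; apply: scar0.
exact: (@pdr_sub_proj _ _ _ (incl V) (@subm_inj _ _ V) pW).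
Qed.

End Syzygies.

Section FiniteFree.
Variables (R : nzRingType) (I : finType).
Local Notation W := ({ffun I -> R^o} : lmodType R).

Lemma ffun_proj : projective W.
Proof.
move=> M N g f gs; have [s sK] := surj_section gs.
pose d (i : I) : {ffun I -> R^o} := [ffun j => (j == i)%:R].
have hl : linear (fun w : W => \sum_i w i *: s (f (d i)) : M).
  move=> a x y; rewrite scaler_sumr -big_split /=; apply: eq_bigr => i _.
  by rewrite !ffunE scalerDl scalerA.
exists (mklin hl) => w; rewrite mklinE linear_sum.
have wE : w = \sum_i w i *: d i.
  apply/ffunP => j; rewrite sum_ffunE (bigD1 j) //= !ffunE eqxx big1.
    by rewrite addr0 /GRing.scale /= mulr1.
  by move=> i /negbTE ij; rewrite !ffunE eq_sym ij scaler0.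
rewrite [in RHS]wE linear_sum; apply: eq_bigr => i _.
by rewrite !linearZ /= sK.
Qed.
End FiniteFree.

(** * Alternating forms *)

Lemma not_uniq_split (T : eqType) (t : seq T) : ~~ uniq t ->
  exists x s0 s1 s2, t = s0 ++ x :: s1 ++ x :: s2.
Proof.
elim: t => //= x t IHt; rewrite negb_and negbK => /orP[/splitPr[s1 s2]|/IHt].
  by exists x, [::], s1, s2.
by move=> [y [s0 [s1 [s2 ->]]]]; exists y, (x :: s0), s1, s2.
Qed.

Section Alternating.
Variables (R : nzRingType) (V X : lmodType R).

(* A p-linear alternating function, as a function of lists vanishing on the
   lists of length other than [p]. *)
Record altf (p : nat) (f : seq V -> X) : Prop := Altf {
  altf_size : forall s, size s != p -> f s = 0;
  altf_lin : forall s1 s2 a x y,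
    f (s1 ++ (a *: x + y) :: s2) = a *: f (s1 ++ x :: s2) + f (s1 ++ y :: s2);
  altf_alt : forall s1 s2 x, f (s1 ++ x :: x :: s2) = 0 }.

Section Theory.
Variables (p : nat) (f : seq V -> X).
Hypothesis fa : altf p f.

Lemma altf_add s1 s2 x y : f (s1 ++ (x + y) :: s2) = f (s1 ++ x :: s2) + f (s1 ++ y :: s2).
Proof. by have := altf_lin fa s1 s2 1 x y; rewrite !scale1r. Qed.

Lemma altf_0 s1 s2 : f (s1 ++ 0 :: s2) = 0.
Proof. by have := altf_lin fa s1 s2 (-1) 0 0; rewrite scaler0 addr0 scaleN1r addNr. Qed.

Lemma altf_scale s1 s2 a x : f (s1 ++ (a *: x) :: s2) = a *: f (s1 ++ x :: s2).
Proof. by have := altf_lin fa s1 s2 a x 0; rewrite altf_0 !addr0. Qed.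

Lemma altf_sum s1 s2 (I : Type) (r : seq I) (c : I -> R) (x : I -> V) :
  f (s1 ++ (\sum_(i <- r) c i *: x i) :: s2)
  = \sum_(i <- r) c i *: f (s1 ++ x i :: s2).
Proof.
elim: r => [|i r IHr]; first by rewrite !big_nil altf_0.
by rewrite !big_cons (altf_lin fa) IHr.
Qed.

Lemma altf_swap s1 s2 x y : f (s1 ++ x :: y :: s2) = - f (s1 ++ y :: x :: s2).
Proof.
have := altf_alt fa s1 s2 (x + y); rewrite altf_add.
have e z u v : f (s1 ++ z :: (u + v) :: s2) =
    f (s1 ++ z :: u :: s2) + f (s1 ++ z :: v :: s2).
  by rewrite -!(cat_rcons z) altf_add.
rewrite !e !(altf_alt fa) add0r addr0 => /eqP.
by rewrite addr_eq0 => /eqP.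
Qed.

Lemma altf_move s0 s1 s2 x :
  f (s0 ++ s1 ++ x :: s2) = (-1) ^+ size s1 *: f (s0 ++ x :: s1 ++ s2).
Proof.
elim/last_ind: s1 s2 => [|s1 y IHs] s2; first by rewrite scale1r.
rewrite cat_rcons catA altf_swap -catA IHs size_rcons exprS mulN1r scaleNr.
by rewrite cat_rcons.
Qed.

Lemma altf_rep s0 s1 s2 x : f (s0 ++ x :: s1 ++ x :: s2) = 0.
Proof.
by rewrite -cat_rcons altf_move cat_rcons (altf_alt fa) scaler0.
Qed.

Variable Q : submod X.

Lemma submod_sign k x : Q x -> Q ((-1) ^+ k *: x).
Proof. exact: scarZ. Qed.

Lemma altf_catCA s0 s1 s2 s3 : Q (f (s0 ++ s1 ++ s2 ++ s3)) -> Q (f (s0 ++ s2 ++ s1 ++ s3)).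
Proof.
elim: s2 s0 => [//|x s2 IHs] s0; rewrite -cat1s -!catA cat1s.
move=> Qf; rewrite -[s0 ++ [:: x] ++ _]/(s0 ++ x :: _) -cat_rcons; apply: IHs.
rewrite cat_rcons; have := submod_sign (size s1) Qf.
rewrite altf_move scalerA -exprD addnn -mul2n exprM sqrrN expr1n expr1n.
by rewrite scale1r.
Qed.

Lemma altf_perm s s' : perm_eq s s' -> Q (f s) -> Q (f s').
Proof.
apply: (catCA_perm_ind (P := fun s => Q (f s))) => s1 s2 s3.
exact: (@altf_catCA [::]).
Qed.

(** Expand every argument in [b]: lists with a repetition give 0, and sorting the others only
    changes signs. *)
Lemma altf_basis n (b : 'I_n -> V) :
  (forall v, exists c : 'I_n -> R, v = \sum_i c i *: b i) ->
  (forall I : {set 'I_n}, #|I| = p -> Q (f (map b (enum I)))) ->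
  forall s, Q (f s).
Proof.
move=> bs Qb s.
have Qbasis (t : seq 'I_n) : Q (f (map b t)).
  have [ut|/not_uniq_split[x [s0 [s1 [s2 ->]]]]] := boolP (uniq t); last first.
    by rewrite map_cat map_cons map_cat map_cons altf_rep; apply: scar0.
  have [st|st] := eqVneq (size t) p; last first.
    by rewrite (altf_size fa) ?size_map //; apply: scar0.
  apply: (@altf_perm (map b (enum [set i in t]))).
    apply: perm_map; apply: uniq_perm; rewrite ?enum_uniq // => i.
    by rewrite mem_enum inE.
  by apply: Qb; rewrite cardsE (card_uniqP ut).
rewrite -[s]/(map b [::] ++ s); elim: s [::] => [|v s IHs] t.
  by rewrite cats0.
have [c ->] := bs v; rewrite altf_sum; apply: scar_sum => i _; apply: scarZ.
by rewrite -cat_rcons -map_rcons.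
Qed.

(** Splitting each argument into its component along [u] and one in the kernel of [a] leaves lists
    with at most one [u], by alternation. *)
Lemma altf_hyperplane (a : {linear V -> R^o}) (u : V) : a u = 1 ->
  (forall s, {in s, forall x, a x = 0} -> Q (f s)) ->
  (forall s, {in s, forall x, a x = 0} -> Q (f (u :: s))) ->
  forall s, Q (f s).
Proof.
move=> au Q0 Q1 s.
(* The prefix [t] collects the kernel components already split off; the two cases, without and with
   [u] in front, feed each other and are proved together. *)
suff h t : {in t, forall x, a x = 0} -> Q (f (t ++ s)) /\ Q (f (u :: t ++ s)).
  by have [] := h [::].
elim: s t => [|v s IHs] t ta; first by rewrite cats0; split; auto.
have vE : v = (a v *: u) + (v - a v *: u) by rewrite addrC subrK.
have ta' : {in rcons t (v - a v *: u), forall x, a x = 0}.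
  move=> x; rewrite mem_rcons inE => /orP[/eqP->|/ta//].
  by rewrite linearB linearZ /= au /GRing.scale/= mulr1 subrr.
have [h1 h2] := IHs _ ta'; have [h3 h4] := IHs _ ta.
rewrite !cat_rcons in h1 h2.
split; rewrite vE.
  rewrite (altf_lin fa); apply: scarD => //; apply: scarZ.
  by rewrite -[t ++ _]cat0s altf_move; apply: submod_sign.
rewrite -cat_cons (altf_lin fa); apply: scarD => //; apply: scarZ.
by rewrite -[u :: t]/([::] ++ u :: t) -catA altf_rep; apply: scar0.
Qed.

End Theory.
End Alternating.

Lemma altf_comp (R R' : nzRingType) (V X : lmodType R) (V' X' : lmodType R')
    (phi : R -> R') (g : V -> V') (h : X' -> X) p (f : seq V' -> X') :
  (forall a x y, g (a *: x + y) = phi a *: g x + g y) ->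
  (forall a x y, h (phi a *: x + y) = a *: h x + h y) ->
  altf p f -> altf p (fun s => h (f (map g s))).
Proof.
move=> gl hl fa.
have h0 : h 0 = 0.
  have := hl (-1) 0 0; rewrite scaler0 addr0 scaleN1r => e.
  by rewrite e addNr.
split=> [s ps|s1 s2 a x y|s1 s2 x]; rewrite ?map_cat /=.
- by rewrite (altf_size fa) ?size_map.
- by rewrite gl (altf_lin fa) hl.
- by rewrite (altf_alt fa).
Qed.

(** * Exterior algebra in coordinates *)

Section Exterior.
Variables (R : comNzRingType) (n : nat).
Local Notation W := {ffun {set 'I_n} -> R^o}.
Implicit Types (i j k : 'I_n) (I J : {set 'I_n}) (w v : W).
Local Notation vec := {ffun 'I_n -> R^o}.

Definition below (i : 'I_n) (J : {set 'I_n}) : nat := \sum_(j in J) (j < i)%N.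
(** For [i] outside [J], the sign in [dx_i /\ dx_J = sgb i J dx_(i |: J)]. *)
Definition sgb i J : R := (-1) ^+ below i J.

Lemma belowU1 i k (J : {set 'I_n}) : k \notin J ->
  below i (k |: J) = ((k < i)%N + below i J)%N.
Proof. by move=> kJ; rewrite /below big_setU1. Qed.

Lemma sgbU1 i k J : k \notin J -> sgb i (k |: J) = (-1) ^+ (k < i)%N * sgb i J.
Proof. by move=> kJ; rewrite /sgb belowU1 // exprD. Qed.

Lemma sgbD1 i k J : k \in J -> sgb i J = (-1) ^+ (k < i)%N * sgb i (J :\ k).
Proof. by move=> kJ; rewrite -sgbU1 ?setD11 // setD1K. Qed.

Lemma sgb_sq i J : sgb i J * sgb i J = 1.
Proof. by rewrite /sgb -exprD addnn -mul2n exprM sqrrN expr1n expr1n. Qed.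

Lemma sg_lt (i k : 'I_n) : i != k ->
  (-1) ^+ (i < k)%N = - (-1) ^+ (k < i)%N :> R.
Proof.
rewrite neq_ltn => /orP[] h; rewrite h ltnNge (ltnW h) /= ?expr0 ?expr1 //.
by rewrite opprK.
Qed.

(* Interior product with the vector [c] and exterior product with the linear
   form [a]. *)
Definition contr (c : 'I_n -> R) (w : W) : W :=
  [ffun J : {set 'I_n} => \sum_(i | i \notin J) sgb i J * c i * w (i |: J)].
Definition wdg (a : 'I_n -> R) (w : W) : W :=
  [ffun J : {set 'I_n} => \sum_(j in J) sgb j J * a j * w (J :\ j)].

Lemma contr_linr c a w v : contr c (a *: w + v) = a *: contr c w + contr c v.
Proof.
apply/ffunP => J; rewrite !ffunE [a *: _ in RHS]mulr_sumr -big_split /=.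
by apply: eq_bigr => i _; rewrite !ffunE mulrDr mulrCA.
Qed.

Lemma contr_linl c a x y w : (forall i, c i = a * x i + y i) ->
  contr c w = a *: contr x w + contr y w.
Proof.
move=> cE; apply/ffunP => J; rewrite !ffunE [a *: _ in RHS]mulr_sumr -big_split /=.
by apply: eq_bigr => i _; rewrite cE mulrDr mulrDl !mulrA (mulrC a).
Qed.

Lemma wdg_linl c a x y w : (forall i, c i = a * x i + y i) ->
  wdg c w = a *: wdg x w + wdg y w.
Proof.
move=> cE; apply/ffunP => J; rewrite !ffunE [a *: _ in RHS]mulr_sumr -big_split /=.
by apply: eq_bigr => i _; rewrite cE mulrDr mulrDl !mulrA (mulrC a).
Qed.

(** The terms for [(i, k)] and [(k, i)] are opposite. They are paired through [i < k], since
    antisymmetry of the whole sum would only show that its double is 0. *)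
Lemma contr_sq c w : contr c (contr c w) = 0.
Proof.
apply/ffunP => J; rewrite !ffunE.
pose T i k := sgb i J * sgb k J * (-1) ^+ (i < k)%N * c i * c k * w (k |: (i |: J)).
have TN i k : i != k -> T i k = - T k i.
  move=> ik; rewrite /T (sg_lt ik) setUCA [sgb i J * _]mulrC.
  by rewrite mulrN !mulNr -!mulrA [c i * (c k * _)]mulrCA.
transitivity (\sum_(i | i \notin J) \sum_(k | (k \notin J) && (i != k)) T i k).
  apply: eq_bigr => i iJ; rewrite ffunE mulr_sumr; apply: eq_big => [k|k].
    by rewrite !inE negb_or andbC eq_sym.
  rewrite !inE negb_or => /andP[_ kJ]; rewrite sgbU1 // /T.
  by rewrite !mulrA; congr (_ * _); ring.
rewrite (eq_bigr (fun i => \sum_(k | (k \notin J) && (i < k)%N) T i k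
    + \sum_(k | (k \notin J) && (k < i)%N) T i k)); last first.
  move=> i _; rewrite (bigID (fun k : 'I_n => (i < k)%N)) /=.
  by congr (_ + _); apply: eq_bigl => k; rewrite -val_eqE /=; case: ltngtP; rewrite ?andbF ?andbT.
rewrite big_split /= [X in _ + X](exchange_big_dep (fun k => k \notin J)) /=; last first.
  by move=> i k _ /andP[].
rewrite -big_split /= big1 // => i iJ.
rewrite [X in _ + X](eq_bigl (fun k => (k \notin J) && (i < k)%N)); last first.
  by move=> k; rewrite iJ.
rewrite -big_split big1 // => k /andP[_ ik]; rewrite TN /= ?addNr //.
by rewrite neq_ltn ik.
Qed.

(** The interior product is an antiderivation: the terms where the contracted index is the inserted
    one give the pairing of [c] and [a], the others match up with opposite signs. *)
Lemma contr_wdg c a w :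
  contr c (wdg a w) = (\sum_i c i * a i) *: w - wdg a (contr c w).
Proof.
apply/ffunP => J; rewrite !ffunE.
rewrite (eq_bigr (fun i => c i * a i * w J
   + \sum_(j in J) sgb i J * c i * (sgb j (i |: J) * a j * w ((i |: J) :\ j)))); last first.
  move=> i iJ; rewrite ffunE big_setU1 //= mulrDr mulr_sumr setU1K //.
  congr (_ + _); rewrite sgbU1 // ltnn expr0 mul1r.
  transitivity (sgb i J * sgb i J * (c i * a i * w J)); last by rewrite sgb_sq mul1r.
  by ring.
rewrite big_split /= -mulr_suml exchange_big /=.
rewrite [X in _ = X - _](_ : _ = (\sum_i c i * a i) * w J) //.
rewrite [X in _ = X * _ - _](bigID (fun i => i \in J)) /= mulrDl [X in _ = X - _]addrC.
rewrite -addrA; congr (_ + _); apply/eqP; rewrite -subr_eq0; apply/eqP.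
rewrite opprB addrA mulr_suml -big_split /=.
rewrite -sumrB big1 // => j jJ; rewrite ffunE.
rewrite [X in _ + _ * X - _](bigD1 j) ?setD11 //= setD1K //.
rewrite [X in _ + _ * (_ + X) - _](eq_bigl (fun i => i \notin J)) => [|i]; last first.
  rewrite !inE negb_and negbK; case: eqVneq => [->|_] /=; rewrite ?jJ ?andbT //.
have -> : sgb j (J :\ j) = sgb j J by rewrite [RHS](sgbD1 _ jJ) ltnn expr0 mul1r.
rewrite mulrDr mulr_sumr addrCA -big_split /= big1 => [|i iJ].
  rewrite addr0 [_ * (_ * _ * _)](_ : _ = sgb j J * sgb j J * (c j * a j * w J)); last by ring.
  by rewrite sgb_sq mul1r subrr.
have ij : i != j by apply: contraNneq iJ => ->.
rewrite (sgbU1 _ iJ) (sgbD1 i jJ) (sg_lt ij).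
have -> : (i |: J) :\ j = i |: J :\ j.
  by apply/setP => k; rewrite !inE; case: (eqVneq k i) => [->|//]; rewrite ij.
set e := (-1) ^+ (j < i)%N; have ee : e * e = 1 by rewrite -expr2 sqrr_sign.
transitivity ((1 - e * e) * (sgb j J * a j * sgb i (J :\ j) * c i * w (i |: J :\ j))).
  by rewrite /=; ring.
by rewrite ee subrr mul0r.
Qed.

Definition contr_eq0 c : contr c 0 = 0.
Proof. by apply/ffunP => J; rewrite !ffunE big1 // => i _; rewrite ffunE mulr0. Qed.

Lemma contrZ c a w : contr c (a *: w) = a *: contr c w.
Proof. by have := contr_linr c a w 0; rewrite contr_eq0 !addr0. Qed.

(** The value [w(c_1, ..., c_p)], by successive interior products; by [ev_altf] it is 0 on lists of
    the wrong length when [w] is homogeneous. *)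
Fixpoint ev (w : W) (s : seq vec) : R :=
  if s is c :: s' then ev (contr c w) s' else w set0.

Lemma ev_linr a w v s : ev (a *: w + v) s = a * ev w s + ev v s.
Proof.
elim: s w v => [|c s IHs] w v /=; first by rewrite !ffunE.
by rewrite contr_linr IHs.
Qed.

Lemma ev_0 s : ev 0 s = 0.
Proof. by elim: s => [|c s IHs] /=; rewrite ?ffunE // contr_eq0. Qed.

Lemma evZ a w s : ev (a *: w) s = a * ev w s.
Proof. by have := ev_linr a w 0 s; rewrite ev_0 !addr0. Qed.

Lemma evD w v s : ev (w + v) s = ev w s + ev v s.
Proof. by have := ev_linr 1 w v s; rewrite scale1r mul1r. Qed.

Lemma evB w v s : ev (w - v) s = ev w s - ev v s.
Proof. by rewrite -scaleN1r evD evZ mulN1r. Qed.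

Definition hdeg p w := forall I, #|I| != p -> w I = 0.

Lemma hdeg_contr p c w : hdeg p.+1 w -> hdeg p (contr c w).
Proof.
move=> wp I Ip; rewrite ffunE big1 // => i iI.
by rewrite wp ?mulr0 // cardsU1 iI.
Qed.

Lemma hdeg0_contr c w : hdeg 0 w -> contr c w = 0.
Proof.
move=> wp; apply/ffunP => I; rewrite !ffunE big1 // => i iI.
by rewrite wp ?mulr0 // cardsU1 iI.
Qed.

Lemma hdeg_wdg p a w : hdeg p w -> hdeg p.+1 (wdg a w).
Proof.
move=> wp I Ip; rewrite ffunE big1 // => i iI.
by rewrite wp ?mulr0 //; apply: contraNneq Ip => <-; rewrite (cardsD1 i I) iI.
Qed.

Lemma ev_altf p w : hdeg p w -> altf p (ev w : seq vec -> R^o).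
Proof.
move=> wp; split.
- move=> s; elim: s p w wp => [|c s IHs] [|p] w wp //= sp.
  + by rewrite wp // cards0.
  + by rewrite hdeg0_contr // ev_0.
  + by apply: (IHs p) => //; apply: hdeg_contr.
- move=> s1 s2 a x y.
  rewrite -[RHS]/(a * ev w (s1 ++ x :: s2) + ev w (s1 ++ y :: s2)).
  elim: s1 w {wp} => [|c s1 IHs] w /=; last exact: IHs.
  by rewrite (@contr_linl _ a x y) ?ev_linr // => i; rewrite !ffunE.
- move=> s1 s2 x; elim: s1 w {wp} => [|c s1 IHs] w /=; last exact: IHs.
  by rewrite contr_sq ev_0.
Qed.

Definition dlt (i : 'I_n) : vec := [ffun j => (j == i)%:R].

Lemma ev_dlt w I : ev w (map dlt (enum I)) = w I.
Proof.
have -> : I = [set i in enum I] by apply/setP => i; rewrite inE mem_enum.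
have : sorted ltn (map val (enum I)).
  apply: (@subseq_sorted _ ltn ltn_trans _ (map val (enum 'I_n))).
    have -> : enum I = filter (mem I) (enum 'I_n) by rewrite enumT.
    exact/map_subseq/filter_subseq.
  by rewrite val_enum_ord iota_ltn_sorted.
have -> : enum [set i in enum I] = enum I.
  by apply: eq_enum => i; rewrite inE mem_enum.
elim: (enum I) w => [|i s IHs] w; first by move=> _; apply: (congr1 (fun J => w J)); apply/setP => i; rewrite !inE.
rewrite [map val _]/= => is_; have ss := path_sorted is_.
have /allP ilt := order_path_min ltn_trans is_.
rewrite /= IHs // ffunE.
have iN : i \notin [set j in s].
  by rewrite inE; apply/negP => /(map_f val)/ilt; rewrite ltnn.
rewrite (bigD1 i) //= big1 => [|j /andP[_ ji]]; last first.
  by rewrite ffunE (negbTE ji) mulr0 mul0r.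
(* The head of an increasing list is smaller than the rest, so no sign appears. *)
rewrite addr0 ffunE eqxx mulr1 /sgb /below big1 ?mul1r => [|j].
  by apply: (congr1 (fun J => w J)); apply/setP => j; rewrite !inE.
rewrite inE => /(map_f val)/ilt /= ij.
by rewrite ltnNge (ltnW ij).
Qed.

Lemma dlt_span (c : vec) : exists a : 'I_n -> R, c = \sum_i a i *: dlt i.
Proof.
exists c; apply/ffunP => j; rewrite sum_ffunE (bigD1 j) //= !ffunE eqxx big1.
  by rewrite addr0 /GRing.scale /= mulr1.
by move=> i /negbTE ij; rewrite !ffunE eq_sym ij scaler0.
Qed.

End Exterior.

Section Uniqueness.
Variables (R : nzRingType) (V X : lmodType R).

Lemma altf_sub p (f g : seq V -> X) : altf p f -> altf p g -> altf p (fun s => f s - g s).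
Proof.
move=> fa ga; split=> [t tp|s1 s2 a x y|s1 s2 x].
- by rewrite (altf_size fa) // (altf_size ga) // subrr.
- by rewrite (altf_lin fa) (altf_lin ga) opprD addrACA scalerBr.
- by rewrite (altf_alt fa) (altf_alt ga) subrr.
Qed.

Definition submod0 : submod X :=
  @Submod _ X (fun x => x = 0) erefl
    (fun a x y (hx : x = 0) (hy : y = 0) =>
       etrans (congr2 (fun u v => a *: u + v) hx hy)
              (etrans (addr0 (a *: 0)) (scaler0 _ a))).

Lemma altf_ext p n (b : 'I_n -> V) (f g : seq V -> X) :
  (forall v, exists c : 'I_n -> R, v = \sum_i c i *: b i) ->
  altf p f -> altf p g ->
  (forall I : {set 'I_n}, #|I| = p -> f (map b (enum I)) = g (map b (enum I))) ->
  f =1 g.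
Proof.
move=> bs fa ga fg s; apply/eqP; rewrite -subr_eq0; apply/eqP.
apply: (@altf_basis _ _ _ _ _ (altf_sub fa ga) submod0 n b bs) => I Ip /=.
by rewrite fg // subrr.
Qed.

End Uniqueness.

(** * Linear forms *)

Section Divisibility.
Variable R : idomainType.

Definition dvdr (x y : R) := exists z, y = x * z.

Lemma dvdr_mull (x y : R) : dvdr x (y * x). Proof. by exists y; rewrite mulrC. Qed.
Lemma dvdr_mulr (x y : R) : dvdr x (x * y). Proof. by exists y. Qed.
Lemma dvdr_refl (x : R) : dvdr x x. Proof. by exists 1; rewrite mulr1. Qed.
Lemma dvdr0 (x : R) : dvdr x 0. Proof. by exists 0; rewrite mulr0. Qed.
Lemma dvd1r (x : R) : dvdr 1 x. Proof. by exists x; rewrite mul1r. Qed.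
Lemma dvdr_trans (y x z : R) : dvdr x y -> dvdr y z -> dvdr x z.
Proof. by move=> [a ->] [b ->]; exists (a * b); rewrite mulrA. Qed.
Lemma dvdrMr (x y z : R) : dvdr x y -> dvdr x (y * z).
Proof. by move=> h; apply: dvdr_trans h (dvdr_mulr _ _). Qed.
Lemma dvdrMl (x y z : R) : dvdr x z -> dvdr x (y * z).
Proof. by move=> h; apply: dvdr_trans h (dvdr_mull _ _). Qed.
Lemma dvdrD (x y z : R) : dvdr x y -> dvdr x z -> dvdr x (y + z).
Proof. by move=> [a ->] [b ->]; exists (a + b); rewrite mulrDr. Qed.
Lemma dvdr_mul (x y x' y' : R) : dvdr x y -> dvdr x' y' -> dvdr (x * x') (y * y').
Proof. by move=> [a ->] [b ->]; exists (a * b); rewrite mulrACA. Qed.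
Lemma dvdr_mul2l (x y z : R) : x != 0 -> dvdr (x * y) (x * z) -> dvdr y z.
Proof. by move=> x0 [a]; rewrite -mulrA => /(mulfI x0) ->; exists a. Qed.
Lemma dvdr_exp (x : R) m n : (m <= n)%N -> dvdr (x ^+ m) (x ^+ n).
Proof. by move=> /subnKC <-; rewrite exprD; apply: dvdr_mulr. Qed.
Lemma dvdr_prod (I : eqType) (r : seq I) (F : I -> R) i :
  i \in r -> dvdr (F i) (\prod_(j <- r) F j).
Proof. by move=> ir; rewrite (big_rem i) //=; apply: dvdr_mulr. Qed.

Definition prm (p : R) := [/\ p != 0, ~ dvdr p 1 &
  forall x y, dvdr p (x * y) -> dvdr p x \/ dvdr p y].

Lemma prm_exp_cancel (p : R) k (x y : R) : prm p -> ~ dvdr p x -> dvdr (p ^+ k) (x * y) ->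
  dvdr (p ^+ k) y.
Proof.
move=> [p0 p1 pp] px; elim: k y => [|k IHk] y; first by rewrite expr0 => _; apply: dvd1r.
move=> h; have [//|[z yE]] : dvdr p x \/ dvdr p y.
  by apply: pp; apply: dvdr_trans h; rewrite exprS; apply: dvdr_mulr.
rewrite yE exprS; apply: dvdr_mul; first exact: dvdr_refl.
by apply: IHk; move: h; rewrite yE exprS mulrCA; apply: dvdr_mul2l.
Qed.

Section PrimeProducts.
Variables (T : eqType) (q : T -> R) (e : rel T).
Hypothesis qe : forall x y : T, e x y -> dvdr (q x) (q y) /\ dvdr (q y) (q x).

Lemma dvdr_prod_count (x : T) (D : seq T) :
  dvdr (q x ^+ count (e x) D) (\prod_(y <- D) q y).
Proof.
elim: D => [|y D IHD]; first by rewrite big_nil; apply: dvdr_refl.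
rewrite big_cons /=; case: (boolP (e x y)) => [exy|_] /=; last first.
  by rewrite add0n; apply: dvdrMl.
by rewrite add1n exprS; apply: dvdr_mul => //; have [] := qe exy.
Qed.

(** Each associate of [q x] in the product absorbs one power and the other factors none, which
    leaves one power for [f]. *)
Lemma prm_count_cancel (x : T) (D : seq T) f : prm (q x) ->
  (forall y, y \in D -> ~~ e x y -> ~ dvdr (q x) (q y)) ->
  dvdr (q x ^+ (count (e x) D).+1) ((\prod_(y <- D) q y) * f) -> dvdr (q x) f.
Proof.
move=> px; have [x0 _ _] := px.
suff h k g : (forall y, y \in D -> ~~ e x y -> ~ dvdr (q x) (q y)) ->
    dvdr (q x ^+ (count (e x) D + k)) ((\prod_(y <- D) q y) * g) ->
    dvdr (q x ^+ k) g.
  by rewrite -addn1 => xy hf; have := h 1%N f xy hf; rewrite expr1.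
elim: D g => [|y D IHD] g xD; first by rewrite big_nil mul1r.
have xD' z : z \in D -> ~~ e x z -> ~ dvdr (q x) (q z).
  by move=> zD; apply: xD; rewrite inE zD orbT.
rewrite big_cons -mulrA /=; case: (boolP (e x y)) => [exy|nexy] /=.
  have [_ [c xc]] := qe exy; rewrite add1n addSn exprS => h.
  apply: IHD => //; apply: (dvdr_mul2l x0).
  by rewrite [X in dvdr _ (X * _)]xc [q y * c]mulrC -mulrA; apply: dvdrMl.
rewrite add0n => h; apply: IHD => //.
by apply: prm_exp_cancel h => //; apply: xD; rewrite ?inE ?eqxx.
Qed.

(** The relation [e] groups associated primes, as happens for the forms of hyperplanes with the same
    trace on [H]; within a class the powers add up. *)
Lemma prm_prod_dvd (D : seq T) f :
  (forall x, x \in D -> prm (q x)) ->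
  {in D &, forall x y, ~~ e x y -> ~ dvdr (q x) (q y)} ->
  (forall x, x \in D -> e x x) ->
  (forall x, x \in D -> dvdr (q x ^+ count (e x) D) f) ->
  dvdr (\prod_(x <- D) q x) f.
Proof.
elim: D => [|x D IHD] pD nD rD hD; first by rewrite big_nil; apply: dvd1r.
have sD y : y \in D -> y \in x :: D by rewrite inE orbC => ->.
have [||||g fE] := IHD.
- by move=> y /sD; apply: pD.
- by move=> y z /sD yD /sD zD; apply: nD.
- by move=> y /sD; apply: rD.
- move=> y /sD yD; apply: dvdr_trans (hD y yD); apply: dvdr_exp.
  by rewrite /= leq_addl.
have xD : x \in x :: D by rewrite inE eqxx.
rewrite big_cons fE mulrC; apply: dvdr_mul; first exact: dvdr_refl.
apply: (@prm_count_cancel _ D); first exact: pD.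
  by move=> y /sD yD; apply: nD.
by have := hD x xD; rewrite /= rD //= add1n -fE.
Qed.

End PrimeProducts.
End Divisibility.

Section LinearForms.
Variables (K : fieldType) (V : vectType K) (n : nat) (b : n.-tuple V).
Hypothesis bB : basis_of fullv b.
Local Notation S := {mpoly K[n]}.

Definition fp (a : V -> K) : S := \sum_(i < n) a (tnth b i) *: 'X_i.

Lemma fp_ext a a' : a =1 a' -> fp a = fp a'.
Proof. by move=> e; apply: eq_bigr => i _; rewrite e. Qed.

Lemma fp_lin c a a' : fp (fun v => c * a v + a' v) = c *: fp a + fp a'.
Proof.
rewrite /fp scaler_sumr -big_split; apply: eq_bigr => i _.
by rewrite scalerDl scalerA.
Qed.

Lemma fp_scale c a : fp (fun v => c * a v) = c *: fp a.
Proof. by rewrite /fp scaler_sumr; apply: eq_bigr => i _; rewrite scalerA. Qed.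

Lemma mcoeff_fp a i : (fp a)@_U_(i) = a (tnth b i).
Proof.
rewrite /fp raddf_sum (bigD1 i) //= mcoeffZ mcoeffX eqxx mulr1 big1 ?addr0 //.
move=> j ji; rewrite mcoeffZ mcoeffX.
suff -> : (U_(j) == U_(i))%MM = false by rewrite mulr0.
apply/eqP => /mnmP/(_ j); rewrite !mnm1E eqxx eq_sym (negbTE ji).
by [].
Qed.

Lemma basis_exp v : v = \sum_(i < n) coord b i v *: tnth b i.
Proof.
rewrite {1}(coord_basis bB (memvf v)); apply: eq_bigr => i _.
by rewrite (tnth_nth 0).
Qed.

Lemma fp_eq0 (a : {linear V -> K^o}) : fp a = 0 -> forall v, a v = 0.
Proof.
move=> a0 v; rewrite (basis_exp v) linear_sum big1 // => i _.
by rewrite linearZ /= -mcoeff_fp a0 mcoeff0 scaler0.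
Qed.

Lemma coord_tnth i j : coord b i (tnth b j) = (i == j)%:R.
Proof. by rewrite (tnth_nth 0) coord_free ?(basis_free bB) // eq_sym. Qed.

Lemma fp_coord i : fp (coord b i) = 'X_i.
Proof.
rewrite /fp (bigD1 i) //= coord_tnth eqxx scale1r big1 ?addr0 //.
by move=> j ji; rewrite coord_tnth eq_sym (negbTE ji) scale0r.
Qed.

End LinearForms.

Section Pullback.
Variable K : fieldType.

Section Def.
Variables (V1 V2 : vectType K) (n1 n2 : nat) (b1 : n1.-tuple V1) (b2 : n2.-tuple V2).
Variable g : {linear V1 -> V2}.

(** Composition of polynomial functions on [V2] with [g], in coordinates. *)
Definition pb : {rmorphism {mpoly K[n2]} -> {mpoly K[n1]}} :=
  comp_mpoly [tuple fp b1 (fun v => coord b2 i (g v)) | i < n2].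

Lemma pbC c : pb c%:MP = c%:MP.
Proof. exact: comp_mpolyC. Qed.
Lemma pbX i : pb 'X_i = fp b1 (fun v => coord b2 i (g v)).
Proof. by rewrite /pb /= comp_mpolyXU -tnth_nth tnth_mktuple. Qed.
Lemma pbZ c p : pb (c *: p) = c *: pb p.
Proof. by rewrite -!mul_mpolyC rmorphM pbC. Qed.

Lemma pb_fp (a : {linear V2 -> K^o}) : basis_of fullv b2 ->
  pb (fp b2 a) = fp b1 (fun v => a (g v)).
Proof.
move=> bB2; rewrite /fp rmorph_sum.
transitivity (\sum_(i < n2) a (tnth b2 i) *: fp b1 (fun v => coord b2 i (g v))).
  by apply: eq_bigr => i _; rewrite pbZ pbX.
rewrite /fp; under eq_bigr do rewrite scaler_sumr.
rewrite exchange_big; apply: eq_bigr => j _ /=.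
rewrite [in RHS](basis_exp bB2 (g _)) linear_sum scaler_suml.
by apply: eq_bigr => i _; rewrite scalerA linearZ /= mulrC.
Qed.

End Def.

Lemma pb_id (V : vectType K) n (b : n.-tuple V) (g : {linear V -> V}) :
  basis_of fullv b -> g =1 id -> pb b b g =1 id.
Proof.
move=> bB gid; apply: (@rmorph_mpoly_ext _ _ _ (pb b b g) idfun) => [c|i] /=.
  by rewrite pbC.
rewrite pbX -[RHS](fp_coord bB); apply: fp_ext => v; by rewrite gid.
Qed.

Lemma pb_comp (V1 V2 V3 : vectType K) n1 n2 n3 (b1 : n1.-tuple V1)
    (b2 : n2.-tuple V2) (b3 : n3.-tuple V3) (g : {linear V1 -> V2})
    (h : {linear V2 -> V3}) (k : {linear V1 -> V3}) :
  basis_of fullv b2 -> (forall v, k v = h (g v)) ->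
  forall p, pb b1 b2 g (pb b2 b3 h p) = pb b1 b3 k p.
Proof.
move=> bB kE.
apply: (@rmorph_mpoly_ext _ _ _ (pb b1 b2 g \o pb b2 b3 h)%FUN (pb b1 b3 k)) => [c|i].
  by rewrite [LHS]/= !pbC.
rewrite [LHS]/= !pbX.
have cl : linear (fun v => coord b3 i (h v) : K^o) by move=> c x y; rewrite !linearP.
rewrite (pb_fp _ _ (mklin cl)) //; apply: fp_ext => v.
by rewrite mklinE kE.
Qed.

End Pullback.

Section FormPrimes.
Variables (K : fieldType) (V : vectType K) (n : nat) (b : n.-tuple V).
Hypothesis bB : basis_of fullv b.
Variables (a : {linear V -> K^o}) (u : V).
Hypothesis au : a u = 1.

Fact along_linear : linear (fun v => v - a v *: u).
Proof.
by move=> c x y; rewrite linearP scalerDl scalerBr opprD addrACA scalerA.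
Qed.
Definition along : {linear V -> V} := mklin along_linear.

Local Notation rho := (pb b b along).

Lemma rho_fp (a' : {linear V -> K^o}) : rho (fp b a') = fp b a' - a' u *: fp b a.
Proof.
rewrite pb_fp // [RHS]addrC -scaleNr -fp_lin; apply: fp_ext => v.
by rewrite /along mklinE linearB linearZ /= addrC mulNr mulrC.
Qed.

Lemma rho_form : rho (fp b a) = 0.
Proof. by rewrite rho_fp au scale1r subrr. Qed.

Lemma rho_div f : exists y, f = rho f + fp b a * y.
Proof.
apply: hom_div => [c|i]; first exact: pbC.
exists (coord b i u)%:MP; rewrite -(fp_coord bB i).
have cl : linear (fun v => coord b i v : K^o) by move=> c x y; rewrite linearP.
have := rho_fp (mklin cl); rewrite -[fp b (mklin cl)]/(fp b (coord b i)) => ->.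
by rewrite mklinE mulrC mul_mpolyC subrK.
Qed.

(** [rho] composes with the projection onto the kernel of [a] along [u]: it kills the form and
    changes any polynomial by a multiple of it only. *)
Lemma dvd_form f : dvdr (fp b a) f <-> rho f = 0.
Proof.
split=> [[y ->]|f0]; first by rewrite rmorphM rho_form mul0r.
by have [y ->] := rho_div f; exists y; rewrite f0 add0r.
Qed.

(** The multiples of the form are the kernel of the ring morphism [rho] into a domain. *)
Lemma form_prm : prm (fp b a).
Proof.
split.
- apply/eqP => /(fp_eq0 bB)/(_ u); rewrite au => /eqP; by rewrite oner_eq0.
- by move=> /dvd_form /eqP; rewrite rmorph1 oner_eq0.
- move=> x y /dvd_form; rewrite rmorphM => /eqP; rewrite mulf_eq0.
  by move=> /orP[]/eqP h; [left | right]; apply/dvd_form.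
Qed.

Lemma dvd_form_form (a' : {linear V -> K^o}) : dvdr (fp b a) (fp b a') ->
  forall v, a v = 0 -> a' v = 0.
Proof.
move=> /dvd_form; rewrite pb_fp //.
have cl : linear (fun v => a' (along v) : K^o) by move=> c x y; rewrite !linearP.
move=> h v av; have := @fp_eq0 _ _ _ _ bB (mklin cl) h v.
by rewrite mklinE /along mklinE av scale0r subr0.
Qed.

End FormPrimes.

(** * Logarithmic forms *)

Section ExteriorDvd.
Variables (R : idomainType) (n : nat).
Local Notation W := {ffun {set 'I_n} -> R^o}.

Lemma wdg_set0 a (w : W) : wdg a w set0 = 0.
Proof. by rewrite ffunE big_set0. Qed.

Lemma ev_wdg_cons a (w : W) c s :
  ev (wdg a w) (c :: s) = (\sum_i c i * a i) * ev w s - ev (wdg a (contr c w)) s.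
Proof. by rewrite /= contr_wdg evB evZ. Qed.

Lemma ev_wdg_dvd f a (w : W) (s : seq {ffun 'I_n -> R^o}) :
  (forall c, c \in s -> dvdr f (\sum_i c i * a i)) -> dvdr f (ev (wdg a w) s).
Proof.
elim: s w => [|c s IHs] w hs; first by rewrite /= wdg_set0; apply: dvdr0.
rewrite ev_wdg_cons -mulN1r; apply: dvdrD.
  by apply: dvdrMr; apply: hs; rewrite inE eqxx.
by apply: dvdrMl; apply: IHs => d ds; apply: hs; rewrite inE ds orbT.
Qed.

Lemma ev_dvd f (w : W) s : (forall I, dvdr f (w I)) -> dvdr f (ev w s).
Proof.
move=> /boolp.choice[v vE].
have -> : w = f *: ([ffun I => v I] : W) by apply/ffunP => I; rewrite !ffunE vE.
by rewrite evZ; apply: dvdr_mulr.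
Qed.

End ExteriorDvd.

(** * Forms as functions on vectors of [V], and the modules [Lp] *)

Section VectorForms.
Variables (K : fieldType) (V : vectType K) (n : nat) (b : n.-tuple V).
Hypothesis bB : basis_of fullv b.
Local Notation S := {mpoly K[n]}.
Local Notation W := ({ffun {set 'I_n} -> S^o} : lmodType S).

Definition crd (v : V) : {ffun 'I_n -> S^o} := [ffun i => (coord b i v)%:MP].
Definition evV (w : W) (s : seq V) : S := ev w (map crd s).

Lemma crd_lin (a : K) x y : crd (a *: x + y) = a%:MP *: crd x + crd y.
Proof. by apply/ffunP => i; rewrite !ffunE linearP mpolyCD mpolyCM. Qed.

Lemma evV_altf p w : hdeg p w -> altf p (evV w : seq V -> S).
Proof.
move=> wp; apply: (@altf_comp K S V S {ffun 'I_n -> S^o} S^o (@mpolyC _ _) crd id p).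
- exact: crd_lin.
- by move=> a x y; rewrite -mul_mpolyC.
- exact: ev_altf.
Qed.

Lemma crd_tnth i : crd (tnth b i) = dlt S i.
Proof. by apply/ffunP => j; rewrite !ffunE coord_tnth // mpolyC_nat. Qed.

Lemma evV_tnth w (I : {set 'I_n}) : evV w (map (tnth b) (enum I)) = w I.
Proof.
by rewrite /evV -map_comp -[RHS]ev_dlt; congr (ev _ _); apply: eq_map => i /=; rewrite crd_tnth.
Qed.

Lemma tnth_span v : exists c : 'I_n -> K, v = \sum_i c i *: tnth b i.
Proof. by exists (fun i => coord b i v); apply: basis_exp. Qed.

Definition cof p (f : seq V -> S) : W :=
  [ffun I : {set 'I_n} => if #|I| == p then f (map (tnth b) (enum I)) else 0].

Lemma hdeg_cof p f : hdeg p (cof p f).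
Proof. by move=> I /negbTE Ip; rewrite ffunE Ip. Qed.

Lemma evV_cof p f : altf p f -> evV (cof p f) =1 f.
Proof.
move=> fa; apply: (altf_ext tnth_span (evV_altf (@hdeg_cof p f)) fa) => I Ip.
by rewrite evV_tnth ffunE Ip eqxx.
Qed.

Lemma cof_evV p w : hdeg p w -> cof p (evV w) = w.
Proof.
move=> wp; apply/ffunP => I; rewrite ffunE evV_tnth.
by case: eqVneq => // Ip; rewrite wp.
Qed.

Lemma evV_lin a w v s : evV (a *: w + v) s = a * evV w s + evV v s.
Proof. exact: ev_linr. Qed.

Lemma cof_ext p f g : f =1 g -> cof p f = cof p g.
Proof. by move=> e; apply/ffunP => I; rewrite !ffunE e. Qed.

Lemma cof_lin p a f g :
  cof p (fun s => a * f s + g s) = a *: cof p f + cof p g.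
Proof.
apply/ffunP => I; rewrite !ffunE; case: ifP => // _.
by rewrite scaler0 addr0.
Qed.

Fact dvdK_lin f (a : K) (x y : S) : dvdr f x -> dvdr f y -> dvdr f (a *: x + y).
Proof. by move=> hx hy; rewrite -mul_mpolyC; apply: dvdrD => //; apply: dvdrMl. Qed.
Definition dvdK f : submod S := @Submod K S (dvdr f) (dvdr0 f) (@dvdK_lin f).

Section OneForm.
Variables (a : {linear V -> K^o}) (u : V).
Hypothesis au : a u = 1.
Definition acof (i : 'I_n) : S := (a (tnth b i))%:MP.

Lemma sum_acof v : \sum_i crd v i * acof i = (a v)%:MP.
Proof.
rewrite {2}(basis_exp bB v) linear_sum rmorph_sum; apply: eq_bigr => i _.
by rewrite ffunE linearZ /= -mpolyCM.
Qed.

Lemma evV_wdg_ker w s : {in s, forall x, a x = 0} -> evV (wdg acof w) s = 0.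
Proof.
move=> sa; have [z ->] : dvdr 0 (evV (wdg acof w) s); last by rewrite mul0r.
apply: ev_wdg_dvd => c /mapP[v vs ->]; rewrite sum_acof sa //.
by rewrite mpolyC0; apply: dvdr0.
Qed.

Lemma evV_wdg_cons w v s : evV (wdg acof w) (v :: s) =
  (a v)%:MP * evV w s - evV (wdg acof (contr (crd v) w)) s.
Proof. by rewrite /evV [map _ _]/= ev_wdg_cons sum_acof. Qed.

Lemma evV_wdg_cons_ker w v s : {in s, forall x, a x = 0} ->
  evV (wdg acof w) (v :: s) = (a v)%:MP * evV w s.
Proof. by move=> sa; rewrite evV_wdg_cons evV_wdg_ker ?subr0. Qed.

(** On vectors [s] of the kernel of [a], the form [a /\ w] vanishes and [(a /\ w)(u, s) = w(s)]; by
    [altf_hyperplane] these values decide. This turns the wedge condition of logarithmic forms into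
    one on values. *)
Lemma dvd_wdgP p f w : hdeg p w ->
  (forall J, dvdr f (wdg acof w J)) <->
  (forall s, {in s, forall x, a x = 0} -> dvdr f (evV w s)).
Proof.
move=> wp; split=> [hf s sa|hf J].
  rewrite -[evV w s]mul1r -mpolyC1 -au -evV_wdg_cons_ker //.
  exact: ev_dvd.
rewrite -evV_tnth; suff: forall s, dvdK f (evV (wdg acof w) s) by exact.
apply: (altf_hyperplane (evV_altf (hdeg_wdg acof wp)) (Q := dvdK f) au) => s sa /=.
  by rewrite evV_wdg_ker //; apply: dvdr0.
by rewrite evV_wdg_cons_ker //; apply: dvdrMl; apply: hf.
Qed.

End OneForm.

(* Opaque, and with a type that does not mention [alpha L], because comparing
   two forms [alpha L] by conversion runs [xchoose]. *)
Fact lform_key : {F : {vspace V} -> {linear V -> K^o} | forall L, F L =1 alpha L}.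
Proof. by exists (fun L => fun_of_lfun (alpha L)). Qed.
Definition lform : {vspace V} -> {linear V -> K^o} := sval lform_key.
Lemma lformE L : lform L =1 alpha L. Proof. exact: (svalP lform_key L). Qed.
Definition lpoly (L : {vspace V}) : S := fp b (lform L).

Lemma lform0 L v : hyperplane L -> (lform L v == 0 :> K) = (v \in L).
Proof. by move=> hL; rewrite -{2}(lker_alpha hL) memv_ker lformE. Qed.

Lemma lform_in L v : hyperplane L -> v \in L -> lform L v = 0.
Proof. by move=> hL vL; apply: (@eqP K _ _); rewrite lform0. Qed.

Lemma in_lform L v : hyperplane L -> lform L v = 0 -> v \in L.
Proof. by move=> hL v0; rewrite -lform0 // v0. Qed.

Lemma lpolyE L : lpoly L = form_poly b (alpha L).
Proof. by apply: eq_bigr => i _; rewrite lformE. Qed.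

Lemma lform_one L : hyperplane L -> exists u, lform L u = 1.
Proof.
move=> hL; have [v] : exists v, v \notin L.
  apply: contrapT => h; move: hL; rewrite /hyperplane.
  have -> : L = fullv.
    apply/vspaceP => v; rewrite memvf; apply/negPn/negP => vL.
    by apply: h; exists v.
  by rewrite eqn_leq ltnn.
rewrite -lform0 // => v0; exists ((lform L v)^-1 *: v).
by rewrite linearZ /= /GRing.scale /= mulVf.
Qed.

Lemma lform_subset L (s : seq V) : hyperplane L ->
  {subset s <= L} <-> {in s, forall x, lform L x = 0}.
Proof.
move=> hL; split=> h x xs; first by apply: lform_in (h x xs).
by apply: in_lform (h x xs).
Qed.

Section LogModule.
Variables (A : {pred {vspace V}}) (p : nat).

Definition in_Lp (w : W) : Prop := hdeg p w /\
  forall L, L \in A -> forall s : seq V, {subset s <= L} -> dvdr (lpoly L) (evV w s).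

Fact in_Lp0 : in_Lp 0.
Proof.
split=> [I _|L LA s sL]; first by rewrite ffunE.
by rewrite /evV ev_0; apply: dvdr0.
Qed.
Fact in_LpL a x y : in_Lp x -> in_Lp y -> in_Lp (a *: x + y).
Proof.
move=> [xp xA] [yp yA]; split=> [I Ip|L LA s sL].
  by rewrite !ffunE xp // yp // scaler0 addr0.
by rewrite evV_lin; apply: dvdrD; [apply: dvdrMl; apply: xA | apply: yA].
Qed.
Definition Lp : submod W := Submod in_Lp0 in_LpL.

End LogModule.

Lemma Lp_sub (A B : {pred {vspace V}}) p w : {subset A <= B} -> Lp B p w -> Lp A p w.
Proof. by move=> AB [wp wB]; split=> // L /AB; apply: wB. Qed.

End VectorForms.

Section OmegaLp.
Variables (K : fieldType) (V : vectType K) (n : nat) (b : n.-tuple V).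
Hypothesis bB : basis_of fullv b.
Local Notation S := {mpoly K[n]}.
Local Notation W := ({ffun {set 'I_n} -> S^o} : lmodType S).
Variables (A : {fset {vspace V}}) (p : nat).
Hypothesis Aarr : arrangement A.

Local Notation Q := (defining_poly b A).

Lemma defining_poly_neq0 : Q != 0.
Proof.
rewrite /defining_poly prodf_seq_neq0; apply/allP => L LA /=.
have [u au] := lform_one (Aarr LA); rewrite -lpolyE.
by have [] := form_prm bB (a := lform L) au.
Qed.

Lemma inversions_set1 (i : 'I_n) (J : {set 'I_n}) : i \in J ->
  inversions [set i] (J :\ i) = below i J.
Proof.
move=> iJ; rewrite /below (bigD1 i) //= ltnn add0n.
rewrite -big_mkcondr sum1dep_card /inversions.
have -> : [set ij in setX [set i] (J :\ i) | (ij.2 < ij.1)%N] =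
    setX [set i] [set j in J | (j < i)%N].
  apply/setP => -[k j]; rewrite !inE /=; case: eqVneq => //= ->.
  by case: (eqVneq j i) => [->|_] /=; rewrite ?ltnn ?andbF.
rewrite cardsX cards1 mul1n; apply: eq_card => j; rewrite !inE.
by case: (eqVneq j i) => [->|_] /=; rewrite ?ltnn ?andbF ?andbT.
Qed.

(** Only the singletons contribute to the left factor, and the partial derivatives of a linear form
    are its constant coefficients. *)
Lemma wedge_dpoly (L : {vspace V}) (w : rform K n) (v : W) :
  (forall I, w I = tofrac (v I)) -> forall J,
  wedge (dpoly (form_poly b (alpha L))) w J = tofrac (wdg (acof b (lform L)) v J).
Proof.
move=> wv J; rewrite !ffunE.
under eq_bigr => I IJ do rewrite ffunE wv mulr_sumr mulr_suml.
rewrite (exchange_big_dep predT) //= rmorph_sum [RHS]big_mkcond /=.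
apply: eq_bigr => i _; case: ifP => iJ; last first.
  rewrite big_pred0 // => I; apply/negP => /andP[IJ /eqP Ii].
  by move: IJ; rewrite Ii sub1set iJ.
rewrite (big_pred1 [set i]) => [|I]; last first.
  by rewrite /=; case: eqVneq => [->|]; rewrite ?sub1set ?iJ ?andbF.
rewrite inversions_set1 // !rmorphM /sgb rmorphXn rmorphN1 /=; congr (_ * _ * _).
congr tofrac; rewrite /acof lformE /form_poly raddf_sum (bigD1 i) //= big1 => [|j ji].
  rewrite mderivZ mderivX mnm1E eqxx scale1r addr0.
  have -> : (U_(i) - U_(i))%MM = 0%MM by apply/mnmP => j; rewrite mnmBE mnm0E subnn.
  by rewrite mpolyX0 -mul_mpolyC mulr1.
by rewrite mderivZ mderivX mnm1E (negbTE ji) scale0r scaler0.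
Qed.

(** Multiplication by [Q] clears the denominators, and [dvd_wdgP] translates the condition at each
    hyperplane. *)
Lemma log_formP (w : rform K n) : log_form b A p w <->
  exists2 v : W, Lp b (mem A) p v & forall I, tofrac Q * w I = tofrac (v I).
Proof.
have Q0 : tofrac Q != 0 by rewrite tofrac_eq0 defining_poly_neq0.
have tofrac_inj : injective (@tofrac S).
  by move=> x y xy; apply/eqP; rewrite -subr_eq0 -tofrac_eq0 rmorphB /= xy subrr.
have ZE (g : rform K n) J : (Q *: g) J = tofrac Q * g J by rewrite ffunE.
have wedgeQ (v : W) L : (forall I, tofrac Q * w I = tofrac (v I)) ->
    forall J, tofrac Q * wedge (dpoly (form_poly b (alpha L))) w J =
      tofrac (wdg (acof b (lform L)) v J).
  move=> vE J; rewrite -(@wedge_dpoly L (Q *: w)) => [|I].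
    have -> : wedge (dpoly (form_poly b (alpha L))) (Q *: w) =
       Q *: wedge (dpoly (form_poly b (alpha L))) w + wedge (dpoly (form_poly b (alpha L))) 0.
      by rewrite -wedge_linear addr0.
    by rewrite wedge0 addr0 ZE.
  by rewrite ZE vE.
split=> [[wr wl]|[v [vp vA] vE]].
  have /boolp.choice[v vE] : forall I, exists v : S, tofrac Q * w I = tofrac v.
    move=> I; have := wr I; rewrite ZE; case: ifP => _ => [[v ->]|->].
      by exists v.
    by exists 0; rewrite rmorph0.
  have vE' I : tofrac Q * w I = tofrac (([ffun I => v I] : W) I) by rewrite ffunE.
  exists [ffun I => v I] => //; have vp : hdeg p ([ffun I => v I] : W).
    move=> I /negbTE Ip; have := wr I; rewrite Ip ZE => h.
    by apply: tofrac_inj; rewrite rmorph0 -vE'.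
  split=> // L LA s; have hL := Aarr LA; have [u au] := lform_one hL.
  move/(lform_subset _ hL); apply: (proj1 (dvd_wdgP bB au (lpoly b L) vp)) => J.
  have [z zr zE] := wl L LA; have := congr1 (fun f : rform K n => f J) zE.
  rewrite ZE (wedgeQ _ _ vE') [RHS]ffunE -lpolyE => h.
  have := zr J; case: ifP => _ => [[y zJ]|zJ].
    exists y; apply: tofrac_inj; rewrite h zJ rmorphM; by [].
  exists 0; rewrite mulr0; apply: tofrac_inj; rewrite h zJ rmorph0.
  exact: mulr0.
split=> [I|L LA].
  rewrite ZE vE; case: eqVneq => [_|Ip]; first by exists (v I).
  by rewrite vp ?rmorph0.
have hL := Aarr LA; have [u au] := lform_one hL.
have h s : {in s, forall x, lform L x = 0} -> dvdr (lpoly b L) (evV b v s).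
  by move=> sL; apply: vA => //; apply/lform_subset.
have /boolp.choice[z zE] := proj2 (dvd_wdgP bB au (lpoly b L) vp) h.
have zp (J : {set 'I_n}) : #|J| != p.+1 -> z J = 0.
  move=> Jp; have := zE J; rewrite (hdeg_wdg _ vp) // => /esym/eqP.
  rewrite mulf_eq0 => /orP[/eqP z0|/eqP //].
  by have [/eqP] := form_prm bB (a := lform L) au.
exists [ffun J => tofrac (z J)].
  by move=> J; case: eqVneq => [_|Jp]; rewrite ffunE; [exists (z J) | rewrite zp ?rmorph0].
apply/ffunP => J; rewrite ZE (wedgeQ _ _ vE) zE lpolyE rmorphM ffunE; congr (_ * _).
by rewrite ffunE.
Qed.

Lemma Omega_Lp : exists i : {linear Omega b A p -> subm (Lp b (mem A) p)},
  injective i /\ surj i.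
Proof.
have Q0 : tofrac Q != 0 by rewrite tofrac_eq0 defining_poly_neq0.
have tofrac_inj : injective (@tofrac S).
  by move=> x y xy; apply/eqP; rewrite -subr_eq0 -tofrac_eq0 rmorphB /= xy subrr.
have ex (w : Omega b A p) : exists v : W, Lp b (mem A) p v /\
    forall I, tofrac Q * log_val w I = tofrac (v I).
  case: w => w /=; rewrite inE => /asboolP/log_formP[v v1 v2]; by exists v.
have [f fP] := boolp.choice ex.
have fL w : Lp b (mem A) p (f w) by have [] := fP w.
have fE w I : tofrac Q * log_val w I = tofrac (f w I) by have [_] := fP w.
have fl : linear f.
  move=> a x y; apply/ffunP => I; apply: tofrac_inj; rewrite -fE.
  have -> : log_val (a *: x + y) I = tofrac a * log_val x I + log_val y I.
    by rewrite /= !ffunE.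
  have -> : (a *: f x + f y) I = a * f x I + f y I by rewrite !ffunE.
  by rewrite mulrDr mulrCA !fE rmorphD rmorphM.
exists (factor (fun w => fL w : Lp b (mem A) p (mklin fl w))); split.
  move=> x y /(congr1 (@sval_ _ _ _)) fxy; apply: val_inj; apply/ffunP => I.
  apply: (mulfI Q0); rewrite !fE.
  exact: (congr1 (fun g : W => tofrac (g I : S)) fxy).
move=> v; pose w : rform K n := [ffun I => tofrac (sval_ v I) / tofrac Q].
have wE I : tofrac Q * w I = tofrac (sval_ v I) by rewrite ffunE mulrC divfK.
have wl : w \in log_pred b A p.
  by rewrite inE; apply/asboolP/log_formP; exists (sval_ v) => //; apply: submP.
exists (LogForm wl); apply: subm_inj; apply/ffunP => I; apply: tofrac_inj.
by rewrite -[LHS]/(tofrac (f (LogForm wl) I)) -(fE (LogForm wl) I) -wE.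
Qed.

End OmegaLp.

(** * Reflexivity *)

Section MoreFormPrimes.
Variables (K : fieldType) (V : vectType K) (n : nat) (b : n.-tuple V).
Hypothesis bB : basis_of fullv b.
Implicit Types a : {linear V -> K^o}.

Lemma form_normalize a v : a v != 0 :> K ->
  exists c (a1 : {linear V -> K^o}), [/\ c != 0, a1 v = 1, forall x, a x = c * a1 x &
    fp b a = c *: fp b a1].
Proof.
move=> av; have l1 : linear (fun x => (a v)^-1 * a x : K^o).
  by move=> c x y; rewrite linearP mulrDr mulrCA.
exists (a v), (mklin l1).
have aE x : a x = a v * mklin l1 x by rewrite mklinE mulrA divff // mul1r.
split=> //; first by rewrite mklinE mulVf.
by rewrite -fp_scale; apply: fp_ext => x; rewrite -aE.
Qed.

Lemma dvdr_scalel (c : K) (f g : {mpoly K[n]}) : c != 0 -> dvdr (c *: f) g <-> dvdr f g.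
Proof.
move=> c0; split=> -[z ->].
  by exists (c *: z); rewrite -scalerAl scalerAr.
by exists (c^-1 *: z); rewrite -scalerAl -scalerAr scalerA divff // scale1r.
Qed.

Lemma dvdr_scaler (c : K) (f g : {mpoly K[n]}) : c != 0 -> dvdr f (c *: g) <-> dvdr f g.
Proof.
move=> c0; split=> -[z zE]; last by exists (c *: z); rewrite zE scalerAr.
by exists (c^-1 *: z); rewrite -scalerAr -zE scalerA mulVf // scale1r.
Qed.

Lemma form_prm_neq0 a v : a v != 0 :> K -> prm (fp b a).
Proof.
move=> av; have [c [a1 [c0 a1v _ ->]]] := form_normalize av.
have [p0 p1 pp] := form_prm bB a1v; split.
- by rewrite scaler_eq0 negb_or c0.
- by move/(dvdr_scalel _ _ c0).
- move=> x y /(dvdr_scalel _ _ c0)/pp[]/(dvdr_scalel _ _ c0) h; by [left | right].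
Qed.

Lemma dvd_form_ker a a' v : a v != 0 :> K -> dvdr (fp b a) (fp b a') ->
  forall x, a x = 0 -> a' x = 0.
Proof.
move=> av; have [c [a1 [c0 a1v aE ->]]] := form_normalize av.
move=> /(dvdr_scalel _ _ c0) h x; rewrite aE => /eqP.
by rewrite mulf_eq0 (negbTE c0) => /eqP; apply: (dvd_form_form bB a1v h).
Qed.

Lemma ker_sub_scale a a' v : a v != 0 :> K -> (forall x, a x = 0 -> a' x = 0) ->
  forall x, a v * a' x = a' v * a x.
Proof.
move=> av h x; apply/eqP; rewrite -subr_eq0.
have E (f : {linear V -> K^o}) : f (a v *: x - a x *: v) = a v * f x - a x * f v.
  by rewrite linearB [X in X - _]linearZ [X in _ - X]linearZ.
rewrite [a' v * _]mulrC -E; apply/eqP/h; rewrite E.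
by rewrite mulrC subrr.
Qed.

Lemma fp_proportional a a' v : a v != 0 :> K -> (forall x, a x = 0 -> a' x = 0) ->
  fp b a' = (a' v / a v) *: fp b a.
Proof.
move=> av h; rewrite -fp_scale; apply: fp_ext => x.
by apply: (mulfI av); rewrite (ker_sub_scale av h) mulrA mulrCA divff ?mulr1.
Qed.

End MoreFormPrimes.

Lemma prm_prod_dvd_ex (R : idomainType) (T : eqType) (q : T -> R) p (D : seq T) :
  prm p -> dvdr p (\prod_(x <- D) q x) -> exists2 x, x \in D & dvdr p (q x).
Proof.
move=> [_ p1 pp]; elim: D => [|x D IHD]; first by rewrite big_nil => /p1.
rewrite big_cons => /pp[h|/IHD[y yD h]]; first by exists x; rewrite ?inE ?eqxx.
by exists y; rewrite ?inE ?yD ?orbT.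
Qed.

(* A projective submodule of a torsion-free module is closed under division by
   a family of elements without common factor. *)
Section Reflexivity.
Variables (R : idomainType) (I : finType).
Local Notation W := ({ffun I -> R^o} : lmodType R).
Variables (T : eqType) (D : seq T) (c : T -> R) (i0 : T).

Lemma proj_closed (M : submod W) (z : W) :
  projective (subm M) -> i0 \in D -> c i0 != 0 ->
  (forall i, i \in D -> M (c i *: z)) ->
  (forall f, (forall i, i \in D -> dvdr (c i0) (c i * f)) -> dvdr (c i0) f) ->
  M z.
Proof.
move=> pM i0D c0 Mz cf.
have [s sP] := pM _ _ (fgcover (subm M)) idfun (@fgcover_surj _ (subm M)).
pose x0 := mksub (Mz i0 i0D); pose F : {freeg (subm M) / R} := s x0.
(* By linearity of the section, [c i] times [s (c i0 z)] is [c i0] times [s (c i z)]; the absence of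
   a common factor then makes the coordinates of [s (c i0 z)] divisible by [c i0]. *)
have dF t : dvdr (c i0) (coeff t F).
  apply: cf => i iD; exists (coeff t (s (mksub (Mz i iD)))).
  rewrite -!coeffZ; congr (coeff t _); rewrite /F -!linearZ; congr (s _).
  by apply: subm_inj; rewrite /= !scalerA mulrC.
have [g gE] := boolp.choice dF.
pose G : {freeg (subm M) / R} := \sum_(t <- dom F) gen (g t) t.
have FG : F = c i0 *: G.
  rewrite [LHS]freeg_sum scaler_sumr; apply: eq_bigr => t _.
  by rewrite gen_scale gE.
have : x0 = c i0 *: fgcover _ G by rewrite -linearZ /= -FG; have := sP x0.
move=> /(congr1 (@sval_ _ _ _)) /= e.
suff -> : z = sval_ (fgcover _ G) by apply: submP.
apply/ffunP => j; apply: (mulfI c0).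
by have := congr1 (fun w : W => w j) e; rewrite !ffunE.
Qed.

End Reflexivity.

Section ImageRestr.
Variables (R Rb : comNzRingType) (rpi : {rmorphism R -> Rb}) (s : {rmorphism Rb -> R}).
Hypothesis piK : cancel s rpi.
Variables (X : lmodType R) (Y : lmodType Rb) (f : {linear X -> restr rpi Y}).

Fact imres0 : exists x, f x = 0 :> Y. Proof. by exists 0; rewrite linear0. Qed.
Fact imresL a (y z : Y) : (exists x, f x = y) -> (exists x, f x = z) ->
  exists x, f x = a *: y + z :> Y.
Proof.
move=> [x <-] [x' <-]; exists (s a *: x + x').
by rewrite linearP restrZ piK.
Qed.
(** An image over [R], seen as an [Rb]-submodule: scalars of [Rb] are lifted by the section [s]. *)
Definition imres : submod Y := @Submod _ Y (fun y => exists x, f x = y) imres0 imresL.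

Lemma imresP x : imres (f x). Proof. by exists x. Qed.
Fact imres_fun_linear : linear (fun x => mksub (imresP x) : restr rpi (subm imres)).
Proof. by move=> a x y; apply: subm_inj; rewrite /= linearP. Qed.
Definition imres_fun := mklin imres_fun_linear.

Lemma imres_ses (A : lmodType R) (i : {linear A -> X}) :
  injective i -> exact i f -> ses i imres_fun.
Proof.
move=> ii ex; split=> // [x|y].
  rewrite -ex; split=> [fx|fx]; last exact: subm_inj.
  exact: (congr1 (@sval_ _ _ _) fx).
by have [x xy] := submP y; exists x; apply: subm_inj.
Qed.

End ImageRestr.

(** * Polynomials and linear forms restricted to [H] *)

Section Hyperplane.
Variables (K : fieldType) (V : vectType K) (n m : nat) (b : n.-tuple V).
Hypothesis bB : basis_of fullv b.
Variable H : {vspace V}.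
Hypothesis hH : hyperplane H.
Variable y : m.-tuple (subvs_of H).
Hypothesis yB : basis_of fullv y.
Local Notation S := {mpoly K[n]}.
Local Notation Sb := {mpoly K[m]}.
Local Notation aH := (lform H).

Fact vs_key : {f : {linear subvs_of H -> V} | f =1 vsval}.
Proof. by exists (vsval : {linear subvs_of H -> V}). Qed.
Definition vs : {linear subvs_of H -> V} := sval vs_key.
Lemma vsE : vs =1 vsval. Proof. exact: (svalP vs_key). Qed.
Lemma vsH x : aH (vs x) = 0.
Proof. by apply: lform_in => //; rewrite vsE subvsP. Qed.
Lemma vs_ex v : aH v = 0 -> exists x, vs x = v.
Proof. by move/(in_lform hH) => vH; exists (vsproj H v); rewrite vsE vsprojK. Qed.
Lemma vs_map_ex s : {in s, forall v, aH v = 0} -> exists t, map vs t = s.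
Proof.
elim: s => [|v s IHs] sH; first by exists [::].
have [|t <-] := IHs; first by move=> x xs; apply: sH; rewrite inE xs orbT.
by have [|x <-] := @vs_ex v; [apply: sH; rewrite inE eqxx | exists (x :: t)].
Qed.
Lemma vs_mapH t : {in map vs t, forall v, aH v = 0}.
Proof. by move=> v /mapP[x _ ->]; apply: vsH. Qed.

Section Projection.
Variable u : V.
Hypothesis au : aH u = 1.

Fact prj_linear : linear (fun v => vsproj H (v - aH v *: u)).
Proof.
move=> c x z; rewrite -linearP; congr (vsproj H _).
by rewrite linearP scalerDl scalerBr opprD addrACA scalerA.
Qed.
Fact prj_key : {f : {linear V -> subvs_of H} | forall v, f v = vsproj H (v - aH v *: u)}.
Proof. by exists (mklin prj_linear). Qed.
Definition prj : {linear V -> subvs_of H} := sval prj_key.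
Lemma prjE v : prj v = vsproj H (v - aH v *: u). Proof. exact: (svalP prj_key). Qed.

Lemma vs_prj v : vs (prj v) = v - aH v *: u.
Proof.
rewrite prjE vsE vsprojK // -lform0 //.
by rewrite linearB linearZ /= au /GRing.scale /= mulr1 subrr.
Qed.
Lemma prj_vs x : prj (vs x) = x.
Proof. by rewrite prjE vsH scale0r subr0 vsE vsvalK. Qed.
Lemma map_prj_vs t : map prj (map vs t) = t.
Proof. by rewrite -map_comp -[RHS]map_id; apply: eq_map => x /=; apply: prj_vs. Qed.

End Projection.

(** Restriction of functions to [H], that is reduction modulo the form of [H]; [rsg u] extends
    functions constantly along [u] and is a section of it. *)
Definition rpi : {rmorphism S -> Sb} := pb y b vs.
Definition rsg u : {rmorphism Sb -> S} := pb b y (prj u).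

Lemma rsg_fp u (a : {linear subvs_of H -> K^o}) :
  rsg u (fp y a) = fp b (fun v => a (prj u v)).
Proof. exact: pb_fp. Qed.

Section WithU.
Variable u : V.
Hypothesis au : aH u = 1.

Lemma rsgK : cancel (rsg u) rpi.
Proof.
move=> f; rewrite /rpi /rsg.
have idl : linear (fun x : subvs_of H => x) by [].
rewrite (@pb_comp K _ _ _ _ _ _ y b y vs (prj u) (mklin idl) bB) => [|x]; last by rewrite prj_vs.
by rewrite pb_id.
Qed.

Lemma rsg_rpi f : rsg u (rpi f) = pb b b (along aH u) f.
Proof.
rewrite /rpi /rsg (@pb_comp K _ _ _ _ _ _ b y b (prj u) vs (along aH u) yB) // => v.
by rewrite vs_prj.
Qed.

Lemma rpi0P f : rpi f = 0 <-> dvdr (lpoly b H) f.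
Proof.
rewrite /lpoly (dvd_form bB au) -rsg_rpi; split=> [->|h]; first by rewrite rmorph0.
by rewrite -(rsgK (rpi f)) h rmorph0.
Qed.

Lemma rpi_lpolyH : rpi (lpoly b H) = 0.
Proof. by apply/rpi0P; apply: dvdr_refl. Qed.

Lemma rsg_rpi_div f : exists z, f = rsg u (rpi f) + lpoly b H * z.
Proof. by have [z zE] := @rho_div _ _ _ _ bB aH u f; exists z; rewrite rsg_rpi. Qed.

End WithU.

Lemma uH_ex : exists u, aH u = 1. Proof. exact: lform_one. Qed.

Lemma rpiP f : rpi f = 0 <-> dvdr (lpoly b H) f.
Proof. by have [u au] := uH_ex; apply: rpi0P au f. Qed.

Lemma lpolyH_neq0 : lpoly b H != 0.
Proof. by have [u au] := uH_ex; have [] := form_prm bB au. Qed.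

Fact lamform_key :
  {F : {vspace V} -> {linear subvs_of H -> K^o} | forall L x, F L x = lform L (vs x)}.
Proof. by exists (fun L => lform L \o vs)%FUN. Qed.
Definition lamform : {vspace V} -> {linear subvs_of H -> K^o} := sval lamform_key.
Lemma lamformE L x : lamform L x = lform L (vs x). Proof. exact: (svalP lamform_key L x). Qed.
Definition lam (L : {vspace V}) : Sb := fp y (lamform L).
Lemma rpi_lpoly L : rpi (lpoly b L) = lam L.
Proof. by rewrite /rpi /lpoly pb_fp //; apply: fp_ext => x; rewrite lamformE. Qed.

Definition eqvH (L L' : {vspace V}) : bool := (L :&: H == L' :&: H)%VS.

Lemma eqvH_refl L : eqvH L L. Proof. exact: eqxx. Qed.
Lemma eqvH_sym L L' : eqvH L L' = eqvH L' L. Proof. exact: eq_sym. Qed.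

Section TwoHyperplanes.
Variable L : {vspace V}.
Hypothesis hL : hyperplane L.
Hypothesis LH : L != H.

Lemma hyperplane_dim_eq (L1 L2 : {vspace V}) :
  hyperplane L1 -> hyperplane L2 -> (L1 <= L2)%VS -> L1 = L2.
Proof.
rewrite /hyperplane => /eqP h1 /eqP h2 s; apply/eqP; rewrite eqEdim s.
by rewrite -ltnS h1 h2 leqnn.
Qed.

Lemma lamform_neq0 : exists x, lamform L x != 0 :> K.
Proof.
apply: contrapT => h; move/eqP: LH; apply; apply/esym/hyperplane_dim_eq => //.
apply/subvP => v vH; rewrite -lform0 //; apply/negPn/negP => v0; apply: h.
have [|x xv] := @vs_ex v; first exact: lform_in.
by exists x; rewrite lamformE xv.
Qed.

Lemma lform_transverse : exists2 u, aH u = 1 & lform L u = 0.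
Proof.
have [v vL vH] : exists2 v, v \in L & v \notin H.
  apply: contrapT => h; move/eqP: LH; apply; apply: hyperplane_dim_eq => //.
  apply/subvP => v vL; apply/negPn/negP => vH; apply: h; by exists v.
rewrite -lform0 // in vH; exists ((aH v)^-1 *: v).
  by rewrite linearZ /= /GRing.scale /= mulVf.
by rewrite linearZ /= (lform_in hL vL) scaler0.
Qed.

Lemma lam_prm : prm (lam L).
Proof. by have [x x0] := lamform_neq0; apply: form_prm_neq0 x0. Qed.

Lemma lamform0 x : (lamform L x == 0 :> K) = (vs x \in (L :&: H)%VS).
Proof.
by rewrite memv_cap -!lform0 // vsH eqxx andbT lamformE.
Qed.

End TwoHyperplanes.

Lemma eqvH_lamform L L' x : hyperplane L -> hyperplane L' -> eqvH L L' ->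
  (lamform L x == 0 :> K) = (lamform L' x == 0 :> K).
Proof. by move=> hL hL' /eqP e; rewrite (lamform0 hL x) (lamform0 hL' x) e. Qed.

Lemma eqvH_lam L L' : hyperplane L -> hyperplane L' -> L != H -> L' != H ->
  eqvH L L' -> dvdr (lam L) (lam L').
Proof.
move=> hL hL' LH LH' e; have [x x0] := lamform_neq0 hL LH.
have x'0 : lamform L' x != 0 :> K by rewrite -(eqvH_lamform x hL hL' e).
have sub z : lamform L z = 0 -> lamform L' z = 0.
  by move=> /(@eqP K); rewrite (eqvH_lamform z hL hL' e) => /eqP.
have E : lam L' = (lamform L' x / lamform L x) *: lam L by apply: fp_proportional x0 sub.
rewrite E; apply/dvdr_scaler; last exact: dvdr_refl.
by rewrite mulf_neq0 ?invr_eq0.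
Qed.

Lemma lam_dvd_eqvH L L' : hyperplane L -> hyperplane L' -> L != H -> L' != H ->
  dvdr (lam L) (lam L') -> eqvH L L'.
Proof.
move=> hL hL' LH LH' d; have [x x0] := lamform_neq0 hL LH.
have sub := dvd_form_ker yB x0 d; have sc := ker_sub_scale x0 sub.
have x'0 : lamform L' x != 0 :> K.
  apply/negP => /eqP e; have [z z0] := lamform_neq0 hL' LH'.
  have := sc z; rewrite e mul0r => /eqP; rewrite mulf_eq0.
  by rewrite (negbTE x0) (negbTE z0).
apply/eqP/vspaceP => v; rewrite !memv_cap; case: (boolP (v \in H)); rewrite ?andbF // !andbT => vH.
have [|z <-] := @vs_ex v; first exact: lform_in.
rewrite -!lform0 // -!lamformE.
apply/(@eqP K)/(@eqP K) => [/sub//|h]; have := sc z; rewrite h mulr0 => /esym/eqP.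
by rewrite mulf_eq0 (negbTE x'0) => /eqP.
Qed.

End Hyperplane.

(** * Restriction and residue *)

Section Sequences.
Variables (K : fieldType) (V : vectType K) (n m : nat) (b : n.-tuple V).
Hypothesis bB : basis_of fullv b.
Variable H : {vspace V}.
Hypothesis hH : hyperplane H.
Variable y : m.-tuple (subvs_of H).
Hypothesis yB : basis_of fullv y.
Local Notation S := {mpoly K[n]}.
Local Notation Sb := {mpoly K[m]}.
Local Notation W := ({ffun {set 'I_n} -> S^o} : lmodType S).
Local Notation Wb := ({ffun {set 'I_m} -> Sb^o} : lmodType Sb).
Local Notation aH := (lform H).
Local Notation vs := (@vs K V H).
Local Notation rpi := (@rpi K V n m b H y).

Lemma vs_altf p w : hdeg p w -> altf p (fun t => rpi (evV b w (map vs t))).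
Proof.
move=> wp; apply: (@altf_comp K K (subvs_of H) Sb V S id vs rpi p) => //.
- by move=> a x z; rewrite linearP.
- by move=> a x z; rewrite rmorphD pbZ.
- exact: evV_altf.
Qed.

(** The pullback of a [p]-form along the inclusion of [H]. *)
Definition rs p (w : W) : Wb := cof y p (fun t => rpi (evV b w (map vs t))).

Lemma rs_linear p : linear (rs p : W -> restr rpi Wb).
Proof.
move=> a x z; rewrite -[RHS]/(rpi a *: (rs p x : Wb) + (rs p z : Wb)) -cof_lin.
by apply: cof_ext => t; rewrite evV_lin rmorphD rmorphM.
Qed.
Definition rsl p : {linear W -> restr rpi Wb} := mklin (@rs_linear p).

Lemma hdeg_rs p w : hdeg p (rs p w). Proof. exact: hdeg_cof. Qed.

Lemma evV_rs p w t : hdeg p w -> evV y (rs p w) t = rpi (evV b w (map vs t)).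
Proof. by move=> wp; rewrite /rs (evV_cof yB (vs_altf wp)). Qed.

Lemma hdeg_eq0 (k : nat) (V' : vectType K) (c : k.-tuple V') (cB : basis_of fullv c) p w :
  hdeg p w -> (forall t, evV c w t = 0) -> w = 0.
Proof.
by move=> wp w0; apply/ffunP => I; rewrite -(evV_tnth cB) w0 ffunE.
Qed.

Lemma rs_eq0P p w : hdeg p w -> rs p w = 0 <->
  (forall s, {in s, forall x, aH x = 0} -> dvdr (lpoly b H) (evV b w s)).
Proof.
move=> wp; split=> [w0 s sH|h].
  apply: (proj1 (rpiP bB hH yB _)); have [t <-] := vs_map_ex hH sH.
  by rewrite -(evV_rs t wp) w0 /evV ev_0.
apply: (hdeg_eq0 yB (@hdeg_rs p w)) => t; rewrite evV_rs //.
by apply: (proj2 (rpiP bB hH yB _)); apply: h; apply: vs_mapH.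
Qed.

Section FirstSequence.
Variables (A' : {pred {vspace V}}) (p : nat).
Definition AH : {pred {vspace V}} := predU1 H (mem A').
Lemma in_AH L : (L \in AH) = (L == H) || (L \in A'). Proof. by []. Qed.

Lemma Lp_AH w : Lp b AH p w <-> Lp b A' p w /\ rs p w = 0.
Proof.
split=> [[wp wA]|[[wp wA] w0]].
  split; first by split=> // L LA; apply: wA; rewrite in_AH LA orbT.
  apply/(rs_eq0P wp) => s sH; apply: wA; first by rewrite in_AH eqxx.
  exact/(lform_subset _ hH).
split=> // L; rewrite inE => /orP[/eqP->|/wA//] s /(lform_subset _ hH).
by move: s; apply/(rs_eq0P wp).
Qed.

Definition r1 : {linear subm (Lp b A' p) -> restr rpi Wb} := (rsl p \o incl _)%FUN.
Fact Lp_AH_sub (w : subm (Lp b AH p)) : Lp b A' p (incl _ w).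
Proof. by have /Lp_AH[] := submP w. Qed.
(** An inclusion here; as [Q(A) = alpha_H Q(A')], it corresponds to multiplication by [alpha_H] on
    logarithmic forms. *)
Definition i1 : {linear subm (Lp b AH p) -> subm (Lp b A' p)} := factor Lp_AH_sub.

Lemma i1_inj : injective i1.
Proof. by move=> x z /(congr1 (@sval_ _ _ _)) /= h; apply: subm_inj. Qed.

Lemma i1_exact : exact i1 r1.
Proof.
move=> w; split=> [w0|[x <-]].
  have wA : Lp b AH p (sval_ w) by apply/Lp_AH; split=> //; apply: submP.
  by exists (mksub wA); apply: subm_inj.
by have /Lp_AH[] := submP x.
Qed.

End FirstSequence.

(* [r2] is the residue along [H]. *)
Section SecondSequence.
Variables (A' : {pred {vspace V}}) (u : V).
Hypothesis arr : forall L, L \in A' -> hyperplane L /\ L != H.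
Hypothesis au : aH u = 1.

Lemma lpoly_ndvd L : L \in A' -> ~ dvdr (lpoly b L) (lpoly b H).
Proof.
move=> LA d; have [hL LH] := arr LA; have [v av] := lform_one hL.
have sub := dvd_form_form bB av d.
move/eqP: LH; apply; apply: hyperplane_dim_eq => //; apply/subvP => x xL.
by apply: in_lform => //; apply: sub; apply: lform_in.
Qed.

Lemma lpoly_prm L : hyperplane L -> prm (lpoly b L).
Proof. by move=> hL; have [v av] := lform_one hL; apply: form_prm av. Qed.

Lemma Lp_mulH p w : Lp b A' p w -> Lp b (AH A') p (lpoly b H *: w).
Proof.
move=> [wp wA]; split=> [I Ip|L]; first by rewrite ffunE wp // scaler0.
rewrite in_AH => LA s sL; rewrite /evV evZ.
by case/orP: LA => [/eqP->|/wA h]; [apply: dvdr_mulr | apply: dvdrMl; apply: h].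
Qed.

(** By [altf_hyperplane] all values, hence all coefficients, are divisible by [alpha_H]. The
    quotient keeps the conditions at the other hyperplanes, whose forms are prime and do not divide
    [alpha_H]. *)
Lemma Lp_divH p w : Lp b (AH A') p w ->
  (forall s, {in s, forall x, aH x = 0} -> dvdr (lpoly b H) (evV b w (u :: s))) ->
  exists2 z, Lp b A' p z & w = lpoly b H *: z.
Proof.
move=> [wp wA] hu.
have wH s : {in s, forall x, aH x = 0} -> dvdr (lpoly b H) (evV b w s).
  move=> sH; apply: wA; first by rewrite in_AH eqxx.
  exact/(lform_subset _ hH).
have h s : dvdK (lpoly b H) (evV b w s).
  exact: (altf_hyperplane (evV_altf b wp) (Q := dvdK (lpoly b H)) au wH hu).
have dI I : dvdr (lpoly b H) (w I) by rewrite -(evV_tnth bB); apply: h.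
have [z zE] := boolp.choice dI.
have wE : w = lpoly b H *: ([ffun I => z I] : W).
  by apply/ffunP => I; rewrite !ffunE zE.
have H0 := lpolyH_neq0 bB hH.
exists [ffun I => z I] => //; split=> [I Ip|L LA s sL].
  rewrite ffunE; apply: (mulfI H0); rewrite -zE mulr0; exact: wp.
have [|[x xE]] : dvdr (lpoly b L) (lpoly b H) \/ dvdr (lpoly b L) (evV b [ffun I => z I] s).
- have [_ _] := lpoly_prm (proj1 (arr LA)); apply.
  have := wA L _ s sL; rewrite {1}wE /evV evZ; apply.
  by rewrite in_AH LA orbT.
- by move/(lpoly_ndvd LA).
- by exists x.
Qed.

(** The inclusion of the logarithmic forms of [A'] in those of [A] becomes this multiplication,
    because [Q(A) = alpha_H Q(A')]. *)
Definition mulH p : {linear subm (Lp b A' p) -> W} :=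
  ( *:%R (lpoly b H) \o incl _)%FUN.
Fact mulH_sub p (w : subm (Lp b A' p)) : Lp b (AH A') p (mulH p w).
Proof. exact: Lp_mulH (submP w). Qed.
Definition i2 p : {linear subm (Lp b A' p) -> subm (Lp b (AH A') p)} :=
  factor (@mulH_sub p).

Lemma i2_inj p : injective (i2 p).
Proof.
move=> x z /(congr1 (@sval_ _ _ _)) /= h; apply: subm_inj; apply/ffunP => I.
apply: (mulfI (lpolyH_neq0 bB hH)).
by have := congr1 (fun w : W => w I) h; rewrite !ffunE.
Qed.

Fact contr_linear : linear (contr (crd b u) : W -> W).
Proof. by move=> a x z; rewrite contr_linr. Qed.

Definition r2 p : {linear subm (Lp b (AH A') p.+1) -> restr rpi Wb} :=
  (rsl p \o mklin contr_linear \o incl _)%FUN.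

Lemma r2E p w : r2 p w = rs p (contr (crd b u) (sval_ w)). Proof. by []. Qed.

Lemma i2_exact p : exact (i2 p.+1) (r2 p).
Proof.
move=> w; have [wp wA] := submP w; have cp := hdeg_contr (crd b u) wp.
rewrite r2E; split=> [/(rs_eq0P cp) h|[x xw]].
  have [z zA wE] := Lp_divH (submP w) h.
  by exists (mksub zA); apply: subm_inj.
apply/(rs_eq0P cp) => s sH; rewrite -[evV b _ s]/(evV b (sval_ w) (u :: s)) -xw.
by rewrite /evV evZ; apply: dvdr_mulr.
Qed.

(** In degree 0 there is no residue: a value on a list starting with [u] is 0. *)
Lemma i2_surj0 : surj (i2 0).
Proof.
move=> w; have [wp _] := submP w.
have [s sH|z zA wE] := Lp_divH (submP w).
  by rewrite (altf_size (evV_altf b wp)) //; apply: dvdr0.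
by exists (mksub zA); apply: subm_inj.
Qed.

End SecondSequence.
End Sequences.

Lemma dvdr_prod_exp (R : idomainType) (T : Type) (r : seq T) (P : pred T) (q : T -> R) x :
  (forall t, P t -> dvdr (q t) x) -> dvdr (\prod_(t <- r | P t) q t) (x ^+ count P r).
Proof.
move=> qx; elim: r => [|t r IHr]; first by rewrite big_nil; apply: dvdr_refl.
rewrite big_cons /=; case: ifP => Pt; last by rewrite add0n.
by rewrite add1n exprS; apply: dvdr_mul => //; apply: qx.
Qed.

(* These identities are stated over abstract rings because rewriting with morphism
   lemmas under [rpi] unfolds it and does not terminate in practice. *)
Fact euler_ring (R : comNzRingType) (d e c h E Y F : R) :
  d * (e * (h * E) + Y * F) = h * ((d * e) * E - c * F) + (c * h + d * Y) * F.
Proof. ring. Qed.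

Fact euler_morph (R R' : comNzRingType) (f : {rmorphism R -> R'}) (e h E Y F : R) :
  f h = 0 -> f (e * (h * E) + Y * F) = f Y * f F.
Proof. by move=> h0; rewrite rmorphD !rmorphM h0 mul0r mulr0 add0r. Qed.

Fact res_ring (R : comNzRingType) (l d c h E G : R) :
  d * (l * G) = - (c * E) -> l * (d * (E - h * G)) = (d * l + c * h) * E.
Proof.
move=> e; rewrite mulrBr mulrBr [RHS]mulrDl.
have -> : l * (d * (h * G)) = h * (d * (l * G)) by ring.
by rewrite e; ring.
Qed.

(** * Targets of restriction and residue, and lifts in codimension one *)

Section Targets.
Variables (K : fieldType) (V : vectType K) (n m : nat) (b : n.-tuple V).
Hypothesis bB : basis_of fullv b.
Variable H : {vspace V}.
Hypothesis hH : hyperplane H.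
Variable y : m.-tuple (subvs_of H).
Hypothesis yB : basis_of fullv y.
Local Notation S := {mpoly K[n]}.
Local Notation Sb := {mpoly K[m]}.
Local Notation W := ({ffun {set 'I_n} -> S^o} : lmodType S).
Local Notation Wb := ({ffun {set 'I_m} -> Sb^o} : lmodType Sb).
Local Notation aH := (lform H).
Local Notation vs := (@vs K V H).
Local Notation rpi := (@rpi K V n m b H y).
Local Notation rsg := (@rsg K V n m b H y).
Local Notation lam := (@lam K V m H y).
Local Notation lamform := (@lamform K V H).
Local Notation rs := (@rs K V n m b H y).

(** The guards make [eqvG_lam] hold for all arguments, as the lemmas on products of primes require
    of their relation. *)
Definition eqvG (L L' : {vspace V}) : bool :=
  [&& eqvH H L L', hyperplane L, hyperplane L', L != H & L' != H].

Lemma eqvG_lam L L' : eqvG L L' -> dvdr (lam L) (lam L') /\ dvdr (lam L') (lam L).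
Proof.
case/and5P=> e hL hL' LH LH'; split; first exact: eqvH_lam.
by apply: eqvH_lam; rewrite // eqvH_sym.
Qed.

Lemma eqvG_lamform L L' x : eqvG L L' -> lamform L x = 0 -> lamform L' x = 0.
Proof.
case/and5P=> e hL hL' LH LH' /(@eqP K).
by rewrite (eqvH_lamform hH x hL hL' e) => /eqP.
Qed.

Variable A' : seq {vspace V}.
Hypothesis A'u : uniq A'.
Hypothesis arr : forall L, L \in A' -> hyperplane L /\ L != H.

Lemma eqvG_refl L : L \in A' -> eqvG L L.
Proof. by move=> /arr[hL LH]; rewrite /eqvG eqvH_refl hL LH. Qed.

Lemma eqvG_ndvd L L' : L \in A' -> L' \in A' -> ~~ eqvG L L' -> ~ dvdr (lam L) (lam L').
Proof.
move=> /arr[hL LH] /arr[hL' LH']; rewrite /eqvG hL hL' LH LH' !andbT.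
by move=> /negP h /(lam_dvd_eqvH hH yB hL hL' LH LH').
Qed.

Lemma lamA_prm L : L \in A' -> prm (lam L).
Proof. by move=> /arr[hL LH]; apply: lam_prm. Qed.

Lemma lamA_neq0 L : L \in A' -> lam L != 0.
Proof. by move=> /lamA_prm[]. Qed.

Definition mult L := count (eqvG L) A'.

Lemma mult_gt0 L : L \in A' -> (0 < mult L)%N.
Proof. by move=> LA; rewrite -has_count; apply/hasP; exists L => //; apply: eqvG_refl. Qed.

(* The conditions satisfied by the restrictions to [H] of the forms in
   [Lp b A' p]: the [L] with the same trace on [H] contribute one factor each. *)
Definition in_N1 p (z : Wb) := hdeg p z /\ forall L, L \in A' ->
  (forall t, dvdr (lam L ^+ (mult L).-1) (evV y z t)) /\
  (forall t, {in t, forall x, lamform L x = 0} -> dvdr (lam L ^+ mult L) (evV y z t)).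

(** The conditions of [Lp] for the restricted arrangement, indexed by the hyperplanes themselves
    instead of their traces. *)
Definition in_N2 p (z : Wb) := hdeg p z /\ forall L, L \in A' ->
  forall t, {in t, forall x, lamform L x = 0} -> dvdr (lam L) (evV y z t).

Lemma lpoly_ndvd2 L L' : hyperplane L -> hyperplane L' -> L != L' ->
  ~ dvdr (lpoly b L) (lpoly b L').
Proof.
move=> hL hL' LL' d; have [v av] := lform_one hL.
have sub := dvd_form_form bB av d.
move/eqP: LL'; apply; apply: hyperplane_dim_eq => //; apply/subvP => x xL.
by apply: in_lform => //; apply: sub; apply: lform_in.
Qed.

Lemma lpoly_prod_dvd (D : seq {vspace V}) f : uniq D ->
  (forall L, L \in D -> hyperplane L) ->
  (forall L, L \in D -> dvdr (lpoly b L) f) -> dvdr (\prod_(L <- D) lpoly b L) f.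
Proof.
move=> uD hD dD; apply: (@prm_prod_dvd _ _ (lpoly b) eq_op) => [L L'|L|L L'|L|L].
- by move=> /eqP ->; split; apply: dvdr_refl.
- by move=> /hD; apply: lpoly_prm.
- by move=> /hD hL /hD hL' LL'; apply: lpoly_ndvd2.
- by [].
- move=> LD; have -> : count (eq_op L) D = 1%N.
    by rewrite (eq_count (a2 := pred1 L)) ?count_uniq_mem ?LD // => x; rewrite /= eq_sym.
  by rewrite expr1; apply: dD.
Qed.

(** The distinct primes [lpoly b L'] of the class divide [f] jointly, and each of them restricts to
    an associate of [lam L]. *)
Lemma class_dvd L f : L \in A' ->
  (forall L', L' \in A' -> eqvG L L' -> dvdr (lpoly b L') f) ->
  dvdr (lam L ^+ mult L) (rpi f).
Proof.
move=> LA h; set D := filter (eqvG L) A'.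
have [|M|M|z ->] := @lpoly_prod_dvd D f.
- exact: filter_uniq.
- by rewrite mem_filter => /andP[_ /arr[]].
- by rewrite mem_filter => /andP[e MA]; apply: h.
rewrite rmorphM rmorph_prod; apply: dvdrMr.
rewrite (eq_bigr lam) => [|M _]; last exact: rpi_lpoly.
have := @dvdr_prod_count _ _ lam eqvG eqvG_lam L D.
by rewrite /D count_filter (eq_count (a2 := eqvG L)) // => M /=; rewrite andbb.
Qed.

(** Vectors of [H] lying in [L] lie in every hyperplane of its class, so [class_dvd] gives the full
    power. For one vector [x0] outside [L], contraction with the Euler field of the plane of [u] and
    [x0] gives the full power for [lam L] times the value, and one factor is cancelled. *)
Lemma rs_N1 p w : Lp b (mem A') p w -> in_N1 p (rs p w).
Proof.
move=> [wp wA]; split=> [|L LA]; first exact: hdeg_rs.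
have [hL LH] := arr LA.
have hX t : {in t, forall x, lamform L x = 0} ->
    dvdr (lam L ^+ mult L) (evV y (rs p w) t).
  move=> tL; rewrite evV_rs //; apply: class_dvd => // M MA e; apply: wA => //.
  apply/lform_subset; first by have [] := arr MA.
  by move=> v /mapP[x xt ->]; rewrite -lamformE; apply: (eqvG_lamform e); apply: tL.
split=> // t; have [x0 lx0] := lamform_neq0 hH hL LH.
have [c [a1 [c0 a1x0 a1E _]]] := form_normalize y lx0.
have zp : hdeg p (rs p w) by apply: hdeg_rs.
suff: dvdK (lam L ^+ (mult L).-1) (evV y (rs p w) t) by [].
apply: (altf_hyperplane (evV_altf y zp) (Q := dvdK (lam L ^+ (mult L).-1)) a1x0).
  move=> r ra; apply: dvdr_trans (hX r _); first by apply: dvdr_exp; apply: leq_pred.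
  by move=> x xr; rewrite a1E ra // mulr0.
move=> r ra; have rL : {in r, forall x, lamform L x = 0}.
  by move=> x xr; rewrite a1E ra // mulr0.
rewrite /= evV_rs // map_cons; set F := evV b w _.
have [u au] := lform_one hH; pose E := evV b w (u :: map vs r).
pose e := lamform L x0 : K.
pose Yf := fp b (fun v => lamform L (prj H u v)).
have rY : rpi Yf = lam L.
  have -> : Yf = rsg u (lam L) by rewrite rsg_fp.
  by rewrite rsgK.
(* [e * alpha_H * u + Yf * x0] is [e] times the Euler field of that plane, so its pairing with each
   [alpha_M] of the class is [e * alpha_M]; after restriction to [H] only the term in [Yf]
   survives. *)
have : dvdr (lam L ^+ mult L) (rpi (e%:MP * (lpoly b H * E) + Yf * F)).
  apply: class_dvd => // M MA eLM; have [hM MH] := arr MA.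
  pose c' := lform M u : K; pose d' := (lamform M x0 / e : K).
  have d'0 : d' != 0.
    case/and5P: eLM => eLM _ _ _ _.
    by rewrite mulf_neq0 ?invr_eq0 // -(eqvH_lamform hH x0 hL hM eLM).
  have lM v : lform M v = c' * aH v + d' * lamform L (prj H u v).
    have {1}-> : v = aH v *: u + vs (prj H u v) by rewrite vs_prj // addrC subrK.
    rewrite linearP -lamformE [_ *: _]mulrC; congr (_ + _).
    apply: (mulfI lx0); rewrite mulrA.
    have -> : lamform L x0 * d' = lamform M x0 by rewrite /d' mulrC divfK.
    by apply: (ker_sub_scale lx0) => x; apply: eqvG_lamform.
  have lpM : lpoly b M = c' *: lpoly b H + d' *: Yf.
    rewrite -[X in _ + X]fp_scale -fp_lin; apply: fp_ext => v; exact: lM.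
  apply/(dvdr_scaler _ _ d'0).
  have -> : d' *: (e%:MP * (lpoly b H * E) + Yf * F) =
      lpoly b H * ((d' * e) *: E - c' *: F) + lpoly b M * F.
    by rewrite lpM -!mul_mpolyC (mpolyCM _ d' e); apply: euler_ring.
  apply: dvdrD; last exact: dvdr_mulr.
  apply: dvdrMl; have -> : (d' * e) *: E - c' *: F =
      evV b w (((d' * e) *: u + (- c') *: vs x0) :: map vs r).
    have wa := evV_altf b wp.
    have := altf_lin wa [::] (map vs r) (d' * e) u (- c' *: vs x0) => /= ->.
    by have := altf_scale wa [::] (map vs r) (- c') (vs x0) => /= ->; rewrite scaleNr.
  apply: wA => //; apply/lform_subset => // v; rewrite inE => /orP[/eqP->|/mapP[x xr ->]].
    have h1 : lform M (vs x0) = d' * e by rewrite -lamformE /d' divfK.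
    rewrite linearP linearZ /= h1 -[LHS]/((d' * e) * c' + (- c') * (d' * e) : K).
    by rewrite mulrC mulNr subrr.
  by rewrite -lamformE; apply: (eqvG_lamform eLM); apply: rL.
rewrite (euler_morph e%:MP E Yf F (rpi_lpolyH bB hH yB au)) rY.
rewrite -{1}(prednK (mult_gt0 LA)) exprS; apply: dvdr_mul2l; exact: lamA_neq0.
Qed.

(** Modulo [alpha_H] the residue does not depend on the transverse vector, as [u - v] lies in [H]; a
    choice of [v] inside [L] makes the condition at [L] apply. *)
Lemma rs_N2 u p w : aH u = 1 -> Lp b (AH H (mem A')) p.+1 w ->
  in_N2 p (rs p (contr (crd b u) w)).
Proof.
move=> au [wp wA]; split=> [|L LA t tL]; first exact: hdeg_rs.
have [hL LH] := arr LA; have [v av Lv] := lform_transverse hH hL LH.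
have cp := hdeg_contr (crd b u) wp.
rewrite evV_rs // -[evV b _ _]/(evV b w (u :: map vs t)).
have -> : evV b w (u :: map vs t) = evV b w (v :: map vs t) + evV b w ((u - v) :: map vs t).
  have := altf_add (evV_altf b wp) [::] (map vs t) v (u - v) => /= <-.
  by rewrite addrC subrK.
rewrite rmorphD [X in _ + X](_ : _ = 0) ?addr0.
  have LAH : L \in AH H (mem A') by rewrite in_AH LA orbT.
  have vL : {subset v :: map vs t <= L}.
    apply/lform_subset => // x; rewrite inE => /orP[/eqP->//|/mapP[z zt ->]].
    by rewrite -lamformE; apply: tL.
  have [z ->] := wA L LAH _ vL.
  by rewrite (rmorphM rpi) rpi_lpoly //; apply: dvdr_mulr.
apply: (proj2 (rpiP bB hH yB _)); apply: wA; first by rewrite in_AH eqxx.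
apply/lform_subset => // x; rewrite inE => /orP[/eqP->|]; last exact: vs_mapH.
by rewrite linearB au av subrr.
Qed.

(** The pullback of [z] along the projection of [V] onto [H] with direction [u]. *)
Definition plift u p (z : Wb) : W := cof b p (fun s => rsg u (evV y z (map (prj H u) s))).

Lemma plift_altf u p z : hdeg p z -> altf p (fun s => rsg u (evV y z (map (prj H u) s))).
Proof.
move=> zp; apply: (@altf_comp K K V S (subvs_of H) Sb id (prj H u) (rsg u) p) => //.
- by move=> a x t; rewrite linearP.
- by move=> a x t; rewrite rmorphD pbZ.
- exact: evV_altf.
Qed.

Lemma hdeg_plift u p z : hdeg p (plift u p z). Proof. exact: hdeg_cof. Qed.

Lemma evV_plift u p z s : hdeg p z ->
  evV b (plift u p z) s = rsg u (evV y z (map (prj H u) s)).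
Proof. by move=> zp; rewrite (evV_cof bB (plift_altf u zp)). Qed.

Lemma rpi_plift u p z t : aH u = 1 -> hdeg p z ->
  rpi (evV b (plift u p z) (map vs t)) = evV y z t.
Proof. by move=> au zp; rewrite evV_plift // map_prj_vs // rsgK. Qed.

Lemma rs_scale p a w : rs p (a *: w) = rpi a *: rs p w.
Proof.
apply/ffunP => I; rewrite !ffunE; case: ifP => _; last by rewrite scaler0.
by rewrite /evV evZ rmorphM.
Qed.

Lemma rs_plift u p z : aH u = 1 -> hdeg p z -> rs p (plift u p z) = z.
Proof.
move=> au zp; rewrite -[RHS](cof_evV yB zp); apply: cof_ext => t.
exact: rpi_plift.
Qed.

(** When [u] is in [L], the projection along [u] maps [L] into [L] and [alpha_L] is the extension of
    its own restriction. *)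
Lemma plift_dvd u p z L s : aH u = 1 -> hyperplane L -> lform L u = 0 -> hdeg p z ->
  (forall t, {in t, forall x, lamform L x = 0} -> dvdr (lam L) (evV y z t)) ->
  {subset s <= L} -> dvdr (lpoly b L) (evV b (plift u p z) s).
Proof.
move=> au hL Lu zp zL /(lform_subset _ hL) sL.
rewrite evV_plift //; have [|f ->] := zL (map (prj H u) s).
  move=> x /mapP[v vs_ ->]; rewrite lamformE vs_prj // linearB linearZ /= sL // Lu.
  by rewrite scaler0 subr0.
rewrite rmorphM -(rpi_lpoly bB y L) (rsg_rpi b hH yB au) /lpoly (rho_fp bB).
by rewrite Lu scale0r subr0; apply: dvdr_mulr.
Qed.

Definition cL L := \prod_(L' <- A' | ~~ eqvG L L') lam L'.

(* As the [cL L] have no common factor, this is surjectivity in codimension one. *)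
Lemma codim1_rs p L z : L \in A' -> in_N1 p z ->
  exists2 w, Lp b (mem A') p w & rs p w = cL L *: z.
Proof.
move=> LA [zp zA]; have [hL LH] := arr LA; have [z1 z2] := zA L LA.
have l0 := lamA_neq0 LA; set k := (mult L).-1.
have kE : mult L = k.+1 by rewrite prednK ?mult_gt0.
have lk0 : lam L ^+ k != 0 by rewrite expf_neq0.
have dz I : dvdr (lam L ^+ k) (z I) by rewrite -(evV_tnth yB); apply: z1.
have [z' z'E] := boolp.choice dz; pose x : Wb := [ffun I => z' I].
have zE : z = lam L ^+ k *: x by apply/ffunP => I; rewrite !ffunE z'E.
have xp : hdeg p x.
  move=> I Ip; apply: (mulfI lk0); rewrite mulr0 -(zp I Ip) zE; by rewrite !ffunE.
have xL t : {in t, forall v, lamform L v = 0} -> dvdr (lam L) (evV y x t).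
  move=> /z2; rewrite zE /evV evZ kE exprSr; exact: dvdr_mul2l.
(* With [u] in [L] the lift is logarithmic along [L] itself; the factor [c0] takes care of all other
   hyperplanes. *)
have [u au Lu] := lform_transverse hH hL LH.
pose c0 := \prod_(L' <- A' | L' != L) lpoly b L'.
pose d0 := \prod_(L' <- A' | (L' != L) && eqvG L L') lam L'.
(* Both sides are products of [k] associates of [lam L]; [g] is their quotient, inserted so that the
   restriction comes out as exactly [cL L *: z]. *)
have [g gE] : dvdr d0 (lam L ^+ k).
  have -> : k = count (fun L' => (L' != L) && eqvG L L') A'.
    have -> : k = count (eqvG L) (rem L A').
      by rewrite /k /mult (permP (perm_to_rem LA) (eqvG L)) /= eqvG_refl.
    rewrite (rem_filter _ A'u) count_filter; apply: eq_count => M /=.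
    by rewrite andbC.
  by apply: dvdr_prod_exp => M /andP[_ /eqvG_lam[]].
exists ((rsg u g * c0) *: plift u p x); first split.
- by move=> I Ip; rewrite ffunE hdeg_plift // scaler0.
- move=> M MA s sM; rewrite /evV evZ; have [ML|ML] := eqVneq M L.
    by apply: dvdrMl; rewrite ML in sM *; apply: plift_dvd sM.
  apply/dvdrMr/dvdrMl; rewrite /c0 -big_filter; apply: dvdr_prod.
  by rewrite mem_filter ML.
have rc : rpi (rsg u g * c0) = g * rpi c0.
  by rewrite (rmorphM rpi) rsgK.
rewrite rs_scale (rs_plift au xp) rc zE scalerA (rmorph_prod rpi).
congr (_ *: _); rewrite gE /d0 /cL.
rewrite (bigID (fun L' => eqvG L L')) /= (eq_bigr lam) => [|M _]; last exact: rpi_lpoly.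
rewrite [X in _ * (_ * X)](eq_bigr lam) => [|M _]; last exact: rpi_lpoly.
rewrite [X in _ * (_ * X)](eq_bigl (fun M => ~~ eqvG L M)) => [|M].
  ring.
by case: eqVneq => //= ->; rewrite eqvG_refl.
Qed.

Lemma codim1_rs0 p z : A' = [::] -> hdeg p z -> exists2 w, Lp b (mem A') p w & rs p w = z.
Proof.
move=> A0 zp; have [u au] := lform_one hH; exists (plift u p z); last exact: rs_plift.
by split=> [|L]; [exact: hdeg_plift | rewrite A0].
Qed.

Lemma acof_lin (c d : K) L M N i : (forall v, lform M v = c * lform L v + d * lform N v) ->
  acof b (lform M) i = c%:MP * acof b (lform L) i + d%:MP * acof b (lform N) i.
Proof. by move=> E; rewrite /acof E mpolyCD !mpolyCM. Qed.

Lemma evV_wdg_lin (c d : K) L M N (w : W) (s : seq V) :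
  (forall v, lform M v = c * lform L v + d * lform N v) ->
  evV b (wdg (acof b (lform M)) w) s = c%:MP * evV b (wdg (acof b (lform L)) w) s +
    d%:MP * evV b (wdg (acof b (lform N)) w) s.
Proof.
move=> /acof_lin aE.
rewrite (wdg_linl (a := c%:MP) (x := acof b (lform L))
  (y := fun i => d%:MP * acof b (lform N) i) w aE).
rewrite evV_lin; congr (_ + _).
rewrite (wdg_linl (a := d%:MP) (x := acof b (lform N)) (y := fun=> 0) w).
  rewrite evV_lin -[RHS]addr0; congr (_ + _).
  have -> : wdg (fun=> 0) w = 0.
    by apply/ffunP => I; rewrite !ffunE big1 // => i _; rewrite mulr0 mul0r.
  exact: ev_0.
by move=> i; rewrite addr0.
Qed.

Lemma wdg_dvd_ker (L : {vspace V}) (w : W) (s : seq V) :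
  (forall t : seq V, {subset t <= L} -> dvdr (lpoly b L) (evV b w t)) ->
  {subset s <= L} -> dvdr (lpoly b L) (evV b (wdg (acof b aH) w) s).
Proof.
elim: s w => [|v s IHs] w wL sL; first by rewrite /evV /= wdg_set0; apply: dvdr0.
have sL' : {subset s <= L} by move=> x xs; apply: sL; rewrite inE xs orbT.
rewrite evV_wdg_cons // -mulN1r; apply: dvdrD; apply: dvdrMl; first exact: wL.
apply: IHs => // t tL; apply: (wL (v :: t)) => x; rewrite inE => /orP[/eqP->|/tL//].
by apply: sL; rewrite inE eqxx.
Qed.

Lemma rs_contr_plift u v p z w : aH u = 1 -> aH v = 1 -> hdeg p z ->
  (forall t, exists g, evV b (contr (crd b u) w) (map vs t) =
    evV b (plift v p z) (map vs t) - lpoly b H * g) ->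
  rs p (contr (crd b u) w) = z.
Proof.
move=> au av zp h; rewrite -[RHS](cof_evV yB zp); apply: cof_ext => t.
have [g ->] := h t; rewrite rmorphB (rmorphM rpi) (rpi_lpolyH bB hH yB au) mul0r subr0.
exact: rpi_plift.
Qed.

(* At [L], the form is locally [z] times the logarithmic form
   [d aH / aH - d aL / aL]. *)
Lemma codim1_res u p L z : aH u = 1 -> L \in A' -> in_N2 p z ->
  exists2 w, Lp b (AH H (mem A')) p.+1 w & rs p (contr (crd b u) w) = cL L *: z.
Proof.
move=> au LA [zp zA]; have [hL LH] := arr LA; have zL := zA L LA.
have [v av Lv] := lform_transverse hH hL LH.
pose x := plift v p z; have xp : hdeg p x by apply: hdeg_plift.
have xL s : {subset s <= L} -> dvdr (lpoly b L) (evV b x s) by apply: plift_dvd.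
have [uL auL] := lform_one hL.
have xL' s : {in s, forall w, lform L w = 0} -> dvdr (lpoly b L) (evV b x s).
  by move=> /(lform_subset _ hL); apply: xL.
have [g gE] := boolp.choice (proj2 (dvd_wdgP bB auL (lpoly b L) xp) xL').
pose gw : W := [ffun I => g I].
have gwE : wdg (acof b (lform L)) x = lpoly b L *: gw.
  by apply/ffunP => I; rewrite gE !ffunE.
have L0 : lpoly b L != 0 by have [] := lpoly_prm bB hL.
have gp : hdeg p.+1 gw.
  move=> I Ip; apply: (mulfI L0); rewrite mulr0 -(hdeg_wdg (acof b (lform L)) xp Ip) gwE.
  by rewrite !ffunE.
(* This is [alpha_H] times [(d alpha_H / alpha_H - d alpha_L / alpha_L) /\ x]. *)
pose w0 := wdg (acof b aH) x - lpoly b H *: gw.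
have w0p : hdeg p.+1 w0.
  move=> I Ip; have -> : w0 I = wdg (acof b aH) x I - lpoly b H * gw I by rewrite !ffunE.
  by rewrite (hdeg_wdg _ xp Ip) (gp _ Ip) mulr0 subrr.
have w0E s : evV b w0 s = evV b (wdg (acof b aH) x) s - lpoly b H * evV b gw s.
  by rewrite /evV evB evZ.
have gLE s : lpoly b L * evV b gw s = evV b (wdg (acof b (lform L)) x) s.
  by rewrite gwE /evV evZ.
pose c1 := \prod_(L' <- A' | ~~ eqvG L L') lpoly b L'.
exists (c1 *: w0); first split.
- by move=> I Ip; rewrite ffunE w0p // scaler0.
- move=> M; rewrite in_AH => MA s sM; rewrite /evV evZ; case/orP: MA => [/eqP MH|MA].
    apply: dvdrMl; rewrite -[ev _ _]/(evV b w0 s) w0E MH evV_wdg_ker ?sub0r //.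
      by rewrite -mulrN; apply: dvdr_mulr.
    by apply/lform_subset; rewrite // -MH.
  case: (boolP (eqvG L M)) => [e|e]; last first.
    apply: dvdrMr; rewrite /c1 -big_filter; apply: dvdr_prod.
    by rewrite mem_filter e.
  apply: dvdrMl; rewrite -[ev _ _]/(evV b w0 s); have [hM MH] := arr MA.
  have sM0 : {in s, forall w, lform M w = 0} by apply/lform_subset.
  have [ML|ML] := eqVneq M L.
    rewrite ML in sM sM0 *; rewrite w0E; apply: dvdrD; first exact: wdg_dvd_ker.
    have -> : evV b gw s = 0; last by rewrite mulr0 oppr0; apply: dvdr0.
    by apply: (mulfI L0); rewrite gLE mulr0 evV_wdg_ker.
  have [x0 lx0] := lamform_neq0 hH hL LH.
  pose d' := (lamform M x0 / lamform L x0 : K); pose c' := lform M v : K.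
  have lM q : lform M q = d' * lform L q + c' * aH q.
    have {1}-> : q = aH q *: v + vs (prj H v q) by rewrite vs_prj // addrC subrK.
    rewrite linearP -lamformE [RHS]addrC [_ *: _]mulrC; congr (_ + _).
    have -> : lform L q = lamform L (prj H v q).
      by rewrite lamformE vs_prj // linearB linearZ /= Lv scaler0 subr0.
    apply: (mulfI lx0); rewrite mulrA.
    have -> : lamform L x0 * d' = lamform M x0 by rewrite /d' mulrC divfK.
    by apply: (ker_sub_scale lx0) => t; apply: eqvG_lamform.
  have lpM : lpoly b M = d'%:MP * lpoly b L + c'%:MP * lpoly b H.
    rewrite !mul_mpolyC -[X in _ + X]fp_scale -fp_lin; apply: fp_ext => t; exact: lM.
  have wM : d'%:MP * evV b (wdg (acof b (lform L)) x) s =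
      - (c'%:MP * evV b (wdg (acof b aH) x) s).
    apply/(@eqP S); rewrite -addr_eq0; apply/eqP.
    by rewrite -(evV_wdg_lin x s lM); apply: evV_wdg_ker.
  have [_ _ pM] := lpoly_prm bB hM.
  have d'0 : d' != 0.
    case/and5P: e => e _ _ _ _.
    by rewrite mulf_neq0 ?invr_eq0 // -(eqvH_lamform hH x0 hL hM e).
  (* On vectors of [M] the forms [d' d alpha_L /\ x] and [- c' d alpha_H /\ x] agree, which makes
     [alpha_M] appear; then [alpha_L] is cancelled by primality of [alpha_M]. *)
  have : dvdr (lpoly b M) (lpoly b L * (d'%:MP * evV b w0 s)).
    have -> : lpoly b L * (d'%:MP * evV b w0 s) =
        lpoly b M * evV b (wdg (acof b aH) x) s.
      rewrite w0E lpM; apply: (@res_ring _ _ _ _ _ _ (evV b gw s)).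
      by rewrite -wM -gLE mulrA.
    exact: dvdr_mulr.
  case/pM => [/lpoly_ndvd2|]; first by move/(_ hM hL ML).
  by rewrite mul_mpolyC => /(dvdr_scaler _ _ d'0).
rewrite contrZ rs_scale (rmorph_prod rpi).
rewrite (eq_bigr lam) => [|M _]; last exact: rpi_lpoly.
congr (_ *: _); apply: (rs_contr_plift au av zp) => t; rewrite -[evV b _ _]/(evV b w0 (u :: map vs t)).
rewrite w0E (evV_wdg_cons_ker bB); last exact: vs_mapH.
by rewrite au mpolyC1 mul1r; exists (evV b gw (u :: map vs t)).
Qed.

Lemma codim1_res0 u p z : aH u = 1 -> A' = [::] -> hdeg p z ->
  exists2 w, Lp b (AH H (mem A')) p.+1 w & rs p (contr (crd b u) w) = z.
Proof.
move=> au A0 zp; exists (wdg (acof b aH) (plift u p z)); first split.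
- by apply: hdeg_wdg; apply: hdeg_plift.
- move=> L; rewrite in_AH A0 orbF => /eqP-> s /(lform_subset _ hH) sH.
  by rewrite evV_wdg_ker //; apply: dvdr0.
apply: (rs_contr_plift au au zp) => t; exists 0.
rewrite -[evV b (contr _ _) _]/(evV b (wdg (acof b aH) (plift u p z)) (u :: map vs t)).
rewrite (evV_wdg_cons_ker bB); last exact: vs_mapH.
by rewrite au mpolyC1 mul1r mulr0 subr0.
Qed.

End Targets.

(** * Surjectivity onto the targets when the modules are projective *)

Section Local.
Variables (K : fieldType) (V : vectType K) (n m : nat) (b : n.-tuple V).
Hypothesis bB : basis_of fullv b.
Variable H : {vspace V}.
Hypothesis hH : hyperplane H.
Variable y : m.-tuple (subvs_of H).
Hypothesis yB : basis_of fullv y.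
Local Notation S := {mpoly K[n]}.
Local Notation Sb := {mpoly K[m]}.
Local Notation Wb := ({ffun {set 'I_m} -> Sb^o} : lmodType Sb).
Local Notation aH := (lform H).
Local Notation rpi := (@rpi K V n m b H y).
Local Notation lam := (@lam K V m H y).
Local Notation rs := (@rs K V n m b H y).
Local Notation eqvG := (eqvG H).

Lemma lpolyH_reg x : lpoly b H * x = 0 -> x = 0.
Proof. by move=> /eqP; rewrite mulf_eq0 (negbTE (lpolyH_neq0 bB hH)) => /eqP. Qed.

(** The image has a resolution of length one over [S], and passing to [Sb] lowers its dimension by
    one. *)
Lemma im_proj (X A : lmodType S) (f : {linear X -> restr rpi Wb})
    (i : {linear A -> X}) u (au : aH u = 1) : injective i -> exact i f ->
  projective A -> projective X -> projective (subm (imres (rsgK bB hH yB u) f)).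
Proof.
move=> ii ex pA pX; have h := imres_ses (rsgK bB hH yB u) ii ex.
apply: (restr_proj_down (rsgK bB hH yB u) (rpi_lpolyH bB hH yB au) lpolyH_reg
  (rsg_rpi_div bB hH yB au)).
by exists A, X, i, (imres_fun (rsgK bB hH yB u) f).
Qed.

Section Arr.
Variable A' : seq {vspace V}.
Hypothesis A'u : uniq A'.
Hypothesis arr : forall L, L \in A' -> hyperplane L /\ L != H.
Local Notation cL := (cL y A').

Lemma cL_neq0 L : cL L != 0.
Proof.
rewrite /cL -big_filter prodf_seq_neq0; apply/allP => M.
by rewrite mem_filter => /andP[_ MA] /=; apply: (lamA_neq0 hH yB arr).
Qed.

Lemma cL_ndvd L : L \in A' -> ~ dvdr (lam L) (cL L).
Proof.
move=> LA; rewrite /cL -big_filter => /(prm_prod_dvd_ex (lamA_prm hH yB arr LA))[M].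
by rewrite mem_filter => /andP[e MA]; apply: (eqvG_ndvd hH yB arr LA MA e).
Qed.

(** For [M] outside the class of [L0], the power of [lam M] in [cL L0] must divide [f], since
    [lam M] does not divide [cL M]. *)
Lemma cL_coprime L0 f : (forall L, L \in A' -> dvdr (cL L0) (cL L * f)) -> dvdr (cL L0) f.
Proof.
move=> h; rewrite /cL -big_filter; set D := filter _ _.
have DA M : M \in D -> M \in A' by rewrite mem_filter => /andP[].
apply: (@prm_prod_dvd _ _ lam eqvG (eqvG_lam hH y)) => [M|M N|M|M] MD.
- exact: (lamA_prm hH yB arr (DA _ MD)).
- by move=> ND; apply: (eqvG_ndvd hH yB arr (DA _ MD) (DA _ ND)).
- exact: (eqvG_refl arr (DA _ MD)).
apply: (prm_exp_cancel (lamA_prm hH yB arr (DA _ MD)) (cL_ndvd (DA _ MD))).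
apply: dvdr_trans (h M (DA _ MD)); rewrite /cL -big_filter.
exact: (dvdr_prod_count (eqvG_lam hH y)).
Qed.

(** The image is projective over [Sb] and contains [cL L *: z] for every [L]; as the [cL L] have no
    common factor, [proj_closed] puts [z] in it. For empty [A'] there is no [cL L], and [z] is
    lifted directly. *)
Lemma im_N1 u p : aH u = 1 -> projective (subm (Lp b (mem A') p)) ->
  projective (subm (Lp b (AH H (mem A')) p)) -> forall z, in_N1 y A' p z ->
  exists2 w, Lp b (mem A') p w & rs p w = z.
Proof.
move=> au p1 p2 z zN; have [A0|[L0 L0A]] : A' = [::] \/ exists L, L \in A'.
- by case: A' => [|L A0]; [left | right; exists L; rewrite inE eqxx].
- by apply: (codim1_rs0 bB hH yB A0); case: zN.
set f := @r1 K V n m b H y (mem A') p.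
have pI : projective (subm (imres (rsgK bB hH yB u) f)) := im_proj au (@i1_inj _ _ _ _ _ bB _ hH y yB (mem A') p)
  (@i1_exact _ _ _ _ _ bB _ hH y yB (mem A') p) p2 p1.
have Mz L : L \in A' -> imres (rsgK bB hH yB u) f (cL L *: z).
  move=> LA; have [w wA wE] := codim1_rs bB hH yB A'u arr LA zN.
  by exists (mksub wA).
have Mfz : imres (rsgK bB hH yB u) f z := @proj_closed Sb {set 'I_m} {vspace V} A' cL L0 (imres (rsgK bB hH yB u) f) z pI L0A (cL_neq0 L0) Mz (@cL_coprime L0).
have [w wz] := Mfz.
exists (sval_ w); first exact: submP.
exact: wz.
Qed.

Lemma im_N2 u p : aH u = 1 -> projective (subm (Lp b (mem A') p.+1)) ->
  projective (subm (Lp b (AH H (mem A')) p.+1)) -> forall z, in_N2 y A' p z ->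
  exists2 w, Lp b (AH H (mem A')) p.+1 w & rs p (contr (crd b u) w) = z.
Proof.
move=> au p1 p2 z zN; have [A0|[L0 L0A]] : A' = [::] \/ exists L, L \in A'.
- by case: A' => [|L A0]; [left | right; exists L; rewrite inE eqxx].
- by apply: (codim1_res0 bB hH yB au A0); case: zN.
have arr' L : L \in mem A' -> hyperplane L /\ L != H by apply: arr.
set f := @r2 K V n m b H y (mem A') u p.
have pI : projective (subm (imres (rsgK bB hH yB u) f)) := im_proj au (@i2_inj _ _ _ _ bB _ hH (mem A') p.+1)
  (@i2_exact _ _ _ _ _ bB _ hH y yB (mem A') u arr' au p) p1 p2.
have Mz L : L \in A' -> imres (rsgK bB hH yB u) f (cL L *: z).
  move=> LA; have [w wA wE] := codim1_res bB hH yB arr au LA zN.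
  by exists (mksub wA).
have Mfz : imres (rsgK bB hH yB u) f z := @proj_closed Sb {set 'I_m} {vspace V} A' cL L0 (imres (rsgK bB hH yB u) f) z pI L0A (cL_neq0 L0) Mz (@cL_coprime L0).
have [w wz] := Mfz.
exists (sval_ w); first exact: submP.
exact: wz.
Qed.

End Arr.
End Local.

(** * Free arrangements *)

Lemma prm_ndvd_exp (R : idomainType) (p q : R) k : prm p -> ~ dvdr p q -> ~ dvdr p (q ^+ k).
Proof.
move=> [_ p1 pp] pq; elim: k => [|k IHk]; first by rewrite expr0.
by rewrite exprS => /pp[/pq|/IHk].
Qed.

Lemma prm_prod_exp_dvd (R : idomainType) (T : eqType) (q : T -> R) (k : T -> nat)
    (D : seq T) f :
  uniq D -> (forall x, x \in D -> prm (q x)) ->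
  {in D &, forall x y, x != y -> ~ dvdr (q x) (q y)} ->
  (forall x, x \in D -> dvdr (q x ^+ k x) f) -> dvdr (\prod_(x <- D) q x ^+ k x) f.
Proof.
move=> uD qp qD; elim: D uD qp qD f => [|x D IHD] /= uD qp qD f h.
  by rewrite big_nil; apply: dvd1r.
have [xD {}uD] := andP uD; have [f' fE] := h x (mem_head _ _).
rewrite big_cons fE; apply: dvdr_mul; first exact: dvdr_refl.
apply: IHD => // [z zD|z t zD tD|z zD].
- by apply: qp; rewrite inE zD orbT.
- by apply: qD; rewrite inE ?zD ?tD orbT.
have zX : z \in x :: D by rewrite inE zD orbT.
have := h z zX; rewrite fE; apply: prm_exp_cancel; first exact: qp.
apply: prm_ndvd_exp (qp z zX) _; apply: qD; rewrite ?mem_head //.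
by apply: contraNneq xD => <-.
Qed.

(** * Pullback of forms along polynomial matrices *)

Section ScalarForms.
Variables (R : idomainType) (n : nat).
Local Notation W := ({ffun {set 'I_n} -> R^o} : lmodType R).
Local Notation vec := ({ffun 'I_n -> R^o} : lmodType R).

Local Notation dltn := (@dlt R n).

Definition cofS p (f : seq vec -> R) : W :=
  [ffun I : {set 'I_n} => if #|I| == p then f (map dltn (enum I)) else 0].

Lemma hdeg_cofS p f : hdeg p (cofS p f).
Proof. by move=> I Ip; rewrite ffunE (negbTE Ip). Qed.

Lemma ev_cofS p f : altf p (f : seq vec -> R^o) -> ev (cofS p f) =1 f.
Proof.
move=> fa; apply: (@altf_ext R vec R^o p n dltn (ev (cofS p f)) f) => //.
- exact: dlt_span.
- exact/ev_altf/hdeg_cofS.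
by move=> I Ip; rewrite ev_dlt ffunE Ip eqxx.
Qed.

Definition mulv (X : 'M[R]_n) (x : vec) : vec := [ffun i => \sum_k x k * X k i].

Lemma mulv_lin X a x y : mulv X (a *: x + y) = a *: mulv X x + mulv X y.
Proof.
apply/ffunP => i; rewrite !ffunE scaler_sumr -big_split; apply: eq_bigr => k _.
by rewrite !ffunE mulrDl /GRing.scale /= mulrA.
Qed.

Lemma mulv_comp X Y x : mulv Y (mulv X x) = mulv (X *m Y) x.
Proof.
apply/ffunP => i; rewrite !ffunE.
transitivity (\sum_k \sum_j x j * X j k * Y k i).
  by apply: eq_bigr => k _; rewrite ffunE mulr_suml.
rewrite exchange_big; apply: eq_bigr => j _; rewrite mxE mulr_sumr.
by apply: eq_bigr => k _; rewrite mulrA.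
Qed.

Lemma mulv_scalar a x : mulv a%:M x = a *: x.
Proof.
apply/ffunP => i; rewrite !ffunE (bigD1 i) //= mxE eqxx big1.
  by rewrite addr0 mulrC.
by move=> k ki; rewrite mxE (negbTE ki) mulr0.
Qed.

Definition pbS X p (w : W) : W := cofS p (fun s => ev w (map (mulv X) s)).

Lemma ev_pbS X p (w : W) (s : seq vec) : hdeg p w -> ev (pbS X p w) s = ev w (map (mulv X) s).
Proof.
move=> wp; apply: ev_cofS.
apply: (@altf_comp R R vec (R^o) vec (R^o) id (mulv X) id p) => //.
- exact: mulv_lin.
- exact: ev_altf.
Qed.

Lemma pbS_lin X p a w v : pbS X p (a *: w + v) = a *: pbS X p w + pbS X p v.
Proof.
apply/ffunP => I; rewrite !ffunE; case: ifP => _; last by rewrite scaler0 addr0.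
exact: ev_linr.
Qed.

Fact pbS_linear X p : linear (pbS X p). Proof. by move=> a w v; apply: pbS_lin. Qed.
Definition pbSl X p : {linear W -> W} := mklin (@pbS_linear X p).

Lemma hdegZ p q (w : W) : hdeg p w -> hdeg p (q *: w).
Proof. by move=> wp I Ip; rewrite ffunE wp // scaler0. Qed.

Lemma hdeg_divZ p q (w : W) : q != 0 -> hdeg p (q *: w) -> hdeg p w.
Proof. by move=> q0 wp I /wp; rewrite ffunE => /eqP; rewrite mulf_eq0 (negbTE q0) => /eqP. Qed.

Lemma ev_scale_all (q : R) p (w : W) (s : seq vec) : hdeg p w -> ev w (map ( *:%R q) s) = q ^+ p * ev w s.
Proof.
elim: s p w => [|c s IHs] [|p] w wp //=; first by rewrite mul1r.
- by rewrite wp ?mulr0 ?cards0.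
- by rewrite !(hdeg0_contr _ wp) !ev_0 mulr0.
rewrite (@contr_linl _ _ _ q c (fun=> 0)) => [|i]; last by rewrite ffunE addr0.
have -> : contr (fun=> 0) w = 0.
  by apply/ffunP => I; rewrite !ffunE big1 // => i _; rewrite mulr0 mul0r.
by rewrite addr0 evZ (IHs p) ?exprS ?mulrA //; apply: hdeg_contr.
Qed.

Lemma ev_dvd_exp (q : R) p (w : W) (s : seq vec) : hdeg p w ->
  (forall x, x \in s -> forall i, dvdr q (x i)) -> dvdr (q ^+ p) (ev w s).
Proof.
move=> wp sq; have [t ->] : exists t, s = map ( *:%R q) t.
  elim: s sq => [|x s IHs] sq; first by exists [::].
  have [|t ->] := IHs; first by move=> z zs; apply: sq; rewrite inE zs orbT.
  have [g gE] := boolp.choice (sq x (mem_head _ _)).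
  by exists ([ffun i => g i] :: t) => /=; congr (_ :: _); apply/ffunP => i; rewrite !ffunE gE.
by rewrite (ev_scale_all _ _ wp); apply: dvdr_mulr.
Qed.

Lemma ev1_sum (w : W) (x : vec) : hdeg 1 w -> ev w [:: x] = \sum_k x k * ev w [:: dltn k].
Proof.
move=> wp; have xE : x = \sum_k x k *: (dltn k : vec).
  apply/ffunP => j; rewrite sum_ffunE (bigD1 j) //= !ffunE eqxx big1.
    by rewrite addr0 /GRing.scale /= mulr1.
  by move=> k kj; rewrite !ffunE eq_sym (negbTE kj) scaler0.
by rewrite {1}xE; apply: (altf_sum (ev_altf wp) [::] [::]).
Qed.

Lemma ev_lincomb (I : finType) (c : I -> R) (e : I -> W) (s : seq vec) :
  ev (\sum_i c i *: e i) s = \sum_i c i * ev (e i) s.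
Proof.
elim/big_rec2: _ => [|i x y _ <-]; first by rewrite ev_0.
exact: ev_linr.
Qed.

Definition form1 : W := [ffun I : {set 'I_n} => (I == set0)%:R].

Lemma hdeg_form1 : hdeg 0 form1.
Proof. by move=> I; rewrite ffunE cards_eq0 => /negbTE ->. Qed.

Lemma ev_wdg_form1 (a : 'I_n -> R) (x : vec) : ev (wdg a form1) [:: x] = \sum_k x k * a k.
Proof.
rewrite ev_wdg_cons (hdeg0_contr _ hdeg_form1) /= wdg_set0 subr0.
by rewrite ffunE eqxx mulr1.
Qed.

(** The determinant of [X] is nonzero as it divides a power of [q], so the adjugate of [X] cancels
    it on the left. *)
Lemma mx_scalar_comm (X Y : 'M[R]_n) q : q != 0 -> X *m Y = q%:M -> Y *m X = q%:M.
Proof.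
move=> q0 XY; have dX : \det X != 0.
  apply/negP => /eqP dX; have := congr1 determinant XY; rewrite det_mulmx dX mul0r det_scalar.
  by move=> /esym/eqP; rewrite expf_eq0 (negbTE q0) andbF.
have : (\det X)%:M *m (Y *m X - q%:M) = 0.
  by rewrite -mul_adj_mx -mulmxA mulmxBr mulmxA XY scalar_mxC subrr mulmx0.
rewrite mul_scalar_mx => e; apply/matrixP => i j; apply: (mulfI dX).
have := congr1 (fun Z : 'M_n => Z i j) e; rewrite !mxE => /eqP.
by rewrite mulrBr subr_eq0 => /eqP.
Qed.

Lemma div_linear (A : lmodType R) (f : {linear A -> W}) q : q != 0 ->
  (forall a I, dvdr q (f a I)) -> exists g : {linear A -> W}, forall a, q *: g a = f a.
Proof.
move=> q0 d; have d' a : exists g : W, q *: g = f a.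
  have [g gE] := boolp.choice (d a); exists [ffun I => g I].
  by apply/ffunP => I; rewrite !ffunE gE.
have [g gE] := boolp.choice d'.
have qI : injective ( *:%R q : W -> W).
  move=> x z xz; apply/ffunP => I; apply: (mulfI q0).
  by have := congr1 (fun w : W => w I) xz; rewrite !ffunE.
have gl : linear g.
  by move=> a x z; apply: qI; rewrite scalerDr scalerA mulrC -scalerA !gE linearP.
by exists (mklin gl) => a; rewrite mklinE.
Qed.

Definition trunc p (w : W) : W := [ffun I : {set 'I_n} => if #|I| == p then w I else 0].
Lemma hdeg_trunc p w : hdeg p (trunc p w).
Proof. by move=> I Ip; rewrite ffunE (negbTE Ip). Qed.
Lemma trunc_id p w : hdeg p w -> trunc p w = w.
Proof. by move=> wp; apply/ffunP => I; rewrite ffunE; case: eqP => // /eqP/wp. Qed.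
Fact trunc_linear p : linear (trunc p).
Proof.
move=> a x z; apply/ffunP => I; rewrite !ffunE.
by case: ifP; rewrite // scaler0 addr0.
Qed.

Definition truncl p : {linear W -> W} := mklin (@trunc_linear p).

(** Pulling back along [Th] and then [Ep] is pulling back along the scalar [q], which multiplies
    [p]-forms by [q ^+ p]. So the pullback along [Th] divided by [q], followed by [q] times the
    pullback along [Ep] divided by [q ^+ p], is the identity of [P], and it factors through a free
    module. *)
Lemma dual_forms_proj (P : submod W) p (Ep Th : 'M[R]_n) q : q != 0 -> Ep *m Th = q%:M ->
  (forall w, P w -> hdeg p w) ->
  (forall w I, P w -> dvdr q (pbS Th p w I)) ->
  (forall c I, hdeg p c -> dvdr (q ^+ p) (q * pbS Ep p c I)) ->
  (forall c w, hdeg p c -> hdeg p w -> q ^+ p *: w = q *: pbS Ep p c -> P w) ->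
  projective (subm P).
Proof.
move=> q0 EpTh Ph PTh PEp P_Ep; have qp0 : q ^+ p != 0 by rewrite expf_neq0.
pose f : {linear subm P -> W} := (pbSl Th p \o incl P)%FUN.
have [i iE] := div_linear (f := f) q0 (fun w I => PTh _ I (submP w)).
(* Divisibility is known for forms of degree [p] only; the truncation makes the map total on [W]. *)
pose h : {linear W -> W} := ( *:%R q \o (pbSl Ep p \o truncl p))%FUN.
have hq c I : dvdr (q ^+ p) (h c I) by rewrite ffunE; apply/PEp/hdeg_trunc.
have [r0 r0E] := div_linear (f := h) qp0 hq.
have r0h c : hdeg p (r0 c).
  by apply: (hdeg_divZ qp0); rewrite r0E; apply/hdegZ/hdeg_cofS.
have rP c : P (r0 c) := P_Ep _ _ (@hdeg_trunc p c) (r0h c) (r0E c).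
apply: (@proj_retract _ W (subm P) i (factor rP)); last exact: ffun_proj.
move=> w; apply: subm_inj; have wp := Ph _ (submP w); rewrite factorE.
have ih : hdeg p (i w) by apply: (hdeg_divZ q0); rewrite iE; apply: hdeg_cofS.
suff : forall s, ev (r0 (i w)) s = ev (sval_ w) s.
  by move=> e0; apply/ffunP => I; rewrite -[LHS]ev_dlt -[RHS]ev_dlt.
move=> s; apply: (mulfI qp0).
rewrite -[LHS]evZ r0E -[h _]/(q *: pbS Ep p (trunc p (i w))) (trunc_id ih) evZ ev_pbS //.
rewrite -evZ iE -[f w]/(pbS Th p (sval_ w)) ev_pbS //.
rewrite -(ev_scale_all _ _ wp) -map_comp; congr (ev _ _); apply: eq_map => x.
by rewrite /= mulv_comp EpTh mulv_scalar.
Qed.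

End ScalarForms.

Section FreeProj.
Variables (K : fieldType) (V : vectType K) (n : nat) (b : n.-tuple V).
Hypothesis bB : basis_of fullv b.
Local Notation S := {mpoly K[n]}.
Local Notation W := ({ffun {set 'I_n} -> S^o} : lmodType S).
Local Notation vec := ({ffun 'I_n -> S^o} : lmodType S).
Local Notation dltn := (@dlt S n).
Local Notation crd := (crd b).
Local Notation evV := (evV b).

(** The condition on constant vectors of [L] extends to polynomial vector fields tangent to [L]:
    write [w(s)] as [(alpha_L /\ w)(u, s) + (alpha_L /\ contr u w)(s)]. The first form has divisible
    coefficients, the second one is divisible on tangent fields. *)
Lemma ev_log_dvd L p (w : W) (s : seq vec) : hyperplane L -> hdeg p w ->
  (forall t : seq V, {subset t <= L} -> dvdr (lpoly b L) (evV w t)) ->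
  (forall x, x \in s -> dvdr (lpoly b L) (\sum_k x k * acof b (lform L) k)) ->
  dvdr (lpoly b L) (ev w s).
Proof.
move=> hL wp wL sL; have [u au] := lform_one hL.
have wL' t : {in t, forall x, lform L x = 0} -> dvdr (lpoly b L) (evV w t).
  by move=> /(lform_subset _ hL); apply: wL.
have dw := proj2 (dvd_wdgP bB au (lpoly b L) wp) wL'.
have -> : ev w s = ev (wdg (acof b (lform L)) w) (crd u :: s) +
    ev (wdg (acof b (lform L)) (contr (crd u) w)) s.
  by rewrite ev_wdg_cons (sum_acof bB) au mpolyC1 mul1r subrK.
by apply: dvdrD; [apply: ev_dvd | apply: ev_wdg_dvd].
Qed.

Variable B : seq {vspace V}.
Hypothesis uB : uniq B.
Hypothesis hB : forall L, L \in B -> hyperplane L.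
Local Notation Q := (\prod_(L <- B) lpoly b L).
Local Notation LpB p := (Lp b (mem B) p).

Lemma prod_lpoly_neq0 : Q != 0.
Proof.
rewrite prodf_seq_neq0; apply/allP => L LB /=.
by have [] := lpoly_prm bB (hB LB).
Qed.

Lemma Lp_prod_form1 (a : 'I_n -> S) : LpB 1 (Q *: wdg a (form1 _ n)).
Proof.
have h1 := hdeg_wdg a (@hdeg_form1 S n); split=> [I Ip|L LB s _].
  by rewrite ffunE h1 // scaler0.
by rewrite /evV evZ; apply/dvdrMr/dvdr_prod.
Qed.

(** This is [Q d alpha_L / alpha_L]; its expression in the generators will show that the dual vector
    fields are tangent to [L]. *)
Lemma Lp_dlog L : L \in B ->
  LpB 1 (\prod_(M <- B | M != L) lpoly b M *: wdg (acof b (lform L)) (form1 _ n)).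
Proof.
move=> LB; have h1 := hdeg_wdg (acof b (lform L)) (@hdeg_form1 S n).
split=> [I Ip|M MB s sM]; first by rewrite ffunE h1 // scaler0.
rewrite /evV evZ; have [ML|ML] := eqVneq M L.
  rewrite -[ev _ _]/(evV _ s) (evV_wdg_ker bB) ?mulr0; first exact: dvdr0.
  by apply/lform_subset; [exact: hB | rewrite -ML].
by apply/dvdrMr; rewrite -big_filter; apply: dvdr_prod; rewrite mem_filter ML.
Qed.

(* The matrices [Ep] of the generators and [Th] of the dual basis satisfy
   [Ep *m Th = Q]; pulling back along them identifies [Lp p] with the forms of
   degree [p] in the dual basis, up to the powers of [Q]. *)
Section DualBasis.
Variable e : 'I_n -> W.
Hypothesis eL : forall i, LpB 1 (e i).
Hypothesis e_gen : forall w, LpB 1 w -> exists c : 'I_n -> S, w = \sum_i c i *: e i.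

Definition Ep : 'M[S]_n := \matrix_(k, i) ev (e i) [:: dltn k].

Lemma mulv_Ep x i : mulv Ep x i = ev (e i) [:: x].
Proof.
rewrite ffunE (ev1_sum _ (proj1 (eL i))); apply: eq_bigr => k _.
by rewrite mxE.
Qed.

(** The entries of [Th] are the coordinates of the forms [Q dx_k] in the generators [e i]. *)
Lemma dual_ex : exists Th : 'M[S]_n, Ep *m Th = Q%:M.
Proof.
have [c cE] := boolp.choice (fun k => e_gen (Lp_prod_form1 (dltn k))).
exists (\matrix_(j, k) c k j); apply/matrixP => j k; rewrite !mxE.
have := congr1 (fun w : W => ev w [:: dltn j]) (cE k).
rewrite evZ ev_wdg_form1 ev_lincomb => h.
transitivity (\sum_i c k i * ev (e i) [:: dltn j]).
  by apply: eq_bigr => i _; rewrite /Ep !mxE mulrC.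
have dE i i' : dltn i i' = (i' == i)%:R by rewrite ffunE.
rewrite -h; have -> : \sum_i dltn j i * dltn k i = (j == k)%:R.
  rewrite (bigD1 j) //= big1 => [|i ij]; last by rewrite dE (negbTE ij) mul0r.
  by rewrite !dE eqxx addr0 mul1r.
by rewrite mulr_natr.
Qed.

Variable Th : 'M[S]_n.
Hypothesis EpTh : Ep *m Th = Q%:M.

(** Evaluate [Q d alpha_L / alpha_L], written as a combination of the [e i], on the [j]-th row of
    [Th]: there [e i] takes the value [Q] if [i = j] and 0 otherwise, so [alpha_L] of the row is
    [alpha_L] times a coefficient. *)
Lemma Th_log L j : L \in B ->
  dvdr (lpoly b L) (\sum_k mulv Th (dltn j) k * acof b (lform L) k).
Proof.
move=> LB; have [c cE] := e_gen (Lp_dlog LB).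
have := congr1 (fun w : W => ev w [:: mulv Th (dltn j)]) cE.
rewrite evZ ev_wdg_form1 ev_lincomb => h; exists (c j).
set R := \prod_(M <- B | M != L) lpoly b M in h.
have QR : Q = R * lpoly b L.
  rewrite (bigD1_seq L) //= mulrC; by [].
have R0 : R != 0.
  by have := prod_lpoly_neq0; rewrite QR mulf_eq0 negb_or => /andP[].
apply: (mulfI R0); rewrite h mulrA -QR.
have E i : ev (e i) [:: mulv Th (dltn j)] = (i == j)%:R * Q.
  rewrite -mulv_Ep mulv_comp (mx_scalar_comm prod_lpoly_neq0 EpTh) mulv_scalar.
  by rewrite !ffunE /GRing.scale /= mulrC.
transitivity (\sum_i c i * ((i == j)%:R * Q)); first by apply: eq_bigr => i _; rewrite E.
move: Q => q; rewrite (bigD1 j) //= big1 => [|i ij]; last by rewrite (negbTE ij) mul0r mulr0.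
by rewrite eqxx mul1r addr0 mulrC.
Qed.

Lemma pb_Th_dvd p w I : LpB p w -> dvdr Q (pbS Th p w I).
Proof.
move=> [wp wB]; rewrite ffunE; case: ifP => _; last exact: dvdr0.
apply: (lpoly_prod_dvd bB) => // L LB; apply: (ev_log_dvd (hB LB) wp); first exact: wB.
by move=> x /mapP[z /mapP[j _ ->] ->]; exact: (Th_log j LB).
Qed.

Lemma mulv_Ep_dvd L v i : L \in B -> v \in L -> dvdr (lpoly b L) (mulv Ep (crd v) i).
Proof.
move=> LB vL; rewrite mulv_Ep; have [_ /(_ L LB [:: v])] := eL i; apply.
by move=> x; rewrite inE => /eqP->.
Qed.

Lemma pb_Ep_altf p c : hdeg p c -> altf p (fun s => ev c (map (mulv Ep) (map crd s))).
Proof.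
move=> cp; have -> : (fun s => ev c (map (mulv Ep) (map crd s))) =
    (fun s => id (ev c (map (mulv Ep \o crd)%FUN s))).
  by apply: functional_extensionality_dep => s; rewrite map_comp.
apply: (@altf_comp K S V S vec (S^o) (@mpolyC n K) (mulv Ep \o crd)%FUN id p) => //.
- by move=> a x z; rewrite /= crd_lin mulv_lin.
- by move=> a x z; rewrite /= -mul_mpolyC.
- exact: ev_altf.
Qed.

Lemma pb_Ep_dvd L p c s : L \in B -> hdeg p c -> {subset s <= L} ->
  dvdr (lpoly b L ^+ p) (ev c (map (mulv Ep) (map crd s))).
Proof.
move=> LB cp sL; apply: (ev_dvd_exp cp) => x /mapP[z /mapP[v vs ->] ->] i.
by apply: mulv_Ep_dvd => //; apply: sL.
Qed.

(** At most one argument has to be taken outside [L]; the others contribute [p - 1] factors, and the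
    additional [lpoly b L] supplies the last one. *)
Lemma pb_Ep_dvd1 L p c s : L \in B -> hdeg p c ->
  dvdr (lpoly b L ^+ p) (lpoly b L * ev c (map (mulv Ep) (map crd s))).
Proof.
move=> LB cp; case: p cp => [|p] cp; first exact: dvd1r.
rewrite exprS; apply: dvdr_mul; first exact: dvdr_refl.
have [u au] := lform_one (hB LB).
apply: (altf_hyperplane (pb_Ep_altf cp) (Q := dvdK (lpoly b L ^+ p)) au) => t.
  move=> /(lform_subset _ (hB LB)) tL; apply: dvdr_trans (pb_Ep_dvd LB cp tL).
  exact: dvdr_exp.
move=> /(lform_subset _ (hB LB)) tL.
exact: (pb_Ep_dvd LB (hdeg_contr (mulv Ep (crd u)) cp) tL).
Qed.

Lemma pb_Ep_div p c I : hdeg p c -> dvdr (Q ^+ p) (Q * pbS Ep p c I).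
Proof.
move=> cp; rewrite -prodrXl; apply: (@prm_prod_exp_dvd _ _ (lpoly b) (fun=> p)) => // [L /hB|L M /hB hL /hB hM LM|L LB].
- exact: lpoly_prm.
- exact: (lpoly_ndvd2 bB).
rewrite ffunE; case: ifP => _; last by rewrite mulr0; apply: dvdr0.
have -> : map dltn (enum I) = map crd (map (tnth b) (enum I)).
  by rewrite -map_comp; apply: eq_map => i /=; rewrite (crd_tnth bB).
have [q ->] : dvdr (lpoly b L) Q by apply: dvdr_prod.
by rewrite mulrAC; apply/dvdrMr; apply: pb_Ep_dvd1.
Qed.

(** On vectors of [L] the pullback along [Ep] contains [alpha_L] to the power [p]. Against [Q ^+ p],
    the factor [Q] on the right leaves one [alpha_L] over for [w]. *)
Lemma pb_Ep_Lp p c w : hdeg p c -> hdeg p w -> Q ^+ p *: w = Q *: pbS Ep p c -> LpB p w.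
Proof.
move=> cp wp wE; split=> // L LB s sL; set q := \prod_(M <- B | M != L) lpoly b M.
have QR : Q = lpoly b L * q by rewrite (bigD1_seq L).
have [L0 L1 Lpr] := lpoly_prm bB (hB LB).
have q0 : ~ dvdr (lpoly b L) q.
  rewrite /q -big_filter => /(prm_prod_dvd_ex (lpoly_prm bB (hB LB)))[M].
  rewrite mem_filter => /andP[ML MB].
  by apply: (lpoly_ndvd2 bB (hB LB) (hB MB)); rewrite eq_sym.
have E : Q ^+ p * evV w s = Q * ev c (map (mulv Ep) (map crd s)).
  by rewrite /evV -evZ wE evZ ev_pbS.
have [g gE] := pb_Ep_dvd LB cp sL.
have : dvdr (lpoly b L) (q ^+ p * evV w s).
  exists (q * g); apply: (mulfI (expf_neq0 p L0)).
  transitivity (Q ^+ p * evV w s); first by rewrite QR exprMn mulrA.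
  by rewrite E gE QR; ring.
by case/Lpr => // /(prm_ndvd_exp (lpoly_prm bB (hB LB)) q0).
Qed.

Lemma Lp_proj_dual p : projective (subm (LpB p)).
Proof.
apply: (@dual_forms_proj S n (LpB p) p Ep Th Q prod_lpoly_neq0 EpTh).
- by move=> w [].
- by move=> w I; apply: pb_Th_dvd.
- by move=> c I; apply: pb_Ep_div.
- by move=> c w; apply: pb_Ep_Lp.
Qed.

End DualBasis.

Lemma Lp_proj p (e : 'I_n -> W) : (forall i, LpB 1 (e i)) ->
  (forall w, LpB 1 w -> exists c : 'I_n -> S, w = \sum_i c i *: e i) ->
  projective (subm (LpB p)).
Proof. by move=> eL eg; have [Th EpTh] := dual_ex eg; apply: (Lp_proj_dual eL eg EpTh). Qed.
End FreeProj.

(** * Gluing *)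

Lemma free_Lp_proj (K : fieldType) (V : vectType K) n (b : n.-tuple V)
    (bB : basis_of fullv b) (B : {fset {vspace V}}) p :
  arrangement B -> free_arrangement b B -> projective (subm (Lp b (mem B) p)).
Proof.
move=> aB [e eP]; have [i [ii is_]] := Omega_Lp bB 1 aB.
apply: (@Lp_proj _ _ _ b bB B (fset_uniq B) (fun L LB => aB L LB) p (fun k => sval_ (i (e k)))).
  by move=> k; apply: (submP (i (e k))).
move=> w wB; have [x xw] := is_ (mksub wB); have [c [xc _]] := eP x.
exists c; have -> : w = sval_ (i x) by rewrite xw.
rewrite xc linear_sum -[sval_ _]/(incl _ _) linear_sum; apply: eq_bigr => k _.
by rewrite !linearZ.
Qed.

Section Glue.
Variables (K : fieldType) (V : vectType K) (m : nat).
Variable H : {vspace V}.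
Hypothesis hH : hyperplane H.
Variable y : m.-tuple (subvs_of H).
Hypothesis yB : basis_of fullv y.
Local Notation Sb := {mpoly K[m]}.
Local Notation lam := (@lam K V m H y).
Local Notation lamform := (@lamform K V H).
Local Notation vs := (@vs K V H).

(** Forms without a common nonzero zero define an injective map into [K^k]; a left inverse writes
    each coordinate as their combination. *)
Lemma var_span (T : seq {vspace V}) :
  (forall x, (forall L, L \in T -> lamform L x = 0) -> x = 0) ->
  forall j, exists c : 'I_(size T) -> K, 'X_j = \sum_i c i *: lam (tnth (in_tuple T) i).
Proof.
move=> T0 j; set k := size T.
pose F0 x : 'rV[K]_k := \row_i (lamform (tnth (in_tuple T) i) x : K).
have F0l : linear F0.
  by move=> a x z; apply/rowP => i; rewrite !mxE linearP.
pose F := linfun (mklin F0l).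
have FE x : F x = F0 x by rewrite lfunE.
have kF : lker F == 0%VS.
  apply/lker0P => x z; rewrite !FE => xz; apply/eqP; rewrite -subr_eq0; apply/eqP/T0 => L.
  move=> /(tnthP (in_tuple T))[i ->]; rewrite linearB.
  have := congr1 (fun r : 'rV[K]_k => r 0 i) xz; rewrite !mxE => ->.
  exact: subrr.
exists (fun i => coord y j ((F^-1)%VF (delta_mx 0 i))).
rewrite -(fp_coord yB j).
transitivity (fp y (fun x => \sum_(i < k) coord y j ((F^-1)%VF (delta_mx 0 i)) *
    (lamform (tnth (in_tuple T) i) x : K))).
  apply: fp_ext => x; rewrite -{1}(lker0_lfunK kF x) FE [F0 x]row_sum_delta !linear_sum.
  by apply: eq_bigr => i _; rewrite !linearZ /= mxE mulrC.
rewrite /fp; transitivity (\sum_(i < m) \sum_(i0 < k)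
   (coord y j ((F^-1)%VF (delta_mx 0 i0)) * lamform (tnth (in_tuple T) i0) (tnth y i)) *: 'X_i : Sb).
  by apply: eq_bigr => i _; rewrite scaler_suml.
rewrite exchange_big; apply: eq_bigr => i _; rewrite /lam /fp scaler_sumr.
by apply: eq_bigr => l _; rewrite scalerA.
Qed.

Variables (W : lmodType Sb) (U N : submod W) (A : seq {vspace V}).
Hypothesis U_socle : forall z, N z -> (forall j, U ('X_j *: z)) -> U z.
Hypothesis U_loc : forall x, x != 0 -> forall z, N z ->
  U ((\prod_(L <- A | vs x \notin L) lam L) *: z).
Hypothesis hA : forall L, L \in A -> hyperplane L.

(* Induction on the number of [L] in [A] outside [T]. If the [L] in [T] meet [H]
   only in [0], then the [lam L] generate the maximal ideal; otherwise the
   factors of the product at a common nonzero point are cancelled one by one. *)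
Lemma glue_ind (T : seq {vspace V}) z : {subset T <= A} -> N z ->
  (forall L, L \in T -> U (lam L *: z)) -> U z.
Proof.
have [k] := ubnP (count [predC T] A); elim: k T z => // k IHk T z; rewrite ltnS => Tk TA Nz Tz.
have [[x x0 xT]|nx] := pselect (exists2 x, x != 0 & forall L, L \in T -> lamform L x = 0).
  have := U_loc x0 Nz; rewrite -big_filter.
  have : forall L : {vspace V}, L \in [seq L : {vspace V} <- A | vs x \notin L] -> (L \notin T) && (L \in A).
    move=> L; rewrite mem_filter => /andP[xL LA]; rewrite LA andbT.
    apply: contra xL => LT; apply: (in_lform (hA LA)).
    by rewrite -lamformE; apply: xT.
  elim: [seq L <- A | _] => [|L D IHD] DA; first by rewrite big_nil scale1r.
  rewrite big_cons -scalerA => Uz; apply: IHD.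
    by move=> M MD; apply: DA; rewrite inE MD orbT.
  have /andP[LT LA] := DA L (mem_head _ _).
  (* The outer induction applies to the product of the remaining factors times [z]: multiplied by
     [lam L] it is already in [U], and [L] leaves the complement of [T]. *)
  apply: (IHk (L :: T)) => [|M|| M].
  - apply: leq_trans Tk; rewrite -(cat_take_drop (index L A) A).
    rewrite !count_cat.
    rewrite (drop_nth L) ?index_mem // nth_index //= LT inE eqxx /= add0n add1n addnS ltnS.
    by apply: leq_add; apply: sub_count => M /=; rewrite inE negb_or => /andP[].
  - by rewrite inE => /orP[/eqP->|/TA].
  - exact: scarZ.
  - rewrite inE => /orP[/eqP->//|MT]; rewrite scalerA mulrC -scalerA.
    exact/scarZ/Tz.
apply: U_socle => // j; have [|c ->] := @var_span T _ j.
  by move=> x xT; apply/eqP/negPn/negP => x0; apply: nx; exists x.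
rewrite scaler_suml; apply: scar_sum => i _.
by rewrite -mul_mpolyC -scalerA; apply/scarZ/Tz; apply: mem_tnth.
Qed.

Lemma glue z : N z -> U z.
Proof. by move=> Nz; apply: (@glue_ind [::] z). Qed.

End Glue.

Lemma pdr_iso_inv (R : nzRingType) n (A B : lmodType R) (i : {linear A -> B}) :
  injective i -> surj i -> pdr n B -> pdr n A.
Proof.
move=> ii is_; have [j jK] := surj_section is_.
have jl : linear j by move=> a x y; apply: ii; rewrite linearP !jK.
apply: (@pdr_iso _ _ _ _ (mklin jl)) => [x y xy|x].
  by rewrite -(jK x) -(jK y) -[j x]/(mklin jl x) xy.
by exists (i x); apply: ii; rewrite mklinE jK.
Qed.

Section Transfer.
Variables (K : fieldType) (V : vectType K) (n : nat) (b : n.-tuple V).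
Hypothesis bB : basis_of fullv b.

Lemma Lp_eq_pdr (A B : {pred {vspace V}}) p k : A =i B ->
  pdr k (subm (Lp b A p)) -> pdr k (subm (Lp b B p)).
Proof.
move=> AB; have h (w : subm (Lp b A p)) : Lp b B p (incl _ w).
  by apply: (Lp_sub _ (submP w)) => L; rewrite AB.
apply: (@pdr_iso _ _ _ _ (factor h)) => [x z|x].
  by move=> /(congr1 (@sval_ _ _ _)) /= xz; apply: subm_inj.
have xA : Lp b A p (sval_ x) by apply: (Lp_sub _ (submP x)) => L; rewrite AB.
by exists (mksub xA); apply: subm_inj.
Qed.

Lemma pd_Omega (A : {fset {vspace V}}) p k : arrangement A ->
  pd_le (Omega b A p) k <-> pdr k (subm (Lp b (mem A) p)).
Proof.
move=> aA; have [i [ii is_]] := Omega_Lp bB p aA; split=> [/pd_le_pdr|].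
  exact: pdr_iso ii is_.
by move=> /(pdr_iso_inv ii is_); apply: pdr_pd_le.
Qed.

End Transfer.

(** * The restricted arrangement and its multiplicities *)

Section Restriction.
Variables (K : fieldType) (V : vectType K) (n m : nat) (b : n.-tuple V).
Hypothesis bB : basis_of fullv b.
Variable H : {vspace V}.
Hypothesis hH : hyperplane H.
Variable y : m.-tuple (subvs_of H).
Hypothesis yB : basis_of fullv y.
Local Notation Sb := {mpoly K[m]}.
Local Notation Wb := ({ffun {set 'I_m} -> Sb^o} : lmodType Sb).
Local Notation lam := (@lam K V m H y).
Local Notation lamform := (@lamform K V H).
Local Notation vs := (@vs K V H).

Definition preH (L : {vspace V}) : {vspace subvs_of H} :=
  (linfun (vsval : subvs_of H -> V) @^-1: L)%VS.

Lemma mem_preH L x : (x \in preH L) = (vs x \in L).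
Proof. by rewrite /preH -memv_preim lfunE /= vsE. Qed.

Lemma preH_lamform L x : hyperplane L -> (x \in preH L) = (lamform L x == 0 :> K).
Proof. by move=> hL; rewrite mem_preH -lform0 // lamformE. Qed.

Lemma eqvH_preH L L' : eqvH H L L' = (preH L == preH L').
Proof.
apply/eqP/eqP => e; apply/vspaceP => v.
  have := congr1 (fun U : {vspace V} => vs v \in U) e.
  have vH : vs v \in H by rewrite vsE subvsP.
  by rewrite /= !memv_cap vH !andbT !mem_preH.
rewrite !memv_cap; case vH: (v \in H); rewrite ?andbF // !andbT.
have [|x <-] := @vs_ex _ _ _ hH v; first exact: lform_in.
by rewrite -!mem_preH e.
Qed.

Lemma hyperplane_preH L : hyperplane L -> L != H -> hyperplane (preH L).
Proof.
move=> hL LH; have [x x0] := lamform_neq0 hH hL LH.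
pose f := linfun (lamform L).
have kf : lker f = preH L.
  by apply/vspaceP => z; rewrite memv_ker lfunE preH_lamform.
rewrite /hyperplane -kf; have := limg_ker_dim f fullv; rewrite capfv => <-.
have /eqP-> : \dim (limg f) == 1%N; last by rewrite addn1.
have d1 : (\dim (limg f) <= 1)%N.
  by apply: leq_trans (dimvS (subvf _)) _; rewrite dimvf.
rewrite eqn_leq d1 /=.
rewrite lt0n dimv_eq0; apply/negP => /eqP f0.
have : f x \in limg f by apply: memv_img; apply: memvf.
by rewrite f0 memv0 lfunE (negbTE x0).
Qed.

Lemma lpoly_preH L : hyperplane L -> L != H ->
  dvdr (lam L) (lpoly y (preH L)) /\ dvdr (lpoly y (preH L)) (lam L).
Proof.
move=> hL LH; have hX := hyperplane_preH hL LH.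
have [x x0] := lamform_neq0 hH hL LH; have [z z1] := lform_one hX.
have z0 : lform (preH L) z != 0 :> K by rewrite z1 oner_eq0.
have eq0 t : (lform (preH L) t == 0 :> K) = (lamform L t == 0 :> K).
  by rewrite lform0 // preH_lamform.
rewrite /lpoly /lam; split.
  rewrite (fp_proportional y (a' := lform (preH L)) x0) => [|t h]; last first.
    by apply/(@eqP K); rewrite eq0; apply/(@eqP K).
  apply/dvdr_scaler; last exact: dvdr_refl.
  by rewrite mulf_neq0 ?invr_eq0 ?eq0.
rewrite (fp_proportional y (a' := lamform L) z0) => [|t h]; last first.
  by apply/(@eqP K); rewrite -eq0; apply/(@eqP K).
apply/dvdr_scaler; last exact: dvdr_refl.
by rewrite mulf_neq0 ?invr_eq0 -?eq0.
Qed.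

Section Transversal.
Variable A' : seq {vspace V}.
Hypothesis A'u : uniq A'.
Hypothesis arr : forall L, L \in A' -> hyperplane L /\ L != H.
Variable R : seq {vspace subvs_of H}.
Hypothesis Ru : uniq R.
Hypothesis RP : forall X, X \in R <-> exists2 L, L \in A' & X = preH L.
Local Notation lR := (lpoly y).

Lemma R_preH L : L \in A' -> preH L \in R.
Proof. by move=> LA; apply/RP; exists L. Qed.

Lemma R_hyp X : X \in R -> hyperplane X.
Proof. by move=> /RP[L /arr[hL LH] ->]; apply: hyperplane_preH. Qed.

Definition kR X := count (fun L => preH L == X) A'.

Lemma mult_kR L : L \in A' -> mult H A' L = kR (preH L).
Proof.
move=> LA; apply: eq_in_count => M MA; have [hL LH] := arr LA; have [hM MH] := arr MA.
by rewrite /eqvG hL hM LH MH !andbT eqvH_preH eq_sym.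
Qed.

Lemma kR_gt0 X : X \in R -> (0 < kR X)%N.
Proof.
by move=> /RP[L LA ->]; rewrite -mult_kR //; apply: (mult_gt0 arr).
Qed.

Lemma preH_subset L (t : seq (subvs_of H)) : L \in A' ->
  {subset t <= preH L} <-> {in t, forall x, lamform L x = 0}.
Proof.
move=> /arr[hL _]; split=> h x xt.
  by apply/(@eqP K); rewrite -preH_lamform //; apply: h.
by rewrite preH_lamform //; apply/(@eqP K); apply: h.
Qed.

Lemma in_N2P p z : in_N2 y A' p z <-> Lp y (mem R) p z.
Proof.
split=> [[zp zA]|[zp zA]].
  split=> // X /RP[L LA ->] t tX; have [hL LH] := arr LA; apply: dvdr_trans (proj2 (lpoly_preH hL LH)) _.
  by apply: zA => //; apply/(preH_subset t LA).
split=> // L LA t tL; have [hL LH] := arr LA; apply: dvdr_trans (proj1 (lpoly_preH hL LH)) _.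
by apply: zA; [apply: R_preH | apply/(preH_subset t LA)].
Qed.

Lemma dvdr_expn (x z : Sb) k : dvdr x z -> dvdr (x ^+ k) (z ^+ k).
Proof. by move=> [q ->]; exists (q ^+ k); rewrite exprMn. Qed.

Lemma in_N1_restr p z : in_N1 y A' p z <-> hdeg p z /\ forall X, X \in R ->
  (forall t, dvdr (lR X ^+ (kR X).-1) (evV y z t)) /\
  (forall t, {subset t <= X} -> dvdr (lR X ^+ kR X) (evV y z t)).
Proof.
split=> [[zp zA]|[zp zA]].
  split=> // X /RP[L LA ->]; have [hL LH] := arr LA; have [z1 z2] := zA L LA; have [_ d] := lpoly_preH hL LH.
  rewrite -mult_kR //; split=> t => [|tX]; first exact: dvdr_trans (dvdr_expn _ d) (z1 t).
  by apply: dvdr_trans (dvdr_expn _ d) (z2 t _); apply/(preH_subset t LA).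
split=> // L LA; have [hL LH] := arr LA; have [z1 z2] := zA _ (R_preH LA); have [d _] := lpoly_preH hL LH.
rewrite mult_kR //; split=> t => [|tX]; first exact: dvdr_trans (dvdr_expn _ d) (z1 t).
by apply: dvdr_trans (dvdr_expn _ d) (z2 t _); apply/(preH_subset t LA).
Qed.

(** Up to a constant, the quotient of the restriction of [Q(A')] to [H] by [Q(A^H)]. *)
Definition PR : Sb := \prod_(X <- R) lR X ^+ (kR X).-1.

Lemma lR_neq0 X : X \in R -> lR X != 0.
Proof. by move=> /R_hyp/(lpoly_prm yB)[]. Qed.

Lemma PR_neq0 : PR != 0.
Proof.
by rewrite prodf_seq_neq0; apply/allP => X XR /=; rewrite expf_neq0 ?lR_neq0.
Qed.

Lemma PR_split X : X \in R -> exists2 q, PR = lR X ^+ (kR X).-1 * q & ~ dvdr (lR X) q.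
Proof.
move=> XR; have pX := lpoly_prm yB (R_hyp XR).
exists (\prod_(Y <- R | Y != X) lR Y ^+ (kR Y).-1); first by rewrite /PR (bigD1_seq X).
rewrite -big_filter => /(prm_prod_dvd_ex pX)[Y].
rewrite mem_filter => /andP[YX YR]; apply: (prm_ndvd_exp pX).
by apply: (lpoly_ndvd2 yB) (R_hyp XR) (R_hyp YR) _; rewrite eq_sym.
Qed.

(** The forms of distinct traces are coprime primes, so the powers [kR X - 1] dividing all values
    can be divided out together; the one factor left on [X] is the condition of [Lp]. *)
Lemma in_N1P p z : in_N1 y A' p z <-> exists2 w, Lp y (mem R) p w & z = PR *: w.
Proof.
rewrite in_N1_restr; split=> [[zp zR]|[w [wp wR] ->]].
  have dz I : dvdr PR (z I).
    apply: prm_prod_exp_dvd => // [X /R_hyp|X Y /R_hyp hX /R_hyp hY XY|X XR].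
    - exact: (lpoly_prm yB).
    - exact: (lpoly_ndvd2 yB).
    - by rewrite -(evV_tnth yB); apply: (proj1 (zR X XR)).
  have [w wE] := boolp.choice dz; pose x : Wb := [ffun I => w I].
  have zE : z = PR *: x by apply/ffunP => I; rewrite !ffunE wE.
  exists x => //; split=> [I Ip|X XR t tX].
    by apply: (mulfI PR_neq0); rewrite mulr0 -(zp I Ip) zE !ffunE.
  have [q Pq qX] := PR_split XR; have := proj2 (zR X XR) t tX.
  have [_ _ pX] := lpoly_prm yB (R_hyp XR).
  rewrite zE /evV evZ Pq -{1}(prednK (kR_gt0 XR)) exprSr -mulrA.
  by move=> /(dvdr_mul2l (expf_neq0 _ (lR_neq0 XR)))/pX[].
split=> [I Ip|X XR]; first by rewrite ffunE wp // scaler0.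
have [q Pq _] := PR_split XR; split=> t => [|tX]; rewrite /evV evZ Pq.
  by rewrite -mulrA; apply: dvdr_mulr.
rewrite -{1}(prednK (kR_gt0 XR)) exprSr -mulrA.
by apply: dvdr_mul; [apply: dvdr_refl | apply/dvdrMl/wR].
Qed.

End Transversal.
End Restriction.

(** * Tameness *)

Lemma no_socle_eq (K : fieldType) m k (W : lmodType {mpoly K[m]}) (U : submod W) z :
  m = k.+2 -> projective W -> pdr k (subm U) -> (forall i, U ('X_i *: z)) -> U z.
Proof. by move=> mk; subst m; apply: no_socle. Qed.

Section Main.
Variables (K : fieldType) (V : vectType K) (n m : nat) (b : n.-tuple V).
Hypothesis bB : basis_of fullv b.
Variable H : {vspace V}.
Hypothesis hH : hyperplane H.
Variable y : m.-tuple (subvs_of H).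
Hypothesis yB : basis_of fullv y.
Variable u : V.
Local Notation aH := (lform H).
Hypothesis au : aH u = 1.
Local Notation S := {mpoly K[n]}.
Local Notation Sb := {mpoly K[m]}.
Local Notation Wb := ({ffun {set 'I_m} -> Sb^o} : lmodType Sb).
Local Notation vs := (@vs K V H).
Local Notation rpi := (@rpi K V n m b H y).
Local Notation lam := (@lam K V m H y).
Variable A' : seq {vspace V}.
Hypothesis A'u : uniq A'.
Hypothesis arr : forall L, L \in A' -> hyperplane L /\ L != H.
Variable R : seq {vspace subvs_of H}.
Hypothesis Ru : uniq R.
Hypothesis RP : forall X, X \in R <-> exists2 L, L \in A' & X = preH H L.
Local Notation LA' p := (Lp b (mem A') p).
Local Notation LA p := (Lp b (AH H (mem A')) p).
Local Notation LR p := (Lp y (mem R) p).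

Local Notation loc x := [seq L : {vspace V} <- A' | vs x \in L].
Hypothesis loc_proj : forall x, x != 0 -> forall p, projective (subm (Lp b (mem (loc x)) p)).
Hypothesis loc_projH : forall x, x != 0 -> forall p,
  projective (subm (Lp b (AH H (mem (loc x))) p)).
Hypothesis A'_tame : forall p, (p <= n)%N -> pdr p (subm (LA' p)).

Local Notation im f := (imres (rsgK bB hH yB u) f).
Local Notation r1 := (@r1 K V n m b H y (mem A')).
Local Notation r2 := (@r2 K V n m b H y (mem A') u).

Lemma ses1 p : exists (i : {linear subm (LA p) -> subm (LA' p)})
    (f : {linear subm (LA' p) -> restr rpi (subm (im (r1 p)))}), ses i f.
Proof.
exists (i1 bB hH yB (mem A') p), (imres_fun (rsgK bB hH yB u) (r1 p)).
by apply: imres_ses; [apply: i1_inj | apply: i1_exact].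
Qed.

Lemma ses2 p : exists (i : {linear subm (LA' p.+1) -> subm (LA p.+1)})
    (f : {linear subm (LA p.+1) -> restr rpi (subm (im (r2 p)))}), ses i f.
Proof.
have arr' L : L \in mem A' -> hyperplane L /\ L != H by apply: arr.
exists (i2 b H (mem A') p.+1), (imres_fun (rsgK bB hH yB u) (r2 p)).
by apply: imres_ses; [apply: i2_inj | apply: i2_exact].
Qed.

Lemma restr_up k (M : lmodType Sb) : pdr k M -> pdr k.+1 (restr rpi M).
Proof.
exact: (pdr_restr (rsgK bB hH yB u) (rpi_lpolyH bB hH yB au) (lpolyH_reg bB hH)
  (rsg_rpi_div bB hH yB au)).
Qed.

Lemma restr_down k (M : lmodType Sb) : pdr k.+1 (restr rpi M) -> pdr k M.
Proof.
exact: (pdr_restr_down (rsgK bB hH yB u) (rpi_lpolyH bB hH yB au) (lpolyH_reg bB hH)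
  (rsg_rpi_div bB hH yB au)).
Qed.

Lemma pdr_subWb (U : submod Wb) : pdr m.-1 (subm U).
Proof.
apply: (@pdr_sub_proj _ _ _ Wb (incl U)); last exact: ffun_proj.
exact: subm_inj.
Qed.

(** A crude bound independent of the induction: the image of restriction lies in a free [Sb]-module,
    so its dimension is at most [m.-1] over [Sb] and one more over [S]. *)
Lemma pdr_LA_up p : (p <= n)%N -> pdr (maxn p m.-1) (subm (LA p)).
Proof.
move=> pn; have [i [f e]] := ses1 p; apply: (pdr_ses_left e).
  exact: pdr_le (leq_maxl _ _) (A'_tame pn).
apply: restr_up; exact: pdr_le (leq_maxr _ _) (pdr_subWb _).
Qed.

Lemma loc_uniq x : uniq (loc x). Proof. exact: filter_uniq. Qed.

Lemma loc_arr x L : L \in loc x -> hyperplane L /\ L != H.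
Proof. by rewrite mem_filter => /andP[_ /arr]. Qed.

(** Since [x] lies in [H], all hyperplanes with the same trace as [L] contain [x] when [L] does. *)
Lemma loc_mult x L : L \in loc x -> mult H (loc x) L = mult H A' L.
Proof.
move=> Lx; rewrite /mult count_filter; apply: eq_in_count => M MA /=.
case: (boolP (eqvG H L M)) => //= e.
move: Lx; rewrite mem_filter => /andP[xL LA].
have [hM _] := arr MA; have [hL _] := arr LA.
apply: (in_lform hM); rewrite -lamformE; apply: (eqvG_lamform hH e).
by rewrite lamformE; apply: lform_in.
Qed.

Lemma N1_loc x p z : in_N1 y A' p z -> in_N1 y (loc x) p z.
Proof.
move=> [zp zA]; split=> // L Lx; rewrite loc_mult //; apply: zA.
by move: Lx; rewrite mem_filter => /andP[].
Qed.

Lemma N2_loc x p z : in_N2 y A' p z -> in_N2 y (loc x) p z.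
Proof.
move=> [zp zA]; split=> // L Lx; apply: zA.
by move: Lx; rewrite mem_filter => /andP[].
Qed.

Local Notation fx x := (\prod_(L <- A' | vs x \notin L) lpoly b L).

Lemma rpi_fx x : rpi (fx x) = \prod_(L <- A' | vs x \notin L) lam L.
Proof.
by rewrite (rmorph_prod rpi); apply: eq_bigr => L _; apply: rpi_lpoly.
Qed.

Lemma dvdr_fx x L : L \in A' -> vs x \notin L -> dvdr (lpoly b L) (fx x).
Proof.
by move=> LA xL; rewrite -big_filter; apply: dvdr_prod; rewrite mem_filter xL.
Qed.

Lemma Lp_fx x p w : Lp b (mem (loc x)) p w -> LA' p (fx x *: w).
Proof.
move=> [wp wA]; split=> [I Ip|L LA s sL]; first by rewrite ffunE wp // scaler0.
rewrite /evV evZ; case: (boolP (vs x \in L)) => xL; last exact/dvdrMr/dvdr_fx.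
have Lx : L \in loc x by rewrite mem_filter xL.
by apply: dvdrMl; apply: (wA L Lx).
Qed.

Lemma LpH_fx x p w : Lp b (AH H (mem (loc x))) p w -> LA p (fx x *: w).
Proof.
move=> [wp wA]; split=> [I Ip|L LA s sL]; first by rewrite ffunE wp // scaler0.
have [Lx|Lx] := boolP (L \in AH H (mem (loc x))).
  by rewrite /evV evZ; apply: dvdrMl; apply: (wA L Lx).
move: LA Lx; rewrite !in_AH; case: eqP => //= _ LA Lx.
rewrite /evV evZ; apply/dvdrMr/dvdr_fx => //.
apply: contra Lx => xL; rewrite -[_ \in _]/(L \in loc x) mem_filter xL; exact: LA.
Qed.

(** Lift [z] for the hyperplanes through [x], where freeness is assumed; multiplying the lift by the
    forms of the others makes it logarithmic for all of [A']. *)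
Lemma im1_loc x p z : x != 0 -> in_N1 y A' p z ->
  im (r1 p) ((\prod_(L <- A' | vs x \notin L) lam L) *: z).
Proof.
move=> x0 /(N1_loc x) zN.
have [w wA <-] := im_N1 bB hH yB (loc_uniq x) (@loc_arr x) au (@loc_proj x x0 p)
  (@loc_projH x x0 p) zN.
rewrite -rpi_fx -rs_scale; by exists (mksub (Lp_fx wA)).
Qed.

Lemma im2_loc x p z : x != 0 -> in_N2 y A' p z ->
  im (r2 p) ((\prod_(L <- A' | vs x \notin L) lam L) *: z).
Proof.
move=> x0 /(N2_loc x) zN.
have [w wA <-] := im_N2 bB hH yB (@loc_arr x) au (@loc_proj x x0 p.+1)
  (@loc_projH x x0 p.+1) zN.
rewrite -rpi_fx -rs_scale -contrZ; by exists (mksub (LpH_fx wA)).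
Qed.

Lemma im1_N1 k p z : m = k.+2 -> pdr k (subm (im (r1 p))) ->
  in_N1 y A' p z -> im (r1 p) z.
Proof.
move=> mk pU /(in_N1P hH yB arr Ru RP)[w wR ->].
pose f : {linear subm (LR p) -> Wb} := ( *:%R (PR y A' R) \o incl (LR p))%FUN.
have fN x : in_N1 y A' p (f x).
  by apply/(in_N1P hH yB arr Ru RP); exists (sval_ x); first exact: submP.
apply: (@glue _ _ _ H y yB Wb (im (r1 p)) (imsub f) A') => [x _|x x0 _ [w' <-]|L LA|].
- exact: (no_socle_eq mk (@ffun_proj _ _) pU).
- exact: im1_loc.
- by have [] := arr LA.
- by exists (mksub wR).
Qed.

Lemma im2_N2 k p z : m = k.+2 -> pdr k (subm (im (r2 p))) -> LR p z -> im (r2 p) z.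
Proof.
move=> mk pU; apply: (@glue _ _ _ H y yB Wb (im (r2 p)) (LR p) A') => [x _|x x0 x' xN|L LA].
- exact: (no_socle_eq mk (@ffun_proj _ _) pU).
- by apply: im2_loc => //; apply/(in_N2P hH y arr RP).
- by have [] := arr LA.
Qed.

(** The bound [k] makes the gluing apply, so that multiplication by [PR] is an isomorphism onto the
    image; any bound [j] is then transferred. *)
Lemma im1_LR k j p : m = k.+2 -> pdr k (subm (im (r1 p))) ->
  pdr j (subm (im (r1 p))) -> pdr j (subm (LR p)).
Proof.
move=> mk pU; pose f : {linear subm (LR p) -> Wb} := ( *:%R (PR y A' R) \o incl (LR p))%FUN.
have fU x : im (r1 p) (f x).
  apply: (im1_N1 mk pU); apply/(in_N1P hH yB arr Ru RP).
  by exists (sval_ x); first exact: submP.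
apply: (@pdr_iso_inv _ _ _ _ (factor fU)) => [x x' /(congr1 (@sval_ _ _ _)) /= h|x].
  apply: subm_inj; apply/ffunP => I; have := congr1 (fun w : Wb => w I) h.
  by rewrite !ffunE; apply: mulfI; apply: (PR_neq0 hH yB arr RP).
have [w wE] := submP x.
have /(in_N1P hH yB arr Ru RP)[v vR vE] : in_N1 y A' p (sval_ x).
  by rewrite -wE; exact: (rs_N1 bB hH yB A'u arr (submP w)).
by exists (mksub vR); apply: subm_inj.
Qed.

Lemma LR_im2 k j p : m = k.+2 -> pdr k (subm (im (r2 p))) ->
  pdr j (subm (LR p)) -> pdr j (subm (im (r2 p))).
Proof.
move=> mk pU; have fU (x : subm (LR p)) : im (r2 p) (incl _ x).
  exact: (im2_N2 mk pU (submP x)).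
apply: (@pdr_iso _ _ _ _ (factor fU)) => [x x' /(congr1 (@sval_ _ _ _)) /= h|x].
  exact: subm_inj.
have [w wE] := submP x.
have vR : LR p (sval_ x).
  by rewrite -wE; apply/(in_N2P hH y arr RP); exact: (rs_N2 bB hH yB arr au (submP w)).
by exists (mksub vR); apply: subm_inj.
Qed.

Lemma small_degree p : (p < m.-1)%N -> exists2 k, m = k.+2 & (p <= k)%N.
Proof. by case: m => [|[|k]] //= pk; exists k. Qed.

(** The image of restriction gets the bound [p.+1] over [S], hence [p] over [Sb]. In low degree this
    is at most [m - 2], so the image is a copy of [LR p]. *)
Lemma LR_step p : (p <= n)%N -> pdr p (subm (LA p)) -> pdr p (subm (LR p)).
Proof.
move=> pn pLA; have [mp|/small_degree[k mk pk]] := leqP m.-1 p.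
  exact: pdr_le mp (pdr_subWb _).
have [i [f e]] := ses1 p.
have pI := restr_down (pdr_ses_right e pLA (pdrS (A'_tame pn))).
exact: (im1_LR mk (pdr_le pk pI) pI).
Qed.

(** The bound is used twice. The crude one for [LA p.+1] bounds the image of the residue by [m - 2],
    enough to identify it with [LR p]; the known dimension of [LR p] then gives the sharp bound. *)
Lemma LA_step p : (p < n)%N -> pdr p (subm (LR p)) -> pdr p.+1 (subm (LA p.+1)).
Proof.
move=> pn pLR; have up := pdr_LA_up pn; have [mp|/small_degree[k mk pk]] := leqP m.-1 p.+1.
  by rewrite (maxn_idPl mp) in up.
have {}up : pdr k.+1 (subm (LA p.+1)) by apply: pdr_le up; rewrite mk geq_max leqnn ltnW.
have [i [f e]] := ses2 p.
have pI := restr_down (pdr_ses_right e (pdr_le pk (A'_tame pn)) up).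
exact: (pdr_ses_mid e (A'_tame pn) (restr_up (LR_im2 mk pI pLR))).
Qed.

Lemma Lp_tame p : (p <= n)%N -> pdr p (subm (LA p)) /\ pdr p (subm (LR p)).
Proof.
elim: p => [|p IHp] pn.
  have p0 : pdr 0 (subm (LA 0)).
    have arr' L : L \in mem A' -> hyperplane L /\ L != H by apply: arr.
    exact: (pdr_iso (i2_inj bB hH (A':=mem A') (p:=0)) (i2_surj0 bB hH arr' au) (A'_tame (leq0n n))).
  by split=> //; apply: LR_step.
have [_ /(LA_step pn) pLA] := IHp (ltnW pn).
by split=> //; apply: LR_step.
Qed.

End Main.

Lemma std_basisP (K : fieldType) l : basis_of fullv (std_basis K l).
Proof.
rewrite basisEdim size_tuple dimvf /dim /= mul1n leqnn andbT.
apply/subvP => v _; rewrite [v]row_sum_delta; apply: memv_suml => i _.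
have -> : delta_mx 0 i = tnth (std_basis K l) i by rewrite tnth_mktuple.
exact/memvZ/memv_span/mem_tnth.
Qed.

Section Arrangement.
Variables (K : fieldType) (V : vectType K) (n m : nat) (b : n.-tuple V).
Hypothesis bB : basis_of fullv b.
Variables (A' : {fset {vspace V}}) (H : {vspace V}).
Hypothesis aA' : arrangement A'.
Hypothesis hH : hyperplane H.
Hypothesis HA' : H \notin A'.
Local Notation A := (H |` A')%fset.
Local Notation vs := (@vs K V H).
Variable y : m.-tuple (subvs_of H).
Hypothesis yB : basis_of fullv y.

Lemma arr_neq L : L \in A' -> hyperplane L /\ L != H.
Proof. by move=> LA; split; [exact: aA' | apply: contraNneq HA' => <-]. Qed.

Lemma arrangement_add : arrangement A.
Proof. by move=> L; rewrite in_fset1U => /orP[/eqP->|/aA']. Qed.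

Lemma restrictionP X : X \in restriction A H <-> exists2 L, L \in A' & X = preH H L.
Proof.
rewrite /restriction; split=> [/imfsetP[L /= LA ->]|[L LA ->]].
  by exists L => //; move: LA; rewrite in_fsetD1 in_fset1U => /andP[/negbTE->].
apply/imfsetP; exists L => //=; rewrite in_fsetD1 in_fset1U LA orbT.
by have [_ ->] := arr_neq LA.
Qed.

Lemma arrangement_restriction : arrangement (restriction A H).
Proof. by move=> X /restrictionP[L /arr_neq[hL LH] ->]; apply: hyperplane_preH. Qed.

Hypothesis A'_tame : tame b A'.
Hypothesis A'_loc : locally_free_along b A' H.
Hypothesis A_loc : locally_free_along b A H.

Lemma tame_add_restriction p : (p <= n)%N ->
  pd_le (Omega b A p) p /\ pd_le (Omega y (restriction A H) p) p.
Proof.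
move=> pn; have [u au] := lform_one hH.
have locE (B : {fset {vspace V}}) x : arrangement B -> arrangement (localization B x).
  by move=> aB L; rewrite !inE => /andP[/aB].
have locH (x : subvs_of H) : vs x \in H by rewrite vsE subvsP.
have loc0 (x : subvs_of H) : x != 0 -> vs x != 0.
  by apply: contra => /eqP x0; apply/eqP/subvs_inj; rewrite -vsE x0 linear0.
have [] := @Lp_tame K V n m b bB H hH y yB u au A' (fset_uniq A') arr_neq
    (restriction A H) (fset_uniq _) restrictionP _ _ _ p pn.
- move=> x x0 q; have := free_Lp_proj bB (p := q) (locE _ _ aA') (A'_loc (locH x) (loc0 _ x0)).
  apply: (@Lp_eq_pdr _ _ _ b _ _ q 0) => L.
  by rewrite !inE mem_filter andbC.
- move=> x x0 q.
  have := free_Lp_proj bB (p := q) (locE _ _ arrangement_add) (A_loc (locH x) (loc0 _ x0)).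
  apply: (@Lp_eq_pdr _ _ _ b _ _ q 0) => L.
  rewrite in_AH !inE mem_filter; case: eqP => [->|_] /=; first exact: locH.
  by rewrite andbC.
- by move=> q qn; apply/(pd_Omega bB q q aA')/A'_tame.
move=> pA pR; split; last exact/(pd_Omega yB _ _ arrangement_restriction).
apply/(pd_Omega bB _ _ arrangement_add).
apply: Lp_eq_pdr pA => L; by rewrite in_AH in_fset1U.
Qed.

End Arrangement.

Theorem theorem1p5 (K : fieldType) (l : nat)
    (A' : {fset {vspace 'rV[K]_l}}) (H : {vspace 'rV[K]_l}) :
  let A := (H |` A')%fset in
  let x := std_basis K l in
  arrangement A' -> hyperplane H -> H \notin A' ->
  tame x A' ->
  locally_free_along x A' H ->
  locally_free_along x A H ->
  tame x A /\
  (forall y : (l.-1).-tuple (subvs_of H),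
     basis_of {:subvs_of H} y -> tame y (restriction A H)).
Proof.
move=> A x aA' hH HA' tA' lA' lA; have xB := std_basisP K l.
have main m (y : m.-tuple (subvs_of H)) (yB : basis_of fullv y) :=
  tame_add_restriction xB aA' hH HA' yB tA' lA' lA.
(* The first claim mentions no basis of [H]; an arbitrary one is supplied to run the joint
   induction. *)
split=> [p pl|y yB p pl]; first by have [] := main _ _ (vbasisP fullv) p pl.
by have [] := main _ y yB p (leq_trans pl (leq_pred l)).
Qed.
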